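(* Let $(M,J)$ be an almost complex manifold of real dimension $2n$, let $D$ be a domain in $M$ and let $p\in\bar D$. Let $U$ be a neighborhood of $p$ in $M$ (not necessarily contained in $D$) and let $z:U\to\mathbb B$ be a diffeomorphism adapted to $p$ in the sense defined in the context. Let $u$ be a $\mathcal C^2$ function on $\bar D$, negative and $J$-plurisubharmonic on $D$. Assume that $-L\le u<0$ on $D\cap U$ and that $u-c|z|^2$ is $J$-plurisubharmonic on $D\cap U$, where $c$ and $L$ are positive constants. Then there exist a positive constant $s$ and a neighborhood $V\subset\subset U$ of $p$, depending on $c$ and $L$ only (in particular, with $(M,J)$, $p$, $U$, $z$ fixed, not on the function $u$ or the domain $D$), such that for every $q\in D\cap V$ and every $v\in T_qM$ $$K_{(D,J)}(q,v)\ \ge\ s\,K_{(D\cap U,J)}(q,v).$$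
   Context: An almost complex structure on $M$ is a smooth bundle endomorphism $J$ of $TM$ with $J^2=-\mathrm{Id}$. $\mathbb B$ is the open unit ball of $\mathbb C^n$, $J_{st}$ the standard complex structure on $\mathbb C^n$ (any $n$), $|\cdot|$ the Euclidean norm, and $\Delta\subset\mathbb C$ the open unit disc with coordinate $\zeta=x+iy$. A smooth map $f:\Delta\to M$ is a $J$-holomorphic disc if $df\circ J_{st}=J\circ df$. An upper semicontinuous function $u$ is $J$-plurisubharmonic if $u\circ f$ is subharmonic on $\Delta$ for every $J$-holomorphic disc $f$ in its domain of definition. Kobayashi-Royden infinitesimal pseudometric: for an almost complex manifold $(N,J)$, $p\in N$, $v\in T_pN$, $K_{(N,J)}(p,v)$ is the infimum of all $\alpha>0$ such that there is a $J$-holomorphic disc $f:\Delta\to N$ with $f(0)=p$ and $df(0)(\partial/\partial x)=v/\alpha$. Adapted diffeomorphism: a diffeomorphism $z:U\to\mathbb B$ such that $z(p)=0$, $dz(p)\circ J(p)\circ dz^{-1}(0)=J_{st}$ and, for some $r\in(0,1)$, some smooth nondecreasing function $\theta_r$ on $\mathbb R^+$ with $\theta_r(s)=s$ for $s\le r/3$ and $\theta_r(s)=1$ for $s\ge 2r/3$, and some positive constants $A,B$, the function $\log(\theta_r(|z|^2))+\theta_r(A|z|)+B|z|^2$ is $J$-plurisubharmonic on $U$. (Such a neighborhood $U$ and diffeomorphism exist at every point of $M$.) $V\subset\subset U$ means that $V$ is relatively compact in $U$. *)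

(* Defs.v *)
From mathcomp Require Import all_boot all_order all_algebra.
From mathcomp Require Import all_classical all_reals all_analysis.

Set Implicit Arguments.
Unset Strict Implicit.
Unset Printing Implicit Defensive.

Import Order.TTheory GRing.Theory Num.Theory.
Import numFieldNormedType.Exports.

Local Open Scope classical_set_scope.
Local Open Scope ring_scope.

(* f is of class C^k on the open set A: all iterated directional derivatives
   up to order k exist and are continuous. *)
Fixpoint Ck (R : realType) (V W : normedModType R) (k : nat) (A : set V)
    (f : V -> W) : Prop :=
  if k is k'.+1 then
    (forall x, A x -> differentiable f x) /\
    (forall v, Ck k' A (fun x => 'D_v f x))
  else forall x, A x -> {for x, continuous f}.

Definition smooth (R : realType) (V W : normedModType R) (A : set V)
  (f : V -> W) : Prop := forall k, Ck k A f.

(* The library's norm on row vectors is the sup norm; its topology is the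
   Euclidean one. *)
Definition enorm (R : realType) (m : nat) (x : 'rV[R]_m) : R :=
  Num.sqrt (\sum_(i < m) x ord0 i ^+ 2).

(* C^n is 'rV[R]_(n + n), with x + i y encoded as row_mx x y; linear maps act
   by multiplication on the right, so v *m Jst R n is i v. *)
Definition Jst (R : realType) (n : nat) : 'M[R]_(n + n) :=
  block_mx 0 1%:M (- 1%:M) 0.

Definition unit_ball (R : realType) (m : nat) : set 'rV[R]_m :=
  [set x | enorm x < 1].

Definition cplx (R : realType) (x y : R) : 'rV[R]_(1 + 1) :=
  row_mx x%:M y%:M.

Definition disc (R : realType) : set 'rV[R]_(1 + 1) := @unit_ball R (1 + 1).

(* chart_inv is only meaningful on the image of chart_dom. *)
Record chart (R : realType) (M : topologicalType) (m : nat) := Chart {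
  chart_dom : set M ;
  chart_fun :> M -> 'rV[R]_m ;
  chart_inv : 'rV[R]_m -> M ;
  chart_dom_open : open chart_dom ;
  chart_im_open : open (chart_fun @` chart_dom) ;
  chart_funK : forall x, chart_dom x -> chart_inv (chart_fun x) = x ;
  chart_fun_cont : forall x, chart_dom x -> {for x, continuous chart_fun} ;
  chart_inv_cont : forall y, (chart_fun @` chart_dom) y ->
    {for y, continuous chart_inv}
}.

(* A smooth structure of dimension m on M.  The atlas need not be maximal;
   chart_at p is a preferred chart around p, through which T_pM is identified
   with 'rV[R]_m. *)
Record manifold (R : realType) (M : topologicalType) (m : nat) := Manifold {
  atlas : set (chart R M m) ;
  chart_at : M -> chart R M m ;
  chart_at_atlas : forall p, atlas (chart_at p) ;
  chart_at_dom : forall p, chart_dom (chart_at p) p ;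
  atlas_compat : forall c d, atlas c -> atlas d ->
    smooth (c @` (chart_dom c `&` chart_dom d)) (d \o chart_inv c) ;
  manifold_hausdorff : hausdorff_space M ;
  manifold_second_countable : @second_countable M
}.

Section Manifolds.
Variables (R : realType) (M : topologicalType) (m : nat) (S : manifold R M m).

(* g : M -> W is of class C^k on the open set A *)
Definition Ck_on (W : normedModType R) (k : nat) (A : set M) (g : M -> W) :=
  forall c, atlas S c ->
    Ck k (c @` (chart_dom c `&` A)) (g \o chart_inv c).

(* g is of class C^k on an arbitrary subset A: near each point of A it
   coincides on A with a function of class C^k on an open set.  Only the values
   of g on A matter. *)
Definition Ck_on_subset (W : normedModType R) (k : nat) (A : set M)
    (g : M -> W) :=
  forall x, A x -> exists (O : set M) (g' : M -> W),
    [/\ open O, O x, Ck_on k O g' & forall y, O y -> A y -> g y = g' y].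

(* f : V -> M is smooth on the open set A *)
Definition smooth_into (V : normedModType R) (A : set V) (f : V -> M) :=
  (forall x, A x -> {for x, continuous f}) /\
  (forall c, atlas S c -> smooth (A `&` f @^-1` chart_dom c) (c \o f)).

(* df(x)(h), in T_{f x}M, for f : V -> M *)
Definition diff_into (V : normedModType R) (f : V -> M) (x h : V) : 'rV[R]_m :=
  'd (chart_at S (f x) \o f) x h.

(* dg(p)(v), for g : M -> W and v in T_pM *)
Definition diff_from (W : normedModType R) (g : M -> W) (p : M)
    (v : 'rV[R]_m) : W :=
  'd (g \o chart_inv (chart_at S p)) (chart_at S p p) v.

(* acs p is the matrix of J(p) in the identification of T_pM with 'rV[R]_m,
   acting on the right; smoothness of J is smoothness, in each chart c, of
   dc o J o dc^-1. *)
Record almost_complex := AlmostComplex {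
  acs :> M -> 'M[R]_m ;
  acs_sqr : forall p, acs p *m acs p = - 1%:M ;
  acs_smooth : forall c, atlas S c -> forall h : 'rV[R]_m,
    smooth (c @` chart_dom c)
      (fun x => diff_from c (chart_inv c x)
                  (diff_into (chart_inv c) x h *m acs (chart_inv c x)))
}.

Variable J : almost_complex.

(* f, restricted to the unit disc, is a J-holomorphic disc in the open set N *)
Definition J_disc (N : set M) (f : 'rV[R]_(1 + 1) -> M) :=
  [/\ smooth_into (@disc R) f,
      forall x, disc x -> N (f x) &
      forall x h, disc x ->
        diff_into f x (h *m Jst R 1) = diff_into f x h *m J (f x)].

(* Kobayashi-Royden pseudometric of the open submanifold N, at q in N and v in
   T_qM; cplx 1 0 is d/dx. *)
Definition kobayashi (N : set M) (q : M) (v : 'rV[R]_m) : \bar R :=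
  ereal_inf [set a%:E | a in [set a : R | 0 < a /\
    exists f, [/\ J_disc N f, f 0 = q &
      diff_into f 0 (cplx 1 0) = a^-1 *: v]]].

End Manifolds.

(* u is upper semicontinuous on A, with values in [-oo, +oo[ *)
Definition usc_on (R : realType) (T : topologicalType) (A : set T)
    (u : T -> \bar R) : Prop :=
  forall x, A x -> (u x < +oo)%E /\
    forall a : R, (u x < a%:E)%E -> \forall y \near x, A y -> (u y < a%:E)%E.

(* Upper semicontinuous with the sub-mean value inequality on every closed disc
   contained in O.  The constant -oo is allowed, and the integral makes sense
   since u is bounded above on circles. *)
Definition subharmonic (R : realType) (O : set 'rV[R]_(1 + 1))
    (u : 'rV[R]_(1 + 1) -> \bar R) : Prop :=
  usc_on O u /\
  forall (a : 'rV[R]_(1 + 1)) (r : R), 0 < r ->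
    [set x | enorm (x - a) <= r] `<=` O ->
    (u a <= ((2 * pi)^-1)%:E *
       \int[lebesgue_measure]_(t in `[0%R, (2 * pi)%R])
          u (a + r *: cplx (cos t) (sin t))%R)%E.

Definition J_psh (R : realType) (M : topologicalType) (m : nat)
    (S : manifold R M m) (J : almost_complex S) (A : set M)
    (u : M -> \bar R) : Prop :=
  usc_on A u /\ forall f, J_disc J A f -> subharmonic (@disc R) (u \o f).

(* z restricts to a diffeomorphism from U onto the unit ball which is adapted
   to p; w is its inverse. *)
Definition adapted (R : realType) (n : nat) (M : topologicalType)
    (S : manifold R M (n + n)) (J : almost_complex S) (p : M) (U : set M)
    (z : M -> 'rV[R]_(n + n)) : Prop :=
  [/\ z p = 0,
      exists w : 'rV[R]_(n + n) -> M,
        [/\ forall k, Ck_on S k U z,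
            smooth_into S (@unit_ball R (n + n)) w,
            forall x, U x -> unit_ball (z x) /\ w (z x) = x,
            forall y, unit_ball y -> U (w y) /\ z (w y) = y &
            forall h,
              diff_from S z p (diff_into S w 0 h *m J p) = h *m Jst R n] &
      exists (r : R) (theta : R -> R) (A B : R),
        [/\ 0 < r < 1,
            smooth [set s : R | 0 < s] theta /\
              (forall s t, 0 <= s -> s <= t -> theta s <= theta t),
            (forall s, 0 <= s -> s <= r / 3 -> theta s = s) /\
              (forall s, 2 * r / 3 <= s -> theta s = 1),
            0 < A /\ 0 < B &
            J_psh J U (fun x => lne (theta (enorm (z x) ^+ 2))%:E +
              (theta (A * enorm (z x)) + B * enorm (z x) ^+ 2)%:E)%E]].

Definition domain (M : topologicalType) (D : set M) : Prop :=
  [/\ open D, connected D & D !=set0].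

(* Main.v *)
(** Write [a] for the coordinates of [q], and equip the coordinate space with the
    inner product invariant under [T], the matrix of [J q]; let [N] be its squared
    norm centred at [a].  The function [ln N] is not quite plurisubharmonic, because
    [J] is not constant, but the defect along a disc is of order [N ^ (-1/2)], which
    a multiple of [sqrt N] absorbs, plus a bounded multiple of the metric, which a
    multiple of [u] absorbs since [u - c |z|^2] is plurisubharmonic.  The profile in
    [t = N / r0^2] is flat at its maximum [t = 1], so it extends by a constant to all
    of [D].  For a disc [f] in [D] centred at [q], the exponential of the resulting
    function, divided by [|zeta|], satisfies the maximum principle on the disc of
    radius 1/2 and is therefore bounded there by a universal constant.  As [u >= -L]
    near [p], this gives [t (f zeta) <= const |zeta|] while [f zeta] stays close to
    [q]; by connectedness [f] maps a disc of fixed radius into [D `&` U], and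
    rescaling it compares the two metrics. *)

Require Import Defs.
From mathcomp Require Import all_boot all_order all_algebra.
From mathcomp Require Import all_classical all_reals all_analysis.
From mathcomp Require Import ring lra.

Set Implicit Arguments.
Unset Strict Implicit.
Unset Printing Implicit Defensive.

Import Order.TTheory GRing.Theory Num.Theory.
Import numFieldNormedType.Exports.

Local Open Scope classical_set_scope.
Local Open Scope ring_scope.

(** * Second derivatives *)

Section Twice.
Variable R : realType.
Implicit Types V W : normedModType R.

(** Plurisubharmonicity only provides sub-mean values of [u \o f], so [u] is never given a
    Laplacian: the maximum principle is proved for the sum of a twice differentiable function with
    positive Laplacian and a continuous sub-mean function. The invariant inner product is what
    lowers the defect of ln N to order N^(-1/2). If X is one partial derivative of the disc in
    coordinates, the other is XT up to an error, and X, XT are orthogonal of equal length. Bessel's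
    inequality then gives |grad N|^2 <= 4 N |X|^2 up to errors, while the Laplacian of N is about 4
    |X|^2, so the part of order 1/N in the Laplacian of ln N is nonnegative. For a norm that is not
    invariant this part may be negative, and neither sqrt N nor [u] could absorb it. The division is
    by |zeta| although t vanishes to order |zeta|^2: the quotient then tends to 0 at the centre
    however large the derivative of [f] is there, and so its bound does not depend on [f]. *)

Lemma near_eq_differentiable V W (f g : V -> W) (x : V) :
  (\forall y \near x, f y = g y) -> differentiable f x -> differentiable g x.
Proof.
move=> fg df; have [dfc dfo] := (diff_locallyP x f).1 df.
have go : g \o shift x = cst (g x) + 'd f x +o_ 0 id.
  have fo := (eqaddoP _ _ _ _).1 dfo; apply/eqaddoP => e e0; near=> h.
  have : `|((f \o shift x) - (cst (f x) + 'd f x)) h| <= e * `|h|.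
    by near: h; apply: fo.
  rewrite !fctE /= /cst (nbhs_singleton fg).
  suff -> : f (h + x) = g (h + x) by [].
  by near: h; move: fg; rewrite (near_shift 0) /= subr0.
by apply/diff_locallyP; rewrite (diff_unique dfc go).
Unshelve. all: by end_near. Qed.

Lemma differentiable_eps V W (f : V -> W) (x : V) (e : R) :
  differentiable f x -> 0 < e ->
  \forall h \near 0, `|f (h + x) - f x - 'd f x h| <= e * `|h|.
Proof.
move=> /diff_locallyP[_ dfo] e0; have fo := (eqaddoP _ _ _ _).1 dfo; near=> h.
have : `|((f \o shift x) - (cst (f x) + 'd f x)) h| <= e * `|h|.
  by near: h; apply: fo.
by rewrite !fctE /= opprD addrA.
Unshelve. all: by end_near. Qed.

(** A pointwise form of C^2: the first derivatives are only asked to be differentiable at [x]. This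
    suffices for the symmetry of second derivatives and for a second-order expansion, and it passes
    to products and composites at a single point. *)
Definition twice V W (f : V -> W) (x : V) :=
  (\forall y \near x, differentiable f y) /\
  forall v, differentiable (fun y => 'D_v f y) x.

Lemma twice_diff V W (f : V -> W) x : twice f x -> differentiable f x.
Proof. by case=> /nbhs_singleton. Qed.

Lemma near_eq_twice V W (f g : V -> W) (x : V) :
  (\forall y \near x, f y = g y) -> twice f x -> twice g x.
Proof.
move=> fg [df ddf]; split.
  near=> y; apply: (@near_eq_differentiable _ _ f).
    by near: y; apply: near_join.
  by near: y.
move=> v; apply: near_eq_differentiable (ddf v).
near=> y; apply: near_eq_derive; near: y; exact: near_join.
Unshelve. all: by end_near. Qed.

Lemma twice_cst V W (k : W) (x : V) : twice (fun=> k) x.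
Proof.
split; first by near=> y; exact: differentiable_cst.
move=> v; have -> : (fun y => 'D_v (fun=> k) y) = cst (0 : W).
  by apply/funext => y; exact: derive_cst.
exact: differentiable_cst.
Unshelve. all: by end_near. Qed.

Section Scalar.
Variable V : normedModType R.
Implicit Types (f g : V -> R) (x v w : V).

Lemma near_deriveD f g x v : twice f x -> twice g x ->
  \forall y \near x, 'D_v (fun y => f y + g y) y = 'D_v f y + 'D_v g y.
Proof.
move=> [df _] [dg _]; near=> y; apply: deriveD; apply: diff_derivable; near: y => //.
Unshelve. all: by end_near. Qed.

Lemma near_deriveM f g x v : twice f x -> twice g x ->
  \forall y \near x, 'D_v (fun y => f y * g y) y = f y * 'D_v g y + g y * 'D_v f y.
Proof.
move=> [df _] [dg _]; near=> y; apply: deriveM; apply: diff_derivable; near: y => //.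
Unshelve. all: by end_near. Qed.

Lemma twiceD f g x : twice f x -> twice g x -> twice (fun y => f y + g y) x.
Proof.
move=> tf tg; split.
  have [df _] := tf; have [dg _] := tg.
  by near=> y; apply: differentiableD; near: y.
move=> v; apply: (@near_eq_differentiable _ _ (fun y => 'D_v f y + 'D_v g y)).
  by apply: filterS (near_deriveD v tf tg) => y ->.
by apply: differentiableD; [apply: tf.2 | apply: tg.2].
Unshelve. all: by end_near. Qed.

Lemma twiceM f g x : twice f x -> twice g x -> twice (fun y => f y * g y) x.
Proof.
move=> tf tg; split.
  have [df _] := tf; have [dg _] := tg.
  by near=> y; apply: differentiableM; near: y.
move=> v.
apply: (@near_eq_differentiable _ _ (fun y => f y * 'D_v g y + g y * 'D_v f y)).
  by apply: filterS (near_deriveM v tf tg) => y ->.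
exact: differentiableD (differentiableM (twice_diff tf) (tg.2 v))
  (differentiableM (twice_diff tg) (tf.2 v)).
Unshelve. all: by end_near. Qed.

Lemma derive2D f g x v w : twice f x -> twice g x ->
  'D_v (fun y => 'D_w (fun y => f y + g y) y) x =
  'D_v (fun y => 'D_w f y) x + 'D_v (fun y => 'D_w g y) x.
Proof.
move=> tf tg; rewrite (near_eq_derive _ (near_deriveD w tf tg)).
by apply: deriveD; apply: diff_derivable; [apply: tf.2 | apply: tg.2].
Qed.

Lemma derive2M f g x v w : twice f x -> twice g x ->
  'D_v (fun y => 'D_w (fun y => f y * g y) y) x =
  f x * 'D_v (fun y => 'D_w g y) x + g x * 'D_v (fun y => 'D_w f y) x
  + 'D_v f x * 'D_w g x + 'D_v g x * 'D_w f x.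
Proof.
move=> tf tg; rewrite (near_eq_derive _ (near_deriveM w tf tg)).
have tf1 : derivable f x v by apply: diff_derivable; exact: twice_diff.
have tg1 : derivable g x v by apply: diff_derivable; exact: twice_diff.
have tf2 : derivable (fun y => 'D_w f y) x v by apply: diff_derivable; apply: tf.2.
have tg2 : derivable (fun y => 'D_w g y) x v by apply: diff_derivable; apply: tg.2.
transitivity ('D_v (f * (fun y => 'D_w g y)) x + 'D_v (g * (fun y => 'D_w f y)) x).
  exact: deriveD (derivableM tf1 tg2) (derivableM tg1 tf2).
rewrite (deriveM tf1 tg2) (deriveM tg1 tf2) /GRing.scale /=.
set A := 'D_v (fun y => _) x.
set B := 'D_v (fun y => _) x.
set C := 'D_v f x. set D := 'D_v g x. set E := 'D_w f x. set F := 'D_w g x.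
move: (f x) (g x) A B C D E F => a b A B C D E F.
ring.
Qed.

Lemma derive_diff_comp1 (psi : R -> R) f x v (dpsi : R) : differentiable f x ->
  is_derive (f x) 1 psi dpsi ->
  differentiable (fun y => psi (f y)) x /\ 'D_v (fun y => psi (f y)) x = dpsi * 'D_v f x.
Proof.
move=> df [dp <-]; have dp' : differentiable psi (f x) by apply/derivable1_diffP.
split; first exact: (@differentiable_comp _ _ _ _ f psi).
rewrite deriveE; last exact: (@differentiable_comp _ _ _ _ f psi).
rewrite (@diff_comp _ _ _ _ f psi) //= -deriveE // -deriveE //.
rewrite deriveE // -[X in 'd psi _ X]mulr1.
rewrite -[_ * 1]/(_ *: 1) linearZ /= -deriveE // mulrC.
by rewrite !deriveE.
Qed.

Variables (psi psi' : R -> R).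

Lemma near_derive_comp1 f x v : twice f x ->
  (\forall t \near f x, is_derive (t : R) (1 : R) psi (psi' t)) ->
  \forall y \near x, differentiable (fun y => psi (f y)) y /\
    'D_v (fun y => psi (f y)) y = psi' (f y) * 'D_v f y.
Proof.
move=> tf dpsi; have [df _] := tf.
have c := differentiable_continuous (twice_diff tf) dpsi.
near=> y; have dy : differentiable f y by near: y.
have py : is_derive (f y) 1 psi (psi' (f y)) by near: y; exact: c.
exact: derive_diff_comp1.
Unshelve. all: by end_near. Qed.

Lemma twice_comp1 f x (psi'' : R) : twice f x ->
  (\forall t \near f x, is_derive (t : R) (1 : R) psi (psi' t)) ->
  is_derive (f x) 1 psi' psi'' -> twice (fun y => psi (f y)) x.
Proof.
move=> tf dpsi ddpsi; split.
  by apply: filterS (near_derive_comp1 0 tf dpsi) => y [].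
move=> v; apply: (@near_eq_differentiable _ _ (fun y => psi' (f y) * 'D_v f y)).
  by apply: filterS (near_derive_comp1 v tf dpsi) => y [_ ->].
apply: differentiableM; last by apply: tf.2.
by have [] := derive_diff_comp1 0 (twice_diff tf) ddpsi.
Qed.

Lemma derive2_comp1 f x (psi'' : R) v w : twice f x ->
  (\forall t \near f x, is_derive (t : R) (1 : R) psi (psi' t)) ->
  is_derive (f x) 1 psi' psi'' ->
  'D_v (fun y => 'D_w (fun y => psi (f y)) y) x =
  psi'' * 'D_v f x * 'D_w f x + psi' (f x) * 'D_v (fun y => 'D_w f y) x.
Proof.
move=> tf dpsi ddpsi.
have E : \forall y \near x,
    'D_w (fun y => psi (f y)) y = ((psi' \o f) * (fun y => 'D_w f y)) y.
  by apply: filterS (near_derive_comp1 w tf dpsi) => y [_ ->].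
rewrite (near_eq_derive _ E).
have [d1 d2] := derive_diff_comp1 v (twice_diff tf) ddpsi.
rewrite deriveM; last by apply: diff_derivable; apply: tf.2.
  by rewrite [X in _ + _ *: X](_ : _ = psi'' * 'D_v f x) // /GRing.scale /=; ring.
exact: diff_derivable.
Qed.

End Scalar.
End Twice.

(** * Symmetry of second derivatives and the second-order expansion *)

Section SecondOrder.
Variables (R : realType) (V : normedModType R).
Implicit Types (f : V -> R) (a x v w h : V).

Lemma near_norm_ball a (P : set V) :
  (\forall y \near a, P y) -> exists2 d : R, 0 < d & forall h, `|h| < d -> P (h + a).
Proof.
move=> /nbhs_normP[d /= d0 Pd]; exists d => // h hd.
by apply: Pd; rewrite /ball_ /= opprD addrCA subrr addr0 normrN.
Qed.

Lemma is_derive_line f a h (s : R) : differentiable f (s *: h + a) ->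
  is_derive s 1 (fun s : R => f (s *: h + a)) ('D_h f (s *: h + a)).
Proof.
move=> df.
pose l := fun s : R => s *: h + a.
have [dl ld] : differentiable l s /\ 'D_1 l s = h.
  have H1 : is_derive s 1 (fun t : R => t *: h) h.
    have ID := is_diff_scalel s h.
    have d1 : differentiable ( *:%R^~ h : R -> V) s by exact: ex_diff.
    apply: DeriveDef; first exact: diff_derivable.
    by rewrite deriveE // diff_val scale1r.
  have H2 : is_derive s 1 l (h + 0) by apply: is_deriveD.
  by split; [apply/derivable1_diffP; apply: ex_derive | rewrite derive_val addr0].
have dfl : differentiable (f \o l) s by exact: differentiable_comp.
apply: DeriveDef; first exact/derivable1_diffP.
by rewrite deriveE // (@diff_comp _ _ _ _ l f) //= -[X in 'd f _ X]deriveE // ld deriveE.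
Qed.

Lemma derive_dirZ f a v (c : R) : differentiable f a ->
  'D_(c *: v) f a = c * 'D_v f a.
Proof. by move=> df; rewrite !deriveE // linearZ. Qed.

Lemma derive_dirD f a v w : differentiable f a ->
  'D_(v + w) f a = 'D_v f a + 'D_w f a.
Proof. by move=> df; rewrite !deriveE // linearD. Qed.

Lemma mean_value_line f a h :
  (forall s : R, 0 <= s <= 1 -> differentiable f (s *: h + a)) ->
  exists2 s : R, 0 <= s <= 1 & f (h + a) - f a = 'D_h f (s *: h + a).
Proof.
move=> df; pose g := fun s : R => f (s *: h + a).
have dg (s : R) : s \in `[0, 1] -> is_derive s (1 : R) g ('D_h f (s *: h + a)).
  by rewrite in_itv => s01; apply: is_derive_line; exact: df.
have dg' (s : R) : s \in `]0, 1[ -> is_derive s (1 : R) g ('D_h f (s *: h + a)).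
  by rewrite in_itv /= => /andP[s0 s1]; apply: dg; rewrite in_itv /= !ltW.
have cg : {within `[0, 1], continuous g}.
  apply: derivable_within_continuous => s s01.
  by have [] := dg s s01.
have [s s01 E] := @MVT_segment R g (fun s => 'D_h f (s *: h + a)) 0 1 ler01 dg' cg.
exists s; first by move: s01; rewrite in_itv.
by move: E; rewrite /g scale1r scale0r add0r subr0 mulr1.
Qed.

Lemma twice_eps f x v (e : R) : twice f x -> 0 < e ->
  exists2 d : R, 0 < d & forall h, `|h| < d ->
    differentiable f (h + x) /\
    `|'D_v f (h + x) - 'D_v f x - 'd (fun y => 'D_v f y) x h| <= e * `|h|.
Proof.
move=> [df ddf] e0; have [d1 d10 H1] := near_norm_ball df.
have := differentiable_eps (ddf v) e0.
move=> /near_norm_ball[d2 d20 H2]; exists (Num.min d1 d2); first by rewrite lt_min d10.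
move=> h; rewrite lt_min => /andP[h1 h2]; split; first exact: H1.
by have := H2 h h2; rewrite addr0.
Qed.

(** The second difference is the increment along [s *: w] of [F y = f (s *: v + y) - f y]. The mean
    value theorem turns it into a difference of two values of ['D_w f], whose first-order expansion
    at [x] yields the mixed derivative. *)
Lemma second_difference f x v w (e : R) : twice f x -> 0 < e ->
  \forall s \near 0^'+,
  `|f (s *: v + s *: w + x) - f (s *: v + x) - f (s *: w + x) + f x
    - s ^+ 2 * 'D_v (fun y => 'D_w f y) x| <= s ^+ 2 * (2 * e * (`|v| + `|w|)).
Proof.
move=> tf e0; have [d d0 H] := twice_eps w tf e0.
have sdn : \forall s \near (0 : R)^'+, s * (`|v| + `|w|) < d.
  have [->|n0] := eqVneq (`|v| + `|w|) 0; first by near=> s; rewrite mulr0.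
  have p0 : 0 < `|v| + `|w| by rewrite lt0r n0 addr_ge0.
  near=> s; rewrite -ltr_pdivlMr //; near: s.
  by apply: nbhs_right_lt; apply: divr_gt0.
near=> s.
have s0 : 0 < s by near: s; exact: nbhs_right_gt.
have sd : s * (`|v| + `|w|) < d by near: s.
have B (c : R) (u : V) : 0 <= c <= 1 -> u = s *: v + c *: (s *: w) \/ u = c *: (s *: w) ->
    `|u| <= s * (`|v| + `|w|).
  move=> /andP[c0 c1] Hu.
  have cw : `|c *: (s *: w)| <= s * `|w|.
    rewrite normrZ normrZ (ger0_norm c0) (gtr0_norm s0).
    by rewrite -[leRHS]mul1r ler_wpM2r // mulr_ge0 // ltW.
  case: Hu => ->.
    by rewrite (le_trans (ler_normD _ _)) // mulrDr lerD // normrZ gtr0_norm.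
  by apply: (le_trans cw); apply: ler_wpM2l; [exact: ltW | rewrite lerDr].
pose F y := f (s *: v + y) - f y.
have dsh y : differentiable f (s *: v + y) ->
    differentiable (fun y => f (s *: v + y)) y /\
    forall u, 'D_u (fun y => f (s *: v + y)) y = 'D_u f (s *: v + y).
  move=> df.
  have ds : differentiable (fun y => s *: v + y) y.
    have di : differentiable (@idfun V) y by exact: ex_diff.
    exact: (differentiableD (differentiable_cst (s *: v) y) di).
  have dc := @differentiable_comp _ _ _ _ (fun y => s *: v + y) f y ds df.
  split; first exact: dc.
  move=> u; rewrite /derive; set A := (fun h : R => _); set B1 := (fun h : R => _).
  suff -> : A = B1 by [].
  by apply/funext => c; rewrite /A /B1 /= addrCA.
have dd (c : R) : 0 <= c <= 1 -> differentiable f (s *: v + (c *: (s *: w) + x)) /\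
   differentiable f (c *: (s *: w) + x).
  move=> c01; split; [rewrite addrA|]; apply: (H _ _).1.
    by apply: le_lt_trans sd; apply: (B c) => //; left.
  by apply: le_lt_trans sd; apply: (B c) => //; right.
have [c c01|c c01] := @mean_value_line F x (s *: w).
  have [d1 d2] := dd c c01; apply: differentiableB => //.
  by apply: (dsh _ _).1.
have [d1 d2] := dd c c01.
have [d1' d1E] := dsh _ d1.
have -> : 'D_(s *: w) F (c *: (s *: w) + x) =
    s * ('D_w f (s *: v + (c *: (s *: w) + x)) - 'D_w f (c *: (s *: w) + x)).
  have -> : 'D_(s *: w) F (c *: (s *: w) + x) =
     'D_(s *: w) (fun y => f (s *: v + y)) (c *: (s *: w) + x) -
     'D_(s *: w) f (c *: (s *: w) + x).
    by apply: deriveB; apply: diff_derivable.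
  by rewrite d1E !derive_dirZ // mulrBr.
rewrite /F addrA => E.
have -> : f (s *: v + s *: w + x) - f (s *: v + x) - f (s *: w + x) + f x =
   s * ('D_w f (s *: v + (c *: (s *: w) + x)) - 'D_w f (c *: (s *: w) + x)).
  by rewrite -E; ring.
have [_ {}H1] := H (s *: v + c *: (s *: w)) (le_lt_trans (B c _ c01 (or_introl erefl)) sd).
have [_ {}H2] := H (c *: (s *: w)) (le_lt_trans (B c _ c01 (or_intror erefl)) sd).
move: H1 H2; rewrite addrA; set A1 := 'D_w f _; set A2 := 'D_w f (c *: _ + x).
have -> : 'd (fun y => 'D_w f y) x (s *: v + c *: (s *: w)) =
    s * 'D_v (fun y => 'D_w f y) x + 'd (fun y => 'D_w f y) x (c *: (s *: w)).
  by rewrite linearD linearZ /= deriveE //; exact: (tf.2 w).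
set D := 'D_v _ _; set T := 'd _ _ _ => H1 H2.
have -> : s * (A1 - A2) - s ^+ 2 * D =
  s * ((A1 - 'D_w f x - (s * D + T)) - (A2 - 'D_w f x - T)).
  by ring.
rewrite normrM (gtr0_norm s0) expr2 -mulrA ler_pM2l //.
rewrite (le_trans (ler_normB _ _)) // (le_trans (lerD H1 H2)) //.
have := ler_wpM2l (ltW e0) (B c _ c01 (or_introl erefl)).
have := ler_wpM2l (ltW e0) (B c _ c01 (or_intror erefl)).
set n1 := `|_|; set n2 := `|_ + _|; set n3 := `|v|; set n4 := `|w|.
move: n1 n2 n3 n4 => n1 n2 n3 n4; lra.
Unshelve. all: by end_near. Qed.

(** The second difference is symmetric in [v] and [w], so it approximates both mixed derivatives to
    within a small multiple of s^2. *)
Lemma derive2_sym f x v w : twice f x ->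
  'D_v (fun y => 'D_w f y) x = 'D_w (fun y => 'D_v f y) x.
Proof.
move=> tf; apply/eqP; rewrite -subr_eq0 -normr_le0; apply/ler_addgt0Pr => e e0.
(* The two errors add up to s^2 times 4 (e / k) (|v| + |w|), which this choice makes at most s^2 e;
   the summand 1 keeps [k] positive. *)
set k := 4 * (`|v| + `|w| + 1).
have k0 : 0 < k by rewrite mulr_gt0 // ltr_wpDl // addr_ge0.
have ek : 0 < e / k by exact: divr_gt0.
rewrite add0r.
have H1 := second_difference v w tf ek; have H2 := second_difference w v tf ek.
have [s [s0 {}H1 {}H2]] : exists s, [/\ 0 < s,
  `|f (s *: v + s *: w + x) - f (s *: v + x) - f (s *: w + x) + f x
    - s ^+ 2 * 'D_v (fun y => 'D_w f y) x| <= s ^+ 2 * (2 * (e / k) * (`|v| + `|w|)) &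
  `|f (s *: w + s *: v + x) - f (s *: w + x) - f (s *: v + x) + f x
    - s ^+ 2 * 'D_w (fun y => 'D_v f y) x| <= s ^+ 2 * (2 * (e / k) * (`|w| + `|v|))].
  near (0 : R)^'+ => s; exists s; split.
  - by near: s; exact: nbhs_right_gt.
  - by near: s.
  - by near: s.
have XE : f (s *: w + s *: v + x) - f (s *: w + x) - f (s *: v + x) + f x =
    f (s *: v + s *: w + x) - f (s *: v + x) - f (s *: w + x) + f x.
  by rewrite [s *: w + s *: v]addrC; ring.
move: H1 H2; rewrite XE [`|w| + _]addrC.
set A := `|v| + `|w|.
have A0 : 0 <= A by rewrite addr_ge0.
have ekk : 4 * (e / k * A) <= e.
  have -> : 4 * (e / k * A) = e * (4 * A / k) by ring.
  by rewrite (ler_piMr (ltW e0)) // ler_pdivrMr // mul1r /k -/A; lra.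
set X := f _ - _ - _ + _.
move: ('D_v _ _) ('D_w _ _) X A (e / k) ekk A0 => D D' X A z ekk A0 H1.
rewrite ler_norml => /andP[H3 H4]; move: H1.
rewrite ler_norml => /andP[H1 H2].
have s20 : 0 < s ^+ 2 by rewrite exprn_gt0.
have ekk2 : s ^+ 2 * (4 * (z * A)) <= s ^+ 2 * e by rewrite ler_pM2l.
rewrite ler_norml -(ler_pM2l s20) -[X in _ && X](ler_pM2l s20); apply/andP; split; lra.
Unshelve. all: by end_near. Qed.

(** The mean value theorem is applied to [F], which is [f] on a segment minus its expansion. [F']
    involves only first derivatives of [f], and their expansions at [x] make it small. *)
Lemma taylor2 f x v w (e : R) : twice f x -> 0 < e ->
  exists2 d : R, 0 < d & forall a b : R, `|a| < d -> `|b| < d ->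
  `|f (a *: v + b *: w + x) - f x - (a * 'D_v f x + b * 'D_w f x)
    - (a ^+ 2 * 'D_v (fun y => 'D_v f y) x
      + a * b * ('D_v (fun y => 'D_w f y) x + 'D_w (fun y => 'D_v f y) x)
      + b ^+ 2 * 'D_w (fun y => 'D_w f y) x) / 2|
  <= e * (`|a| + `|b|) ^+ 2.
Proof.
move=> tf e0; set N := `|v| + `|w| + 1.
have N0 : 0 < N by rewrite ltr_wpDl // addr_ge0.
have eN : 0 < e / N by exact: divr_gt0.
have [d1 d10 H1] := twice_eps v tf eN; have [d2 d20 H2] := twice_eps w tf eN.
exists (Num.min d1 d2 / (2 * N)); first by rewrite divr_gt0 ?mulr_gt0 // lt_min d10.
move=> a b ad bd; set h := a *: v + b *: w.
have hN : `|h| <= (`|a| + `|b|) * N.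
  rewrite (le_trans (ler_normD _ _)) // !normrZ.
  have := normr_ge0 v; have := normr_ge0 w; have := normr_ge0 a; have := normr_ge0 b.
  rewrite /N; nra.
have hd : `|h| < Num.min d1 d2.
  rewrite (le_lt_trans hN) // -ltr_pdivlMr //.
  move: ad bd; rewrite invfM mulrA; lra.
have dh (s : R) : 0 <= s <= 1 -> `|s *: h| <= `|h|.
  by move=> /andP[s0 s1]; rewrite normrZ ger0_norm // ler_piMl.
have dhd s s01 := le_lt_trans (dh s s01) hd.
set b2 := (X in X / 2).
pose F (t : R) := f (t *: h + x) - (t * (a * 'D_v f x + b * 'D_w f x) + t ^+ 2 * (b2 / 2)).
have df (s : R) : 0 <= s <= 1 -> differentiable f (s *: h + x).
  move=> /dhd; rewrite lt_min => /andP[s1 _]; exact: (H1 _ s1).1.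
pose F' (s : R) := 'D_h f (s *: h + x) - ((a * 'D_v f x + b * 'D_w f x) + s * b2).
have dF : forall s : R, s \in `[0, 1] -> is_derive s (1 : R) F (F' s).
  move=> s; rewrite in_itv => s01; apply: is_deriveB; first exact: is_derive_line (df s s01).
  by apply: is_derive_eq; rewrite /GRing.scale /=; field.
have dF' : forall s : R, s \in `]0, 1[ -> is_derive s (1 : R) F (F' s).
  by move=> s; rewrite in_itv /= => /andP[s0 s1]; apply: dF; rewrite in_itv /= !ltW.
have cF : {within `[0, 1], continuous F}.
  apply: derivable_within_continuous => s s01.
  by have [] := dF s s01.
have [c c01 E] := @MVT_segment R F F' 0 1 ler01 dF' cF.
have {}c01 : 0 <= c <= 1 by move: c01; rewrite in_itv.
set X := (X in `|X|); have -> : X = F' c.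
  rewrite -[RHS]mulr1 -[X in F' c * X]subr0 -E /F /X /h !scale1r !scale0r add0r.
  by field.
have := dhd c c01; rewrite lt_min => /andP[c1 c2].
have [_ {}H1] := H1 _ c1; have [_ {}H2] := H2 _ c2.
have LE (u : V) : 'd (fun y => 'D_u f y) x (c *: h) =
    c * (a * 'D_v (fun y => 'D_u f y) x + b * 'D_w (fun y => 'D_u f y) x).
  rewrite linearZ /= linearD !linearZ /=.
  by rewrite -[X in a *: X]deriveE -1?[X in b *: X]deriveE //; exact: (tf.2 u).
move: H1; rewrite (LE v) => H1; move: H2; rewrite (LE w) => H2.
have -> : F' c =
  a * ('D_v f (c *: h + x) - 'D_v f x - c * (a * 'D_v (fun y => 'D_v f y) x + b * 'D_w (fun y => 'D_v f y) x))
  + b * ('D_w f (c *: h + x) - 'D_w f x - c * (a * 'D_v (fun y => 'D_w f y) x + b * 'D_w (fun y => 'D_w f y) x)).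
  have Dh : 'D_h f (c *: h + x) = a * 'D_v f (c *: h + x) + b * 'D_w f (c *: h + x).
    have dfc := df c c01; rewrite {1}/h (derive_dirD (a *: v) (b *: w) dfc).
    by rewrite (derive_dirZ v a dfc) (derive_dirZ w b dfc).
  rewrite /F' Dh /b2.
  move: ('D_v f _) ('D_w f _) ('D_v f x) ('D_w f x) => t1 t2 t3 t4.
  move: ('D_v _ _) ('D_v _ _) ('D_w _ _) ('D_w _ _) => t5 t6 t7 t8.
  ring.
move: H1 H2; move: (_ - _ - _) (_ - _ - _) => u1 u2 H1 H2.
apply: (le_trans (ler_normD _ _)); rewrite (normrM a) (normrM b).
have K1 := le_trans H1 (ler_wpM2l (ltW eN) (dh c c01)).
have K2 := le_trans H2 (ler_wpM2l (ltW eN) (dh c c01)).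
rewrite (le_trans (lerD (ler_wpM2l (normr_ge0 a) K1) (ler_wpM2l (normr_ge0 b) K2))) //.
have K : e / N * `|h| <= e * (`|a| + `|b|).
  by rewrite mulrAC ler_pdivrMr // -mulrA ler_pM2l.
have A0 : 0 <= `|a| + `|b| by rewrite addr_ge0.
have := ler_wpM2l A0 K.
move=> H5; rewrite -mulrDl; apply: (le_trans H5).
have -> : (`|a| + `|b|) * (e * (`|a| + `|b|)) = e * (`|a| + `|b|) ^+ 2 by ring.
by [].
Qed.

End SecondOrder.

(** * Sub-mean functions and the maximum principle *)

Section CircleMeans.
Variable R : realType.
Local Notation e1 := (cplx 1 0 : 'rV[R]_(1 + 1)).
Local Notation e2 := (cplx 0 1 : 'rV[R]_(1 + 1)).

Lemma cplxE (a b : R) : cplx a b = a *: e1 + b *: e2.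
Proof.
rewrite /cplx !scale_row_mx add_row_mx; congr row_mx; apply/rowP => i;
  by rewrite !mxE ord1 /= ?mulr1n ?mulr0 ?mulr1 ?addr0 ?add0r.
Qed.

Lemma norm_cplx_le (a b : R) : `|cplx a b| <= `|a| + `|b|.
Proof.
have n1 (c : R) : `|cplx c 0| <= `|c|.
  rewrite -[leLHS]/(mx_norm _) mx_normrE; apply/bigmax_leP; split=> // -[i j] _ /=.
  by rewrite ord1 !mxE; case: (fintype.split j) => k; rewrite !mxE ord1 ?mulr1n ?mul0rn ?normr0.
have n2 (c : R) : `|cplx 0 c| <= `|c|.
  rewrite -[leLHS]/(mx_norm _) mx_normrE; apply/bigmax_leP; split=> // -[i j] _ /=.
  by rewrite ord1 !mxE; case: (fintype.split j) => k; rewrite !mxE ord1 ?mulr1n ?mul0rn ?normr0.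
have -> : cplx a b = cplx a 0 + cplx 0 b.
  by rewrite [LHS]cplxE [cplx a 0]cplxE [cplx 0 b]cplxE !scale0r addr0 add0r.
by rewrite (le_trans (ler_normD _ _)) // lerD.
Qed.

(** The integrand is the general form of a quadratic polynomial restricted to a circle; [F] is an
    explicit primitive. *)
Lemma trig_integral (al b g a1 a2 a3 : R) :
  (\int[lebesgue_measure]_(t in `[0%R, (2 * pi)%R])
    (al + b * cos t + g * sin t + a1 * cos t ^+ 2 + a2 * (cos t * sin t)
      + a3 * sin t ^+ 2)%:E = (2 * pi * al + pi * (a1 + a3))%:E)%E.
Proof.
pose f (t : R) := al + b * cos t + g * sin t + a1 * cos t ^+ 2 + a2 * (cos t * sin t)
      + a3 * sin t ^+ 2.
pose F (t : R) := al * t + b * sin t - g * cos t + a1 / 2 * (t + sin t * cos t)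
  + a2 / 2 * (sin t ^+ 2) + a3 / 2 * (t - sin t * cos t).
have dF (t : R) : is_derive t (1 : R) F (f t).
  apply: is_derive_eq; rewrite /f /GRing.scale /=.
  have E' : sin t * sin t = 1 - cos t * cos t.
    by rewrite -[_ * _]expr2 -(cos2Dsin2 t) expr2 addrAC subrr add0r.
  by rewrite !expr2 !mulrN E'; field.
have pi0 : 0 < 2 * pi :> R by rewrite mulr_gt0 // pi_gt0.
have cF : continuous F.
  move=> t; apply/differentiable_continuous/derivable1_diffP.
  by have [] := dF t.
have cf : continuous f.
  move=> t; apply/differentiable_continuous/derivable1_diffP.
  rewrite /f; exact: ex_derive.
rewrite (@continuous_FTC2 _ f F) //.
- have s0 : sin (2 * pi) = 0 :> R by rewrite mulr_natl sin2pi.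
  have c0 : cos (2 * pi) = 1 :> R by rewrite mulr_natl cos2pi.
  rewrite -EFinB /F sin0 cos0 s0 c0; congr (_%:E); by field.
- by apply: continuous_subspaceT => t; exact: cf.
- split; first by move=> t _; have [] := dF t.
  + by apply: cvg_at_right_filter; exact: cF.
  + by apply: cvg_at_left_filter; exact: cF.
- by move=> t _; rewrite derive1E; have [] := dF t.
Qed.

End CircleMeans.

Section SubMean.
Variables (R : realType) (V : normedModType R) (e1 e2 : V).
Hypotheses (e1_le1 : `|e1| <= 1) (e2_le1 : `|e2| <= 1).
Implicit Types (f k h : V -> R) (a x y : V).

Definition laplacian f x : R :=
  'D_e1 (fun y => 'D_e1 f y) x + 'D_e2 (fun y => 'D_e2 f y) x.

Lemma norm_circle_le (t : R) : `|cos t *: e1 + sin t *: e2| <= 2.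
Proof.
rewrite (le_trans (ler_normD _ _)) // !normrZ.
have := cos_max t; have := sin_max t; have := normr_ge0 (cos t).
have := normr_ge0 (sin t); have := normr_ge0 e1; have := normr_ge0 e2.
move: e1_le1 e2_le1; move: (`|e1|) (`|e2|) (`|cos t|) (`|sin t|) => u v c s; nra.
Qed.

Lemma continuous_circle h a (r : R) :
  (forall y, `|y - a| <= 2 * r -> {for y, continuous h}) -> 0 <= r ->
  continuous (fun t => h (a + r *: (cos t *: e1 + sin t *: e2))).
Proof.
move=> ch r0 t.
have ct : {for t, continuous (fun t => a + r *: (cos t *: e1 + sin t *: e2))}.
  apply: continuousD; first exact: cvg_cst.
  apply: continuousZ; first exact: cvg_cst.
  by apply: continuousD; apply: continuousZr_tmp;
    [exact: continuous_cos | exact: continuous_sin].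
apply: (@continuous_comp _ _ _ (fun t => a + r *: (cos t *: e1 + sin t *: e2)) h) => //.
apply: ch; rewrite addrC addKr normrZ ger0_norm // mulrC ler_wpM2r //.
exact: norm_circle_le.
Qed.

(** At a local maximum of [k + h], the values of [h] on small circles are at most h(a) minus the
    increment of [k]. That increment has mean r^2 / 4 times the Laplacian of [k], up to the Taylor
    error, so the mean of [h] would fall below h(a). *)
Lemma submean_local_max k h a :
  twice k a -> 0 < laplacian k a ->
  (\forall y \near a, {for y, continuous h}) ->
  (\forall r \near 0^'+, ((h a)%:E <= ((2 * pi)^-1)%:E *
     \int[lebesgue_measure]_(t in `[0%R, (2 * pi)%R])
       (h (a + r *: (cos t *: e1 + sin t *: e2)))%:E)%E) ->
  ~ (\forall y \near a, k y + h y <= k a + h a).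
Proof.
move=> tk k0 ch hm kh.
(* Since |r cos t| + |r sin t| <= 2 r, the Taylor error is at most r^2 / 16 times the Laplacian, a
   quarter of the gain r^2 / 4. *)
have e0 : 0 < laplacian k a / 64 by rewrite divr_gt0.
have [d d0 T] := taylor2 e1 e2 tk e0.
have [d1 d10 H1] := near_norm_ball ch.
have [d2 d20 H2] := near_norm_ball kh.
have [r [r0 rd {}hm]] : exists r : R, [/\ 0 < r, 2 * r < Num.min d (Num.min d1 d2) &
   ((h a)%:E <= ((2 * pi)^-1)%:E *
     \int[lebesgue_measure]_(t in `[0%R, (2 * pi)%R])
       (h (a + r *: (cos t *: e1 + sin t *: e2)))%:E)%E].
  have m0 : 0 < Num.min d (Num.min d1 d2) by rewrite !lt_min d0 d10.
  near (0 : R)^'+ => r; exists r; split.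
  - by near: r; exact: nbhs_right_gt.
  - rewrite -ltr_pdivlMl //; near: r; apply: nbhs_right_lt.
    by rewrite mulr_gt0 // invr_gt0.
  - by near: r.
move: rd; rewrite !lt_min => /and3P[rd rd1 rd2].
set kx := 'D_e1 k a in T; set ky := 'D_e2 k a in T.
set kxx := 'D_e1 (fun y => 'D_e1 k y) a in T.
set kyy := 'D_e2 (fun y => 'D_e2 k y) a in T.
set kxy := _ + _ in T.
have le2 (t : R) : `|cos t| <= 1 /\ `|sin t| <= 1 by split; [exact: cos_max|exact: sin_max].
pose Tp (t : R) := (h a + r ^+ 2 * (laplacian k a / 16)) + (- r * kx) * cos t + (- r * ky) * sin t
  + (- (r ^+ 2 * kxx / 2)) * cos t ^+ 2 + (- (r ^+ 2 * kxy / 2)) * (cos t * sin t)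
  + (- (r ^+ 2 * kyy / 2)) * sin t ^+ 2.
have hT (t : R) : h (a + r *: (cos t *: e1 + sin t *: e2)) <= Tp t.
  have [c1 s1] := le2 t.
  have cn : `|r *: (cos t *: e1 + sin t *: e2)| <= 2 * r.
    rewrite normrZ gtr0_norm // mulrC ler_wpM2r ?(ltW r0) //.
    exact: norm_circle_le.
  have := H2 _ (le_lt_trans cn rd2); rewrite [_ + a]addrC => H.
  have rc : `|r * cos t| <= r by rewrite normrM gtr0_norm // ler_piMr // ltW.
  have rs : `|r * sin t| <= r by rewrite normrM gtr0_norm // ler_piMr // ltW.
  have r2 : r < d by lra.
  have := T _ _ (le_lt_trans rc r2) (le_lt_trans rs r2).
  have -> : (r * cos t) *: e1 + (r * sin t) *: e2 + a = a + r *: (cos t *: e1 + sin t *: e2).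
    by rewrite scalerDr !scalerA addrC.
  have S : (`|r * cos t| + `|r * sin t|) ^+ 2 <= 4 * r ^+ 2.
    have : 0 <= `|r * cos t| by []; have : 0 <= `|r * sin t| by [].
    move: rc rs; move: (`|r * cos t|) (`|r * sin t|) => u v; nra.
  have S2 := ler_wpM2l (ltW e0) S.
  move=> /le_trans /(_ S2); rewrite ler_norml => /andP[L _].
  move: H L; rewrite /Tp.
  move: (cos t) (sin t) (laplacian k a) (h a) (k a) (h (a + _)) (k (a + _)) => c s u5 u4 u3 u1 u2.
  by lra.
have pi2 : 0 < 2 * pi :> R by rewrite mulr_gt0 // pi_gt0.
have cH : continuous (fun t => h (a + r *: (cos t *: e1 + sin t *: e2))).
  apply: continuous_circle; last exact: ltW.
  by move=> y yr; rewrite -(subrK a y); apply: H1; exact: le_lt_trans yr rd1.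
have IH : (\int[lebesgue_measure]_(t in `[0%R, (2 * pi)%R])
       (h (a + r *: (cos t *: e1 + sin t *: e2)))%:E <= \int[lebesgue_measure]_(t in `[0%R, (2 * pi)%R]) (Tp t)%:E)%E.
  apply: le_integral => //.
  - apply: continuous_compact_integrable; first exact: segment_compact.
    by apply: continuous_subspaceT => t; exact: cH.
  - apply: continuous_compact_integrable; first exact: segment_compact.
    apply: continuous_subspaceT => t; apply/differentiable_continuous/derivable1_diffP.
    rewrite /Tp; exact: ex_derive.
  - by move=> t _; rewrite lee_fin; exact: hT.
rewrite trig_integral in IH.
have c0 : (0 <= ((2 * pi)^-1 : R)%:E)%E by rewrite lee_fin invr_ge0 ltW.
have := le_trans hm (lee_wpmul2l c0 IH); rewrite -EFinM lee_fin.
set X := (X in _ <= X).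
have -> : X = h a - r ^+ 2 * (laplacian k a * 3 / 16).
  have LE : laplacian k a = kxx + kyy by [].
  rewrite /X LE; move: kx ky kxx kyy kxy {T Tp hT IH LE X} => kx ky kxx kyy kxy.
  have pin : pi != 0 :> R by rewrite lt0r_neq0 // pi_gt0.
  by move: pin; move: (pi : R) => P pin; field; rewrite pin.
have : 0 < r ^+ 2 * (laplacian k a * 3 / 16).
  by rewrite !mulr_gt0 // exprn_gt0.
move: (r ^+ 2 * _) => z; lra.
Unshelve. all: by end_near. Qed.

End SubMean.

(** * The Laplacian of the logarithmic pole *)

Section VectorCalculus.
Variable R : realType.

Lemma twice_deriveD (V : normedModType R) (f g : V -> R) x v :
  twice f x -> twice g x -> 'D_v (fun y => f y + g y) x = 'D_v f x + 'D_v g x.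
Proof. by move=> tf tg; have /nbhs_singleton := near_deriveD v tf tg. Qed.

Lemma twice_deriveM (V : normedModType R) (f g : V -> R) x v :
  twice f x -> twice g x ->
  'D_v (fun y => f y * g y) x = f x * 'D_v g x + g x * 'D_v f x.
Proof. by move=> tf tg; have /nbhs_singleton := near_deriveM v tf tg. Qed.

Lemma twice_sum (V : normedModType R) (I : Type) (r : seq I) (F : I -> V -> R) x :
  (forall i, twice (F i) x) ->
  [/\ twice (fun y => \sum_(i <- r) F i y) x,
      forall v, 'D_v (fun y => \sum_(i <- r) F i y) x = \sum_(i <- r) 'D_v (F i) x &
      forall v w, 'D_v (fun y => 'D_w (fun y => \sum_(i <- r) F i y) y) x =
        \sum_(i <- r) 'D_v (fun y => 'D_w (F i) y) x].
Proof.
move=> tF; elim: r => [|i r [IH1 IH2 IH3]].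
  have -> : (fun y => \sum_(i <- [::]) F i y) = cst (0 : R).
    by apply/funext => y; rewrite big_nil.
  have D0 v : (fun y : V => 'D_v (cst (0 : R)) y) = cst 0.
    by apply/funext => y; exact: derive_cst.
  split=> [|v|v w]; first exact: twice_cst.
    by rewrite big_nil derive_cst.
  by rewrite big_nil D0 derive_cst.
have -> : (fun y => \sum_(j <- i :: r) F j y) = (fun y => F i y + \sum_(j <- r) F j y).
  by apply/funext => y; rewrite big_cons.
split=> [|v|v w].
- exact: (twiceD (tF i) IH1).
- by rewrite big_cons -IH2; apply: twice_deriveD.
- by rewrite big_cons -IH3; apply: derive2D.
Qed.

Definition dot (m : nat) (x y : 'rV[R]_m) : R := \sum_i x 0 i * y 0 i.

Section Dot.
Variable m : nat.
Implicit Types x y z : 'rV[R]_m.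

Lemma dotC x y : dot x y = dot y x.
Proof. by apply: eq_bigr => i _; rewrite mulrC. Qed.

Lemma dotDl x y z : dot (x + y) z = dot x z + dot y z.
Proof. by rewrite -big_split; apply: eq_bigr => i _; rewrite mxE mulrDl. Qed.

Lemma dotZl (c : R) x y : dot (c *: x) y = c * dot x y.
Proof. by rewrite mulr_sumr; apply: eq_bigr => i _; rewrite mxE mulrA. Qed.

Lemma dot_ge0 x : 0 <= dot x x.
Proof. by apply: sumr_ge0 => i _; rewrite -expr2 sqr_ge0. Qed.

Lemma dot_eq0 x : dot x x = 0 -> x = 0.
Proof.
move=> /eqP; rewrite psumr_eq0; last by move=> i _; rewrite -expr2 sqr_ge0.
move=> /allP H; apply/rowP => i; rewrite mxE; have := H i (mem_index_enum _).
by rewrite mulf_eq0 orbb => /eqP.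
Qed.

Lemma coord_le_dot x i : x 0 i ^+ 2 <= dot x x.
Proof.
rewrite /dot (bigD1 i) //= -expr2 lerDl; apply: sumr_ge0 => j _.
by rewrite -expr2 sqr_ge0.
Qed.

Lemma dot_CS x y : dot x y ^+ 2 <= dot x x * dot y y.
Proof.
have [/dot_eq0 ->|y0] := eqVneq (dot y y) 0.
  have z0 z : dot z 0 = 0 by rewrite /dot big1 // => i _; rewrite mxE mulr0.
  by rewrite !z0 mulr0 expr0n.
have yp : 0 < dot y y by rewrite lt0r y0 dot_ge0.
have := dot_ge0 (x + (- (dot x y / dot y y)) *: y).
rewrite dotDl dotZl dotC dotDl dotZl [dot y (_ + _)]dotC dotDl dotZl [dot y x]dotC.
move=> H; have : 0 <= (dot x x - dot x y ^+ 2 / dot y y) * dot y y.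
  rewrite pmulr_lge0 //; move: H; congr (_ <= _); field; exact: y0.
by rewrite mulrBl divfK // subr_ge0.
Qed.

Lemma dot_add_le x y : dot (x + y) (x + y) <= 2 * (dot x x + dot y y).
Proof.
have := dot_ge0 (x + (-1) *: y).
rewrite !(dotDl, dotZl) ![dot _ (_ + _)]dotC !(dotDl, dotZl) [dot y x]dotC; lra.
Qed.

Lemma norm_le_dot x : `|x| ^+ 2 <= dot x x.
Proof.
have [->|x0] := eqVneq x 0; first by rewrite normr0 expr0n dot_ge0.
have := x0; rewrite -normr_eq0 => /(@mx_norm_neq0 R 1 m x)[[i j]] /= xe.
rewrite -[X in X ^+ 2 <= _]/(mx_norm x) xe ord1 real_normK ?num_real //.
exact: coord_le_dot.
Qed.

End Dot.

Lemma dot_mulmx_le (m n : nat) (x : 'rV[R]_m) (B : 'M[R]_(m, n)) (b : R) :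
  (forall i j, `|B i j| <= b) ->
  dot (x *m B) (x *m B) <= m%:R * n%:R * b ^+ 2 * dot x x.
Proof.
move=> Bb.
have -> : m%:R * n%:R * b ^+ 2 * dot x x = \sum_(j < n) m%:R * b ^+ 2 * dot x x.
  by rewrite sumr_const card_ord -mulr_natl; ring.
apply: ler_sum => j _; rewrite -expr2.
have -> : (x *m B) 0 j = dot x (\row_i B i j).
  by rewrite mxE; apply: eq_bigr => i _; rewrite mxE.
apply: le_trans (dot_CS _ _) _; rewrite mulrC ler_wpM2r ?dot_ge0 //.
have -> : m%:R * b ^+ 2 = \sum_(i < m) b ^+ 2.
  by rewrite sumr_const card_ord mulr_natl.
apply: ler_sum => i _; rewrite mxE -expr2 -[leLHS]real_normK ?num_real //.
by rewrite ler_sqr ?nnegrE // (le_trans _ (Bb i j)).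
Qed.

Variables (C2 : normedModType R) (e1 e2 : C2).
Local Notation laplacian := (laplacian e1 e2).

Section Laplacian.
Implicit Types (f g : C2 -> R) (x v : C2).

Lemma laplacianD f g x : twice f x -> twice g x ->
  laplacian (fun y => f y + g y) x = laplacian f x + laplacian g x.
Proof.
move=> tf tg; rewrite [RHS]addrACA.
exact: (congr2 +%R (derive2D e1 e1 tf tg) (derive2D e2 e2 tf tg)).
Qed.

Lemma laplacianM f g x : twice f x -> twice g x ->
  laplacian (fun y => f y * g y) x = f x * laplacian g x + g x * laplacian f x
    + 2 * ('D_e1 f x * 'D_e1 g x + 'D_e2 f x * 'D_e2 g x).
Proof.
move=> tf tg.
have E := congr2 +%R (derive2M e1 e1 tf tg) (derive2M e2 e2 tf tg).
apply: (etrans E); rewrite {E} /laplacian.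
move: ('D_e1 f x) ('D_e1 g x) ('D_e2 f x) ('D_e2 g x) => t1 t2 t3 t4.
move: ('D_e1 _ x) ('D_e1 _ x) ('D_e2 _ x) ('D_e2 _ x) => t5 t6 t7 t8.
ring.
Qed.

Lemma laplacian_comp (psi psi' : R -> R) (psi'' : R) f x : twice f x ->
  (\forall t \near f x, is_derive (t : R) (1 : R) psi (psi' t)) ->
  is_derive (f x) 1 psi' psi'' ->
  laplacian (fun y => psi (f y)) x =
    psi'' * ('D_e1 f x ^+ 2 + 'D_e2 f x ^+ 2) + psi' (f x) * laplacian f x.
Proof.
move=> tf d1 d2.
have E := congr2 +%R (derive2_comp1 e1 e1 tf d1 d2) (derive2_comp1 e2 e2 tf d1 d2).
apply: (etrans E); rewrite {E} /laplacian.
move: ('D_e1 f x) ('D_e2 f x) => t1 t2.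
move: ('D_e1 _ x) ('D_e2 _ x) => t5 t6.
ring.
Qed.

Lemma laplacian_cst (k : R) x : laplacian (fun=> k) x = 0.
Proof.
have D0 v : (fun y : C2 => 'D_v (cst k) y) = cst 0.
  by apply/funext => y; exact: derive_cst.
by rewrite /laplacian !D0 !derive_cst addr0.
Qed.

Lemma laplacianZ (k : R) f x : twice f x ->
  twice (fun y => k * f y) x /\
  laplacian (fun y => k * f y) x = k * laplacian f x.
Proof.
move=> tf; have tc := twice_cst k x; split; first exact: twiceM.
apply: (etrans (laplacianM tc tf)); rewrite laplacian_cst.
have -> : 'D_e1 (fun=> k) x = 0 by exact: derive_cst.
have -> : 'D_e2 (fun=> k) x = 0 by exact: derive_cst.
by move: ('D_e1 f x) ('D_e2 f x) (laplacian f x) (f x) => t1 t2 t3 t4; ring.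
Qed.

End Laplacian.

Section Vector.
Variable m : nat.
Implicit Types (G : C2 -> 'rV[R]_m) (x v : C2).

Definition vtwice G x := forall i, twice (fun y => G y 0 i) x.
Definition vderive v G x : 'rV[R]_m := \row_i 'D_v (fun y => G y 0 i) x.
Definition vlaplacian G x : 'rV[R]_m := \row_i laplacian (fun y => G y 0 i) x.

Lemma twice_dot G x : vtwice G x ->
  [/\ twice (fun y => dot (G y) (G y)) x,
      forall v, 'D_v (fun y => dot (G y) (G y)) x = 2 * dot (G x) (vderive v G x) &
      laplacian (fun y => dot (G y) (G y)) x =
       2 * (dot (vderive e1 G x) (vderive e1 G x) + dot (vderive e2 G x) (vderive e2 G x)
            + dot (G x) (vlaplacian G x))].
Proof.
move=> tG.
have tF i : twice (fun y => G y 0 i * G y 0 i) x by exact: twiceM.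
have [T1 T2 T3] := twice_sum (index_enum _) tF.
split=> //.
  move=> v; rewrite T2 mulr_sumr; apply: eq_bigr => i _.
  rewrite (twice_deriveM v (tG i) (tG i)) mxE.
  by rewrite -mulr2n mulr_natl.
apply: (etrans (congr2 +%R (T3 e1 e1) (T3 e2 e2))).
rewrite -!big_split mulr_sumr /=; apply: eq_bigr => i _.
have := laplacianM (tG i) (tG i); rewrite {1}/laplacian => ->.
rewrite !mxE; move: ('D_e1 _ x) ('D_e2 _ x) (laplacian _ x) => t1 t2 t3; ring.
Qed.

(** Applied with a graph matrix, this makes the invariant norm of [g - a] the Euclidean norm of an
    affine image of [g], to which [twice_dot] applies. *)
Lemma vtwice_affine (n : nat) G x (T : 'M[R]_(m, n)) (a : 'rV[R]_m) : vtwice G x ->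
  [/\ forall j, twice (fun y => ((G y - a) *m T) 0 j) x,
      forall v, \row_j 'D_v (fun y => ((G y - a) *m T) 0 j) x = vderive v G x *m T &
      \row_j laplacian (fun y => ((G y - a) *m T) 0 j) x = vlaplacian G x *m T].
Proof.
move=> tG.
have tFc i : twice (fun y => G y 0 i - a 0 i) x.
  exact: (twiceD (tG i) (twice_cst (- a 0 i) x)).
have tF j i : twice (fun y => (G y 0 i - a 0 i) * T i j) x.
  exact: (twiceM (tFc i) (twice_cst (T i j) x)).
have E j : (fun y => ((G y - a) *m T) 0 j) =
    (fun y => \sum_i (G y 0 i - a 0 i) * T i j).
  by apply/funext => y; rewrite mxE; apply: eq_bigr => i _; rewrite !mxE.
split=> [j|v|].
- by rewrite E; have [] := twice_sum (index_enum _) (tF j).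
- apply/rowP => j; rewrite !mxE E; have [_ -> _] := twice_sum (index_enum _) (tF j).
  apply: eq_bigr => i _; rewrite mxE.
  rewrite (twice_deriveM v (tFc i) (twice_cst (T i j) x)).
  rewrite (twice_deriveD v (tG i) (twice_cst (- a 0 i) x)).
  by rewrite !derive_cst mulr0 add0r addr0 mulrC.
- apply/rowP => j; rewrite !mxE E /laplacian.
  have [_ _ S] := twice_sum (index_enum _) (tF j).
  apply: (etrans (congr2 +%R (S e1 e1) (S e2 e2))); rewrite -big_split.
  apply: eq_bigr => i _ /=; rewrite mxE.
  have := laplacianM (tFc i) (twice_cst (T i j) x); rewrite {1}/laplacian => ->.
  rewrite laplacian_cst !derive_cst (laplacianD (tG i) (twice_cst (- a 0 i) x)).
  by rewrite laplacian_cst !mulr0 add0r !addr0 mulr0 addr0 mulrC.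
Qed.

End Vector.
End VectorCalculus.

(** * The differential inequality for the logarithmic pole *)

Section LogPole.
Variable R : realType.

(* With [X] and [XT + E] the two partial derivatives of [g] and [L] its Laplacian:
   [r] and [xi] are the [T]-invariant norms of [g - a] and [X]; [b1], [b2], [e], [l]
   are the products of [g - a] with [X], [XT], [E], [L]; [p] is that of [XT] with
   [E], and [s] is the squared norm of [E]. *)
Lemma log_pole_estimate (r xi r0 kap b1 b2 e l p s : R) :
  0 < r -> 0 <= xi -> 0 <= kap -> r <= r0 -> 20 * kap * r0 <= 1 ->
  b1 ^+ 2 + b2 ^+ 2 <= r ^+ 2 * xi ^+ 2 -> `|e| <= kap * r ^+ 2 * xi ->
  `|l| <= kap * r * xi ^+ 2 -> `|p| <= kap * r * xi ^+ 2 ->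
  0 <= s <= kap ^+ 2 * r ^+ 2 * xi ^+ 2 ->
  - (10 * xi ^+ 2 / r0 ^+ 2) <=
  (- (r ^- 4) - (2 * r0 * r ^+ 3)^-1) * (4 * (b1 ^+ 2 + (b2 + e) ^+ 2))
  + (r ^- 2 - 2 / r0 ^+ 2 + (r0 * r)^-1)
    * (2 * xi ^+ 2 + 2 * (xi ^+ 2 + 2 * p + s) + 2 * l).
Proof.
move=> r0p x0 k0 rr kr Hb He Hl Hp /andP[s0 Hs].
have r00 : 0 < r0 by exact: lt_le_trans rr.
have krr : 20 * (kap * r) <= 1.
  by apply: le_trans kr; rewrite -mulrA ler_pM2l // ler_wpM2l.
move: Hb Hs Hl Hp; have [X XE] : exists X, X = xi ^+ 2 by eexists.
have [q qE] : exists q, q = kap * r by eexists.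
rewrite -!XE -!qE => Hb Hs; rewrite -exprMn -qE in Hs; move=> Hl Hp.
rewrite -qE in krr.
have q0 : 0 <= q by rewrite qE mulr_ge0 // ltW.
have X0 : 0 <= X by rewrite XE sqr_ge0.
(* [LN] is the Laplacian of N = r^2, about 4 X, and [M] is the squared gradient of N divided by N,
   at most about 4 X. The logarithm contributes (LN - M) / r^2, where the main terms may cancel; the
   square root contributes (LN - M / 2) / (r0 r), which keeps a positive multiple of X. *)
set LN := 2 * X + 2 * (X + 2 * p + s) + 2 * l.
set M := 4 * (b1 ^+ 2 + (b2 + e) ^+ 2) / r ^+ 2.
have Hb2 : `|b2| <= r * xi.
  rewrite -ler_sqr ?nnegrE ?mulr_ge0 ?(ltW r0p) // exprMn real_normK ?num_real //.
  rewrite -XE; have := sqr_ge0 b1; move: Hb; lra.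
have qX : 0 <= q * X by rewrite mulr_ge0.
have qqX : q * (q * X) <= q * X / 20.
  have : 0 <= q * X * (1 - 20 * q) by rewrite mulr_ge0 // subr_ge0.
  lra.
have Hs' : s <= q * X.
  have : q ^+ 2 * X = q * (q * X) by ring.
  lra.
have LN1 : LN <= 5 * X /\ 4 * X - 6 * (q * X) <= LN.
  move: Hl Hp => /ler_normlP[Hl1 Hl2] /ler_normlP[Hp1 Hp2].
  have : 20 * (q * X) <= X by have := ler_wpM2r X0 krr; rewrite mul1r; lra.
  rewrite /LN; split; lra.
have M1 : M <= 4 * X + 12 * (q * X).
  rewrite /M ler_pdivrMr ?exprn_gt0 //.
  have He' : `|e| <= q * (r * xi) by move: He; rewrite qE; congr (_ <= _); ring.
  have be : b2 * e <= q * (r ^+ 2 * X).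
    apply: le_trans (ler_norm _) _; rewrite normrM.
    apply: le_trans (ler_pM _ _ Hb2 He') _ => //.
    by rewrite XE le_eqVlt; apply/orP; left; apply/eqP; ring.
  have ee : e ^+ 2 <= q * (q * X) * r ^+ 2.
    rewrite -real_normK ?num_real //.
    have := ler_pM (normr_ge0 e) (normr_ge0 e) He' He'.
    rewrite -expr2 => /le_trans; apply.
    by rewrite XE le_eqVlt; apply/orP; left; apply/eqP; ring.
  have : q * (q * X) * r ^+ 2 <= q * X / 20 * r ^+ 2.
    by rewrite ler_wpM2r // sqr_ge0.
  have : 0 <= q * X * r ^+ 2 by rewrite mulr_ge0 // sqr_ge0.
  rewrite [(b2 + e) ^+ 2](_ : _ = b2 ^+ 2 + 2 * (b2 * e) + e ^+ 2); last by ring.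
  lra.
have rn0 : r != 0 by rewrite gt_eqF.
have r0n0 : r0 != 0 by rewrite gt_eqF.
have -> : (- (r ^- 4) - (2 * r0 * r ^+ 3)^-1) * (4 * (b1 ^+ 2 + (b2 + e) ^+ 2))
  + (r ^- 2 - 2 / r0 ^+ 2 + (r0 * r)^-1) * LN
  = r ^- 2 * (LN - M) + (r0 * r)^-1 * (LN - M / 2) - 2 / r0 ^+ 2 * LN.
  by rewrite /M; field; rewrite rn0 r0n0.
have T1 : - (18 * kap / r * X) <= r ^- 2 * (LN - M).
  have -> : - (18 * kap / r * X) = r ^- 2 * (- (18 * (q * X))).
    by rewrite qE; field.
  rewrite ler_pM2l ?invr_gt0 ?exprn_gt0 //; lra.
have T2 : (r0 * r)^-1 * X <= (r0 * r)^-1 * (LN - M / 2).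
  rewrite ler_pM2l ?invr_gt0 ?mulr_gt0 //.
  have : 20 * (q * X) <= X by have := ler_wpM2r X0 krr; rewrite mul1r; lra.
  lra.
have T3 : 2 / r0 ^+ 2 * LN <= 10 * X / r0 ^+ 2.
  have -> : 10 * X / r0 ^+ 2 = 2 / r0 ^+ 2 * (5 * X) by field.
  by rewrite ler_pM2l ?divr_gt0 ?exprn_gt0 //; lra.
(* The loss from the logarithm is covered by the gain from the square root, since 20 kap r0 <= 1.
   Only the loss [T3] from the linear term remains. *)
have T4 : 18 * kap / r * X <= (r0 * r)^-1 * X.
  rewrite ler_wpM2r // invfM ler_pM2r ?invr_gt0 //.
  rewrite -[leRHS]mul1r ler_pdivlMr //.
  have : 0 <= kap * r0 by rewrite mulr_ge0 // ltW.
  lra.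
lra.
Qed.

End LogPole.

Section LogPoleLaplacian.
Variable R : realType.

(** Cauchy-Schwarz for [A] and a multiple of its projection onto the plane of [B] and [B']. Two
    separate Cauchy-Schwarz bounds would give twice the right-hand side, too much for the
    cancellation in [log_pole_estimate]. *)
Lemma bessel2 (m : nat) (A B B' : 'rV[R]_m) :
  dot B B' = 0 -> dot B' B' = dot B B ->
  dot A B ^+ 2 + dot A B' ^+ 2 <= dot A A * dot B B.
Proof.
move=> o n; set s := _ + _.
have s0 : 0 <= s by rewrite addr_ge0 // sqr_ge0.
have := dot_CS A (dot A B *: B + dot A B' *: B').
have -> : dot A (dot A B *: B + dot A B' *: B') = s.
  by rewrite dotC dotDl !dotZl [dot B A]dotC [dot B' A]dotC -!expr2.
have -> : dot (dot A B *: B + dot A B' *: B') (dot A B *: B + dot A B' *: B') = s * dot B B.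
  rewrite dotDl !dotZl ![dot _ (_ + _)]dotC !dotDl !dotZl [dot B' B]dotC o n.
  by rewrite /s; ring.
rewrite mulrCA expr2; have [->|sn] := eqVneq s 0.
  by move=> _; rewrite mulr_ge0 // dot_ge0.
by rewrite ler_pM2l // lt0r sn.
Qed.

Lemma quarter_square_le (u d Q : R) :
  4 * Q * u <= 1 -> u * (Q * d ^+ 2) <= (d / 2) ^+ 2.
Proof. by move=> H; have := ler_wpM2r (sqr_ge0 d) H; lra. Qed.

Lemma half_sum_le (u v w : R) : 0 <= v -> - (u / 2) <= w ->
  u <= 2 * (u + v + w).
Proof. lra. Qed.

(** With the inverse powers of r and r0 replaced by variables, the last combination in
    [log_pole_laplacian] becomes linear in the monomials. *)
Lemma sum_rearrange_ge0 (i4 i3 i2 j2 k b1 b2 e x2 p s l Q dd : R) :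
  - (10 * x2 / j2) <= (- i4 - i3) * (4 * (b1 ^+ 2 + (b2 + e) ^+ 2)) +
    (i2 - 2 / j2 + k) * (2 * x2 + 2 * (x2 + 2 * p + s) + 2 * l) ->
  10 / j2 * x2 <= 10 / j2 * (Q * dd) ->
  0 <= (- i4 - i3) * ((2 * b1) ^+ 2 + (2 * (b2 + e)) ^+ 2) +
    (i2 - 2 / j2 + k) * (2 * (x2 + (x2 + 2 * p + s) + l)) + 10 * Q / j2 * dd.
Proof. by move=> H1 H2; lra. Qed.

Section Graph.
Variables (m : nat) (T : 'M[R]_m).
Hypothesis TT : T *m T = - 1%:M.
Implicit Types x y : 'rV[R]_m.

Definition graph_mx : 'M[R]_(m, m + m) := row_mx 1%:M T.

(* [herm] is the [T]-invariant inner product <x, y> + <xT, yT>, obtained as the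
   restriction of the Euclidean one to the graph of [T]. *)
Definition herm x y := dot (x *m graph_mx) (y *m graph_mx).

Lemma hermE x y : herm x y = dot x y + dot (x *m T) (y *m T).
Proof.
rewrite /herm /graph_mx !mul_mx_row !mulmx1 /dot big_split_ord /=.
by congr (_ + _); apply: eq_bigr => i _; rewrite ?row_mxEl ?row_mxEr.
Qed.

Lemma hermT x : herm (x *m T) (x *m T) = herm x x.
Proof.
rewrite !hermE -!mulmxA TT mulmxN mulmx1 addrC; congr (_ + _).
by apply: eq_bigr => i _; rewrite mxE mulrNN.
Qed.

Lemma hermT0 x : herm x (x *m T) = 0.
Proof.
rewrite hermE -mulmxA TT mulmxN mulmx1 [dot (x *m T) _]dotC.
have -> : dot (- x) (x *m T) = - dot x (x *m T).
  by rewrite -scaleN1r dotZl mulN1r.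
by rewrite subrr.
Qed.

Lemma dot_le_herm x : dot x x <= herm x x.
Proof. by rewrite hermE lerDl dot_ge0. Qed.

Lemma hermC x y : herm x y = herm y x.
Proof. exact: dotC. Qed.

Lemma hermDl x y z : herm (x + y) z = herm x z + herm y z.
Proof. by rewrite /herm mulmxDl dotDl. Qed.

Lemma hermDr x y z : herm x (y + z) = herm x y + herm x z.
Proof. by rewrite /herm mulmxDl dotC dotDl; congr (_ + _); rewrite dotC. Qed.

Lemma herm_norm_le (u v : R) x y : 0 <= u -> 0 <= v ->
  herm x x <= u ^+ 2 -> herm y y <= v ^+ 2 -> `|herm x y| <= u * v.
Proof.
move=> u0 v0 hx hy.
rewrite -ler_sqr ?nnegrE ?mulr_ge0 // real_normK ?num_real //.
by rewrite exprMn (le_trans (dot_CS _ _)) // ler_pM // dot_ge0.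
Qed.

End Graph.

Variables (C2 : normedModType R) (e1 e2 : C2).

Section Pole.
Variables (m : nat) (g : C2 -> 'rV[R]_m) (T : 'M[R]_m) (a : 'rV[R]_m) (Q r0 : R).

(* The derivative in [N] of the first three terms vanishes at [N = r0 ^+ 2]. *)
Definition log_pole (y : C2) : R :=
  let N := herm T (g y - a) (g y - a) in
  ln N - 2 / r0 ^+ 2 * N + 2 / r0 * Num.sqrt N + 10 * Q / r0 ^+ 2 * dot (g y) (g y).

Let psi (t : R) := ln t - 2 / r0 ^+ 2 * t + 2 / r0 * Num.sqrt t.
Let psi' (t : R) := t^-1 - 2 / r0 ^+ 2 + r0^-1 * (Num.sqrt t)^-1.

Lemma is_derive_psi (t : R) : 0 < t -> is_derive t (1 : R) psi (psi' t).
Proof.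
move=> t0; have Dl := is_derive1_ln t0; have Ds := is_derive1_sqrt t0.
apply: is_derive_eq; rewrite /psi' /GRing.scale /= mulr1; congr (_ + _).
by rewrite invfM mulrA; congr (_ * _); rewrite mulrAC divff ?mul1r // pnatr_eq0.
Qed.

Lemma is_derive_psi' (t : R) : 0 < t -> 0 < r0 ->
  is_derive t (1 : R) psi'
    (- (Num.sqrt t ^- 4) - (2 * r0 * Num.sqrt t ^+ 3)^-1).
Proof.
move=> t0 r00; have Ds := is_derive1_sqrt t0.
have s0 : 0 < Num.sqrt t by rewrite sqrtr_gt0.
have D1 : is_derive t (1 : R) (fun y : R => y^-1) (- t ^- 2 *: 1).
  by apply: is_deriveV; rewrite gt_eqF.
have D2 : is_derive t (1 : R) (fun y : R => (Num.sqrt y)^-1)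
    (- Num.sqrt t ^- 2 *: (2 * Num.sqrt t)^-1).
  by apply: is_deriveV; rewrite gt_eqF.
apply: is_derive_eq; rewrite /GRing.scale /=.
have {1}-> : t = Num.sqrt t ^+ 2 by rewrite sqr_sqrtr // ltW.
by field; rewrite !gt_eqF.
Qed.

(** [Y - X *m T] measures how far [g] is from being holomorphic for the constant structure [T]. It
    is controlled by [g x - a], so the error terms are smaller than the main ones by a factor of
    order sqrt N. The loss 10 xi^2 / r0^2 left by [log_pole_estimate] is paid for by the last term
    of [log_pole]: the Laplacian of the squared norm of [g] is at least |X|^2. *)
Lemma log_pole_laplacian (x : C2) :
  let X := vderive e1 g x in let Y := vderive e2 g x in
  let L := vlaplacian e1 e2 g x in
  vtwice g x -> T *m T = - 1%:M -> 0 < Q -> 0 < r0 ->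
  (forall v, herm T v v <= Q * dot v v) ->
  dot (Y - X *m T) (Y - X *m T) <= Q * dot (g x - a) (g x - a) * dot X X ->
  dot L L <= Q * dot X X ^+ 2 ->
  4 * Q * dot (g x) (g x) <= 1 ->
  0 < herm T (g x - a) (g x - a) <= r0 ^+ 2 -> 20 * Q * r0 <= 1 ->
  twice log_pole x /\ 0 <= laplacian e1 e2 log_pole x.
Proof.
move=> X Y L tg TT Q0 r00 HQ HE HL Hg /andP[N0 Nr] Qr.
set ga := g x - a in HE N0 Nr.
have [tG DG LG] := vtwice_affine e1 e2 (graph_mx T) a tg.
have [tN DN LN] := twice_dot e1 e2 (tG : vtwice (fun y => (g y - a) *m graph_mx T) x).
set Nf := fun y => herm T (g y - a) (g y - a).
have {}DN v : 'D_v Nf x = 2 * herm T ga (vderive v g x).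
  by rewrite /Nf /herm DN /vderive DG.
have {}LN : laplacian e1 e2 Nf x = 2 * (herm T X X + herm T Y Y + herm T ga L).
  by rewrite /Nf /herm LN /vderive !DG /vlaplacian LG.
have {}tN : twice Nf x by [].
set N := Nf x; rewrite -[herm T ga ga]/N in N0 Nr.
set r := Num.sqrt N.
have r0p : 0 < r by rewrite sqrtr_gt0.
have rN : r ^+ 2 = N by rewrite sqr_sqrtr // ltW.
set xi := Num.sqrt (herm T X X).
have hX0 : 0 <= herm T X X by exact: dot_ge0.
have xiE : xi ^+ 2 = herm T X X by rewrite sqr_sqrtr.
have xi0 : 0 <= xi by exact: sqrtr_ge0.
have [E EE] : exists E, E = Y - X *m T by eexists.
rewrite -EE in HE.
have YE : Y = X *m T + E by rewrite EE addrC subrK.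
have dX : dot X X <= xi ^+ 2 by rewrite xiE dot_le_herm.
have dX0 := dot_ge0 X.
have dg : dot ga ga <= r ^+ 2 by rewrite rN /N /Nf -/ga dot_le_herm.
have hE : herm T E E <= (Q * r * xi) ^+ 2.
  apply: le_trans (HQ E) _.
  have := ler_wpM2l (ltW Q0) HE; move=> /le_trans; apply.
  have -> : Q * (Q * dot ga ga * dot X X) = Q ^+ 2 * (dot ga ga * dot X X) by ring.
  have -> : (Q * r * xi) ^+ 2 = Q ^+ 2 * (r ^+ 2 * xi ^+ 2) by ring.
  rewrite ler_pM2l ?exprn_gt0 //.
  by apply: ler_pM => //; exact: dot_ge0.
have hL : herm T L L <= (Q * xi ^+ 2) ^+ 2.
  apply: le_trans (HQ L) _.
  have := ler_wpM2l (ltW Q0) HL; move=> /le_trans; apply.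
  rewrite mulrA -expr2 exprMn ler_pM2l ?exprn_gt0 //.
  by rewrite ler_sqr ?nnegrE // exprn_ge0.
have hg : herm T ga ga <= r ^+ 2 by rewrite rN.
have qrx : 0 <= Q * r * xi by rewrite !mulr_ge0 // ltW.
have qx : 0 <= Q * xi ^+ 2 by rewrite !mulr_ge0 // ?exprn_ge0 // ltW.
have rr0 : r <= r0 by rewrite -ler_sqr ?nnegrE ?rN // ltW.
have hXT : herm T (X *m T) (X *m T) <= xi ^+ 2 by rewrite hermT // xiE.
have bes : herm T ga X ^+ 2 + herm T ga (X *m T) ^+ 2 <= r ^+ 2 * xi ^+ 2.
  rewrite rN xiE; apply: bessel2; first exact: hermT0.
  exact: hermT.
have He : `|herm T ga E| <= Q * r ^+ 2 * xi.
  have := herm_norm_le (ltW r0p) qrx hg hE.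
  by congr (_ <= _); ring.
have Hl : `|herm T ga L| <= Q * r * xi ^+ 2.
  have := herm_norm_le (ltW r0p) qx hg hL.
  by congr (_ <= _); ring.
have Hp : `|herm T (X *m T) E| <= Q * r * xi ^+ 2.
  have := herm_norm_le xi0 qrx hXT hE.
  by congr (_ <= _); ring.
have Hs : 0 <= herm T E E <= Q ^+ 2 * r ^+ 2 * xi ^+ 2.
  by rewrite dot_ge0 /= -!exprMn.
have est := log_pole_estimate r0p xi0 (ltW Q0) rr0 Qr bes He Hl Hp Hs.
have D1 : \forall t \near Nf x, is_derive (t : R) (1 : R) psi (psi' t).
  by have := lt_nbhsr N0; apply: filterS => t; exact: is_derive_psi.
have D2 := is_derive_psi' N0 r00.
have tpsi := twice_comp1 tN D1 D2.
have [td _ Ld] := twice_dot e1 e2 tg.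
have tc := twice_cst (10 * Q / r0 ^+ 2) x.
split; first exact: (twiceD tpsi (twiceM tc td)).
have -> : laplacian e1 e2 log_pole x = laplacian e1 e2 (fun y => psi (Nf y)) x +
    laplacian e1 e2 (fun y => 10 * Q / r0 ^+ 2 * dot (g y) (g y)) x.
  exact: (laplacianD e1 e2 tpsi (twiceM tc td)).
have -> := laplacianM e1 e2 tc td.
have -> := laplacian_comp e1 e2 tN D1 D2.
rewrite laplacian_cst !derive_cst !mul0r !addr0 mulr0 addr0 Ld LN (DN e1) (DN e2).
rewrite -/X -/Y -/L.
have hY : herm T ga Y = herm T ga (X *m T) + herm T ga E by rewrite YE hermDr.
have hYY : herm T Y Y = xi ^+ 2 + 2 * herm T (X *m T) E + herm T E E.
  rewrite YE hermDr 2!hermDl (hermC T E (X *m T)) hermT // -xiE.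
  by move: (herm T (X *m T) E) (herm T E E) => p s; ring.
(* By Cauchy-Schwarz and the bound on [L] this follows from 4 Q |g|^2 <= 1; half of |X|^2 is left
   over. *)
have dL : - (dot X X / 2) <= dot (g x) L.
  suff : `|dot (g x) L| <= dot X X / 2 by rewrite ler_norml => /andP[].
  rewrite -ler_sqr ?nnegrE ?divr_ge0 // real_normK ?num_real //.
  apply: le_trans (dot_CS _ _) _.
  have := ler_wpM2l (dot_ge0 (g x)) HL; move=> /le_trans; apply.
  exact: quarter_square_le.
have XQ : xi ^+ 2 <= Q * dot X X by rewrite xiE.
have i0 : 0 <= 10 / r0 ^+ 2 by rewrite divr_ge0 // exprn_ge0 // ltW.
have KK : dot X X <= 2 * (dot X X + dot Y Y + dot (g x) L).
  by apply: half_sum_le; rewrite ?dot_ge0.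
have := ler_wpM2l i0 (le_trans XQ (ler_wpM2l (ltW Q0) KK)).
rewrite mulr0 addr0 hY hYY -xiE.
move: est; rewrite /psi' -!/N -!/r -invfM.
have -> : N^-1 = r ^- 2 by rewrite rN.
exact: sum_rearrange_ge0.
Qed.

End Pole.
End LogPoleLaplacian.

(** * Discs in coordinates *)

Section CkFacts.
Variable R : realType.
Implicit Types V W : normedModType R.

Lemma Ck_ext V W k (A : set V) (f g : V -> W) : open A ->
  (forall x, A x -> f x = g x) -> Ck k A f -> Ck k A g.
Proof.
move=> oA; elim: k f g => [|k IH] f g fg /=.
  move=> cf x Ax; have : f y @[y --> x] --> f x := cf x Ax.
  rewrite (fg x Ax) => cx; apply: cvg_trans cx; apply: near_eq_cvg.
  by apply: filterS (open_nbhs_nbhs (conj oA Ax)) => y /fg.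
have nfg x : A x -> \forall y \near x, f y = g y.
  by move=> Ax; apply: filterS (open_nbhs_nbhs (conj oA Ax)) => y /fg.
move=> [df ddf]; split.
  by move=> x Ax; apply: near_eq_differentiable (nfg x Ax) (df x Ax).
move=> v; apply: IH (ddf v) => x Ax; exact: near_eq_derive (nfg x Ax).
Qed.

Lemma Ck_subset V W k (A B : set V) (f : V -> W) : B `<=` A -> Ck k A f -> Ck k B f.
Proof.
move=> BA; elim: k f => [|k IH] f /=; first by move=> cf x /BA; exact: cf.
by move=> [df ddf]; split=> [x /BA|v]; [exact: df | exact: IH].
Qed.

(** The factor [c] is there for the induction: each derivative brings out one more factor [r]. *)
Lemma Ck_affine V W k (A : set V) (f : V -> W) (c r : R) (a : V) : open A ->
  Ck k A f -> Ck k [set x | A (a + r *: x)] (fun x => c *: f (a + r *: x)).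
Proof.
move=> oA; have cl (x : V) : differentiable (fun x => a + r *: x) x.
  exact: (differentiableD (differentiable_cst a x) (ex_diff (is_diff_def := is_diff_scaler r x))).
have oB : open [set x | A (a + r *: x)].
  by apply: open_comp oA => x _; exact/differentiable_continuous.
elim: k c f => [|k IH] c f /=.
  move=> cf x Ax; apply: continuousZ; first exact: cvg_cst.
  apply: (@continuous_comp _ _ _ (fun x => a + r *: x) f); last exact: cf.
  exact/differentiable_continuous.
move=> [df ddf].
have dfa x : A (a + r *: x) -> differentiable (fun x => f (a + r *: x)) x.
  move=> Ax.
  exact: (@differentiable_comp _ _ _ _ (fun x => a + r *: x) f x (cl x) (df _ Ax)).
split=> [x Ax|v].
  exact: differentiableZ (dfa x Ax).
apply: (@Ck_ext _ _ _ _ (fun x => (c * r) *: 'D_v f (a + r *: x)) _ oB);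
  last by have := IH (c * r) _ (ddf v).
move=> x Ax; apply/esym.
rewrite (@deriveZ _ _ _ (fun x => f (a + r *: x))); last exact: diff_derivable (dfa x Ax).
rewrite deriveE; last exact: dfa.
rewrite (@diff_comp _ _ _ _ (fun x => a + r *: x) f) //; last exact: df.
rewrite /= -[in RHS]scalerA; congr (_ *: _).
rewrite [X in 'd f _ X](_ : _ = r *: v); last first.
  rewrite (@diffD _ _ _ (cst a) ( *:%R r)) //=.
  by rewrite diff_cst add0r diff_val.
by rewrite linearZ /= deriveE //; exact: df.
Qed.

Lemma Ck_twice V W (A : set V) (f : V -> W) x : open A -> A x -> Ck 2 A f -> twice f x.
Proof.
move=> oA Ax [df ddf]; split.
  by apply: filterS (open_nbhs_nbhs (conj oA Ax)) => y; exact: df.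
by move=> v; apply: (ddf v).1.
Qed.

Lemma differentiable_entry V (m n : nat) (f : V -> 'M[R]_(m, n)) x i j :
  differentiable f x -> differentiable (fun y => f y i j) x.
Proof.
move=> df; apply: (@differentiable_comp _ _ _ _ f (fun N : 'M[R]_(m, n) => N i j)) => //.
exact: differentiable_coord.
Qed.

Lemma derive_entry V (m n : nat) (f : V -> 'M[R]_(m, n)) x v i j :
  differentiable f x -> 'D_v (fun y => f y i j) x = ('D_v f x) i j.
Proof. by move=> df; rewrite derive_mx ?mxE //; exact: diff_derivable. Qed.

Lemma twice_entry V (m : nat) (f : V -> 'rV[R]_m) x i :
  twice f x -> twice (fun y => f y 0 i) x.
Proof.
move=> [df ddf]; split.
  by apply: filterS df => y; exact: differentiable_entry.
move=> v; apply: (@near_eq_differentiable _ _ _ (fun y => ('D_v f y) 0 i)).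
  by apply: filterS df => y dy; rewrite derive_entry.
exact: differentiable_entry (ddf v).
Qed.

Lemma derive_coords (m : nat) W (f : 'rV[R]_m -> W) x v : differentiable f x ->
  'D_v f x = \sum_i v 0 i *: 'D_(delta_mx 0 i) f x.
Proof.
move=> df; rewrite deriveE // {1}[v]row_sum_delta linear_sum; apply: eq_bigr => i _.
by rewrite linearZ /= deriveE.
Qed.

End CkFacts.

(** * Functions with locally bounded first derivatives *)

Section Tame.
Variable R : realType.
Implicit Types m n : nat.

(** What a Lipschitz bound with uniform constants near [x] requires. It is stable under sums,
    products and composition, hence can be checked factor by factor on the entries of [J_coord]. *)
Definition tame m (f : 'rV[R]_m -> R) (x : 'rV[R]_m) :=
  exists2 K : R, 0 <= K & \forall y \near x,
    [/\ differentiable f y, `|f y| <= K & forall v, `|'D_v f y| <= K * `|v|].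

Lemma coord_le_norm m (v : 'rV[R]_m) i : `|v 0 i| <= `|v|.
Proof.
rewrite -[leRHS]/(mx_norm v) mx_normrE.
exact: (le_bigmax _ (fun ij => `|v ij.1 ij.2|) (0, i)).
Qed.

Lemma norm_le_coords m (v : 'rV[R]_m) (K : R) : 0 <= K -> (forall i, `|v 0 i| <= K) -> `|v| <= K.
Proof.
move=> K0 H; rewrite -[leLHS]/(mx_norm v) mx_normrE; apply/bigmax_leP; split=> //.
by move=> [i j] _ /=; rewrite ord1.
Qed.

Lemma near_bounded (T : topologicalType) (h : T -> R) (x : T) : {for x, continuous h} ->
  \forall y \near x, `|h y| <= `|h x| + 1.
Proof.
move=> ch; have : \forall y \near x, `|h x - h y| < 1.
  by move/cvgrPdist_lt: ch; apply; exact: ltr01.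
apply: filterS => y H.
have := ler_normB (h x) (h x - h y); rewrite opprB addrC subrK => /le_trans; apply.
by rewrite lerD2l ltW.
Qed.

(** The derivatives along the finitely many basis vectors are continuous, hence bounded near [x],
    and by linearity they control all directions. *)
Lemma Ck_tame m n (A : set 'rV[R]_m) (f : 'rV[R]_m -> 'rV[R]_n) x i :
  open A -> A x -> Ck 1 A f -> tame (fun y => f y 0 i) x.
Proof.
move=> oA Ax [df ddf]; have nA := open_nbhs_nbhs (conj oA Ax).
have cd j : {for x, continuous (fun y => ('D_(delta_mx 0 j) f y) 0 i)}.
  apply: (@continuous_comp _ _ _ ('D_(delta_mx 0 j) f) (fun N : 'rV[R]_n => N 0 i)).
    exact: ddf.
  exact: coord_continuous.
pose K := `|f x 0 i| + 1 + \sum_j (`|('D_(delta_mx 0 j) f x) 0 i| + 1).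
have S0 : 0 <= \sum_j (`|('D_(delta_mx 0 j) f x) 0 i| + 1) by apply: sumr_ge0 => j _; rewrite addr_ge0.
exists K; first by rewrite !addr_ge0.
have Nd : \forall y \near x, forall j, `|('D_(delta_mx 0 j) f y) 0 i| <= `|('D_(delta_mx 0 j) f x) 0 i| + 1.
  exact: (filter_forall (nbhs_filter x) (fun j => near_bounded (cd j))).
have Nf : \forall y \near x, `|f y 0 i| <= `|f x 0 i| + 1.
  apply: (@near_bounded _ (fun y => f y 0 i)).
  exact/differentiable_continuous/differentiable_entry/df.
near=> y; have Ay : A y by near: y.
have Ndy : forall j, `|('D_(delta_mx 0 j) f y) 0 i| <= `|('D_(delta_mx 0 j) f x) 0 i| + 1 by near: y.
have dy := df y Ay; split; first exact: differentiable_entry.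
  have : `|f y 0 i| <= `|f x 0 i| + 1 by near: y.
  by rewrite /K => /le_trans; apply; rewrite lerDl.
move=> v; rewrite derive_entry // derive_coords // summxE.
apply: le_trans (ler_norm_sum _ _ _) _; rewrite /K mulrDl.
apply: ler_wpDl; first by rewrite mulr_ge0 // addr_ge0.
rewrite mulr_suml; apply: ler_sum => j _; rewrite mxE normrM mulrC.
apply: ler_pM => //; last exact: coord_le_norm.
Unshelve. all: by end_near. Qed.

Lemma tame_mul m (f g : 'rV[R]_m -> R) x : tame f x -> tame g x -> tame (fun y => f y * g y) x.
Proof.
move=> [K K0 Hf] [L L0 Hg]; exists (2 * (K * L)); first by rewrite !mulr_ge0.
near=> y.
have [d1 b1 D1] : [/\ differentiable f y, `|f y| <= K & forall v, `|'D_v f y| <= K * `|v|] by near: y.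
have [d2 b2 D2] : [/\ differentiable g y, `|g y| <= L & forall v, `|'D_v g y| <= L * `|v|] by near: y.
split; first exact: differentiableM.
  rewrite normrM; apply: (le_trans (ler_pM _ _ b1 b2)) => //.
  by apply: ler_peMl; rewrite ?mulr_ge0 ?ler1n.
move=> v; rewrite (@deriveM _ _ f g); try exact: diff_derivable.
apply: le_trans (ler_normD _ _) _; rewrite /GRing.scale /= !normrM.
have := ler_pM (normr_ge0 _) (normr_ge0 _) b1 (D2 v).
have := ler_pM (normr_ge0 _) (normr_ge0 _) b2 (D1 v).
move: (`|f y| * _) (`|g y| * _) => u1 u2; lra.
Unshelve. all: by end_near. Qed.

Lemma tame_sum m (I : Type) (r : seq I) (F : I -> 'rV[R]_m -> R) x :
  (forall i, tame (F i) x) -> tame (fun y => \sum_(i <- r) F i y) x.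
Proof.
move=> tF; elim: r => [|i r [L L0 Hg]].
  exists 0 => //; near=> y; have -> : (fun y => \sum_(i <- [::]) F i y) = cst (0 : R).
    by apply/funext => z; rewrite big_nil.
  split=> [||v]; first exact: differentiable_cst.
    by rewrite ?big_nil normr0.
  by rewrite derive_cst normr0 mul0r.
have [K K0 Hf] := tF i; exists (K + L); first exact: addr_ge0.
near=> y.
have [d1 b1 D1] : [/\ differentiable (F i) y, `|F i y| <= K & forall v, `|'D_v (F i) y| <= K * `|v|].
  by near: y.
have [d2 b2 D2] : [/\ differentiable (fun y => \sum_(j <- r) F j y) y,
    `|\sum_(j <- r) F j y| <= L &
    forall v, `|'D_v (fun y => \sum_(j <- r) F j y) y| <= L * `|v|] by near: y.
have -> : (fun y => \sum_(j <- i :: r) F j y) = (F i + (fun y => \sum_(j <- r) F j y)).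
  by apply/funext => z; rewrite big_cons.
split; first exact: differentiableD.
  by rewrite ?big_cons; apply: le_trans (ler_normD _ _) _; exact: lerD.
move=> v; rewrite deriveD; try exact: diff_derivable.
by apply: le_trans (ler_normD _ _) _; rewrite mulrDl lerD.
Unshelve. all: by end_near. Qed.

Lemma tame_comp m n (f : 'rV[R]_n -> R) (k : 'rV[R]_m -> 'rV[R]_n) x :
  tame f (k x) -> {for x, continuous k} -> (\forall y \near x, differentiable k y) ->
  (forall i, tame (fun y => k y 0 i) x) -> tame (fun y => f (k y)) x.
Proof.
move=> [K K0 Hf] ck dk tk.
have [L HL] := @choice _ _ (fun i L => 0 <= L /\ \forall y \near x,
    [/\ differentiable (fun y => k y 0 i) y, `|k y 0 i| <= L &
       forall v, `|'D_v (fun y => k y 0 i) y| <= L * `|v|])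
   (fun i => let: ex_intro2 L a b := tk i in ex_intro _ L (conj a b)).
pose B := \sum_i L i.
have B0 : 0 <= B by apply: sumr_ge0 => i _; exact: (HL i).1.
have LB i : L i <= B.
  rewrite /B (bigD1 i) //= lerDl; apply: sumr_ge0 => j _; exact: (HL j).1.
exists (K + K * B); first by rewrite addr_ge0 // mulr_ge0.
have Nk := filter_forall (nbhs_filter x) (fun i => (HL i).2).
near=> y.
have [d1 b1 D1] : [/\ differentiable f (k y), `|f (k y)| <= K & forall v, `|'D_v f (k y)| <= K * `|v|].
  by near: y; exact: (ck _ Hf).
have dky : differentiable k y by near: y.
have Nky : forall i, [/\ differentiable (fun y => k y 0 i) y, `|k y 0 i| <= L i &
       forall v, `|'D_v (fun y => k y 0 i) y| <= L i * `|v|] by near: y.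
have Dk v : `|'D_v k y| <= B * `|v|.
  apply: norm_le_coords => [|i]; first by rewrite mulr_ge0.
  rewrite -derive_entry //.
  have [_ _ /(_ v)] := Nky i.
  by move=> /le_trans; apply; rewrite ler_wpM2r.
split; first exact: (@differentiable_comp _ _ _ _ k f).
  by apply: le_trans b1 _; rewrite lerDl mulr_ge0.
move=> v; rewrite deriveE; last exact: (@differentiable_comp _ _ _ _ k f).
rewrite (@diff_comp _ _ _ _ k f) //= -deriveE // -deriveE //.
apply: le_trans (D1 _) _; rewrite mulrDl ler_wpDl ?mulr_ge0 //.
by rewrite -mulrA ler_wpM2l.
Unshelve. all: by end_near. Qed.

End Tame.

(** * Differentials and changes of chart *)

Section Charts.
Variables (R : realType) (M : topologicalType) (m : nat) (S : manifold R M m).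
Implicit Types (c d : chart R M m) (U : set M).

Lemma chart_image_open c U : open U -> open (c @` (chart_dom c `&` U)).
Proof.
move=> oU; rewrite openE => y [x [cx Ux] <-].
have [oi ci] : open (c @` chart_dom c) /\ (c @` chart_dom c) (c x).
  by split; [exact: chart_im_open | exists x].
have N1 := open_nbhs_nbhs (conj oi ci).
have N2 : \forall y \near c x, U (chart_inv c y).
  apply: (chart_inv_cont ci); rewrite chart_funK //.
  exact: open_nbhs_nbhs (conj oU Ux).
rewrite /interior; near=> y'; have [x' cx' yE] : (c @` chart_dom c) y' by near: y'.
exists x' => //; split=> //; rewrite -(chart_funK cx') yE; near: y'; exact: N2.
Unshelve. all: by end_near. Qed.

Lemma near_chart_invK c x : chart_dom c x -> \forall y \near x, chart_inv c (c y) = y.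
Proof.
move=> cx; apply: filterS (open_nbhs_nbhs (conj (@chart_dom_open _ _ _ c) cx)) => y.
exact: chart_funK.
Qed.

Local Notation at_ := (chart_at S).

Lemma differentiable_transition c d x : atlas S c -> atlas S d ->
  chart_dom c x -> chart_dom d x -> differentiable (d \o chart_inv c) (c x).
Proof.
move=> ac ad cx dx; have [H _] := atlas_compat ac ad 1%N; apply: H.
by exists x.
Qed.

Section Chain.
Variables V W : normedModType R.
Implicit Types (f : V -> M) (g : M -> W).

Lemma near_comp_chart f g c x : {for x, continuous f} -> chart_dom c (f x) ->
  \forall y \near x, g (f y) = ((g \o chart_inv c) \o (c \o f)) y.
Proof.
move=> cf cx.
have H : \forall y \near x, chart_inv c (c (f y)) = f y := cf _ (near_chart_invK cx).
by apply: filterS H => y /= ->.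
Qed.

Lemma diff_comp_chart f g c x : {for x, continuous f} -> chart_dom c (f x) ->
  differentiable (c \o f) x -> differentiable (g \o chart_inv c) (c (f x)) ->
  differentiable (g \o f) x /\
  forall h, 'd (g \o f) x h = 'd (g \o chart_inv c) (c (f x)) ('d (c \o f) x h).
Proof.
move=> cf cx df dg.
have E := near_comp_chart g cf cx.
have dc := @differentiable_comp _ _ _ _ (c \o f) (g \o chart_inv c) x df dg.
have dgf : differentiable (g \o f) x.
  apply: near_eq_differentiable dc; apply: filterS E => y.
  exact: esym.
split=> // h; rewrite -deriveE // (near_eq_derive _ E) deriveE //.
by rewrite (@diff_comp _ _ _ _ (c \o f) (g \o chart_inv c)).
Qed.

Lemma diff_chain f g x : {for x, continuous f} ->
  differentiable (at_ (f x) \o f) x ->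
  differentiable (g \o chart_inv (at_ (f x))) (at_ (f x) (f x)) ->
  differentiable (g \o f) x /\
  forall h, 'd (g \o f) x h = diff_from S g (f x) (diff_into S f x h).
Proof. by move=> cf; apply: diff_comp_chart => //; exact: chart_at_dom. Qed.

End Chain.

(** With [diff_fromE], this allows working in one fixed chart: the preferred chart [chart_at] may
    jump from point to point. *)
Lemma diff_intoE (V : normedModType R) (f : V -> M) c x : atlas S c -> {for x, continuous f} -> chart_dom c (f x) ->
  differentiable (c \o f) x ->
  forall h, diff_into S f x h =
    'd (at_ (f x) \o chart_inv c) (c (f x)) ('d (c \o f) x h).
Proof.
move=> ac cf cx df.
have dt := differentiable_transition ac (chart_at_atlas S (f x)) cx (chart_at_dom S (f x)).
by have [_] := diff_comp_chart cf cx df dt.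
Qed.

Lemma diff_fromE (W : normedModType R) (g : M -> W) c q : atlas S c -> chart_dom c q ->
  differentiable (g \o chart_inv c) (c q) ->
  differentiable (g \o chart_inv (at_ q)) (at_ q q) /\
  forall v, diff_from S g q v =
    'd (g \o chart_inv c) (c q) ('d (c \o chart_inv (at_ q)) (at_ q q) v).
Proof.
move=> ac cq dg.
have aq : chart_dom (at_ q) q by exact: chart_at_dom.
have qq : chart_inv (at_ q) (at_ q q) = q by exact: chart_funK.
have cont : {for at_ q q, continuous (chart_inv (at_ q))}.
  by apply: chart_inv_cont; exists q.
have dt : differentiable (c \o chart_inv (at_ q)) (at_ q q).
  by apply: differentiable_transition => //; exact: chart_at_atlas.
have := @diff_comp_chart _ _ (chart_inv (at_ q)) g c (at_ q q) cont.
by rewrite qq => /(_ cq dt dg).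
Qed.

End Charts.

Section UnitBall.
Variables (R : realType) (m : nat).

Lemma twice_id (V : normedModType R) (x : V) : twice id x.
Proof.
split; first by near=> y; exact: ex_diff.
move=> v; have -> : (fun y : V => 'D_v id y) = cst v.
  by apply/funext => y; exact: derive_id.
exact: differentiable_cst.
Unshelve. all: by end_near. Qed.

Lemma dot_continuous : continuous (fun x : 'rV[R]_m => dot x x).
Proof.
move=> x; apply/differentiable_continuous/twice_diff.
by have [] := @twice_dot R _ 0 0 m id x (fun i => twice_entry i (twice_id x)).
Qed.

Lemma unit_ballE (x : 'rV[R]_m) : unit_ball x <-> dot x x < 1.
Proof.
have -> : unit_ball x = (enorm x < 1) by [].
have -> : enorm x = Num.sqrt (dot x x) by rewrite /enorm /dot; congr Num.sqrt; apply: eq_bigr => i _.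
by rewrite -[X in _ < X]sqrtr1 ltr_sqrt.
Qed.

Lemma open_unit_ball : open (@unit_ball R m).
Proof.
have -> : @unit_ball R m = (fun x => dot x x) @^-1` [set y | y < 1].
  by apply/seteqP; split=> x /=; rewrite unit_ballE.
apply: open_comp; last exact: open_lt.
by move=> x _; exact: dot_continuous.
Qed.

Lemma unit_ball0 : unit_ball (0 : 'rV[R]_m).
Proof. by apply/unit_ballE; rewrite /dot big1 // => i _; rewrite mxE mul0r. Qed.

Lemma tame_near_eq (f g : 'rV[R]_m -> R) x :
  (\forall y \near x, f y = g y) -> tame f x -> tame g x.
Proof.
move=> fg [K K0 Hf]; have fg2 := near_join fg; exists K => //; near=> y.
have E : \forall y' \near y, f y' = g y' by near: y.
have [d b D] : [/\ differentiable f y, `|f y| <= K & forall v, `|'D_v f y| <= K * `|v|] by near: y.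
split; first exact: near_eq_differentiable E d.
  by rewrite -(nbhs_singleton E).
by move=> v; rewrite -(near_eq_derive v E).
Unshelve. all: by end_near. Qed.

End UnitBall.

Lemma conj_mx_sqr (R : realType) (m : nat) (A K B : 'M[R]_m) :
  A *m B = 1%:M -> B *m A = 1%:M -> K *m K = - 1%:M ->
  A *m K *m B *m (A *m K *m B) = - 1%:M.
Proof.
move=> AB BA KK; rewrite !mulmxA -[A *m K *m B *m A]mulmxA BA mulmx1.
by rewrite -[A *m K *m K]mulmxA KK mulmxN mulmx1 mulNmx AB.
Qed.

Lemma diff_near_comp (R : realType) (V V' W : normedModType R)
    (F : V -> W) (k : V -> V') (G : V' -> W) x h :
  (\forall y \near x, F y = (G \o k) y) -> differentiable k x ->
  differentiable G (k x) -> 'd F x h = 'd G (k x) ('d k x h).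
Proof.
move=> E dk dG; have dc := @differentiable_comp _ _ _ _ k G x dk dG.
have dF : differentiable F x.
  by apply: near_eq_differentiable dc; apply: filterS E => y ->.
rewrite -deriveE // (near_eq_derive _ E) deriveE //.
by rewrite (@diff_comp _ _ _ _ k G).
Qed.

Section DiffLinear.
Variables (R : realType) (M : topologicalType) (m : nat) (S : manifold R M m).

Lemma diff_into_coords n (f : 'rV[R]_n -> M) x h :
  diff_into S f x h = \sum_l h 0 l *: diff_into S f x (delta_mx 0 l).
Proof.
rewrite /diff_into; move: ('d _ x) => L.
by rewrite {1}[h]row_sum_delta linear_sum; apply: eq_bigr => l _; rewrite linearZ.
Qed.

Lemma diff_from_sum (W : normedModType R) (g : M -> W) q n (a : 'I_n -> R) (v : 'I_n -> 'rV[R]_m) :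
  diff_from S g q (\sum_l a l *: v l) = \sum_l a l *: diff_from S g q (v l).
Proof.
rewrite /diff_from; move: ('d _ _) => L.
by rewrite linear_sum; apply: eq_bigr => l _; rewrite linearZ.
Qed.

End DiffLinear.

(** * The almost complex structure in the coordinates [z] *)

Section Coordinates.
Variables (R : realType) (M : topologicalType) (m : nat) (S : manifold R M m).
Variables (J : almost_complex S) (U : set M) (z : M -> 'rV[R]_m) (w : 'rV[R]_m -> M).
Hypotheses (Uopen : open U) (zC : forall k, Ck_on S k U z)
  (wC : smooth_into S (@unit_ball R m) w)
  (Uz : forall x, U x -> unit_ball (z x) /\ w (z x) = x)
  (Bw : forall y, unit_ball y -> U (w y) /\ z (w y) = y).
Local Notation at_ := (chart_at S).

Lemma diff_z (c : chart R M m) x : atlas S c -> chart_dom c x -> U x ->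
  differentiable (z \o chart_inv c) (c x).
Proof. by move=> ac cx Ux; have [H _] := zC 1 ac; apply: H; exists x. Qed.

Lemma z_continuous x : U x -> {for x, continuous z}.
Proof.
move=> Ux; have cx := chart_at_dom S x.
have dz := diff_z (chart_at_atlas S x) cx Ux.
have c1 : {for x, continuous ((z \o chart_inv (at_ x)) \o at_ x)}.
  apply: continuous_comp; first exact: chart_fun_cont.
  exact: differentiable_continuous.
have E : \forall y \near x, ((z \o chart_inv (at_ x)) \o at_ x) y = z y.
  by apply: filterS (near_chart_invK cx) => y /= ->.
have : ((z \o chart_inv (at_ x)) \o at_ x) y @[y --> x] --> z x.
  by rewrite -(nbhs_singleton E); exact: c1.
by move=> H; apply: cvg_trans H; apply: near_eq_cvg; apply: filterS E => y ->.
Qed.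

Lemma open_w_dom (c : chart R M m) : open (@unit_ball R m `&` w @^-1` chart_dom c).
Proof.
rewrite openE => y [By cy]; rewrite /interior.
have N1 := open_nbhs_nbhs (conj (@open_unit_ball R m) By).
have N2 : \forall y' \near y, chart_dom c (w y').
  have nd : nbhs (w y) (chart_dom c).
    exact: open_nbhs_nbhs (conj (@chart_dom_open _ _ _ c) cy).
  exact: (wC.1 y By _ nd).
by apply: filterS2 N1 N2.
Qed.

Lemma diff_w (c : chart R M m) y : atlas S c -> unit_ball y -> chart_dom c (w y) ->
  differentiable (c \o w) y.
Proof. by move=> ac By cy; have [H _] := wC.2 c ac 1%N; apply: H. Qed.

(** The push-forward of [J] by [z], as a matrix field on the unit ball. *)
Definition J_coord (y : 'rV[R]_m) : 'M[R]_m :=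
  let e := at_ (w y) in
  jacobian (e \o w) y *m J (w y) *m jacobian (z \o chart_inv e) (e (w y)).

Lemma J_coordE y k : unit_ball y ->
  k *m J_coord y = diff_from S z (w y) (diff_into S w y k *m J (w y)).
Proof. by move=> By; rewrite /J_coord /jacobian !mulmxA !mul_rV_lin1. Qed.

Lemma jacobian_wz y : unit_ball y ->
  jacobian (at_ (w y) \o w) y *m jacobian (z \o chart_inv (at_ (w y))) (at_ (w y) (w y)) = 1%:M.
Proof.
move=> By; apply/row_matrixP => i; rewrite !rowE mulmxA /jacobian !mul_rV_lin1 mulmx1.
have [Uy zy] := Bw By.
have aw := diff_w (chart_at_atlas S (w y)) By (chart_at_dom S (w y)).
have az := diff_z (chart_at_atlas S (w y)) (chart_at_dom S (w y)) Uy.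
have [dc <-] := diff_comp_chart (wC.1 y By) (chart_at_dom S (w y)) aw az.
have E : \forall y' \near y, (z \o w) y' = id y'.
  by apply: filterS (open_nbhs_nbhs (conj (@open_unit_ball R m) By)) => y' /Bw[].
by rewrite -deriveE // (near_eq_derive _ E) derive_id.
Qed.

Lemma J_coord_sqr y : unit_ball y -> J_coord y *m J_coord y = - 1%:M.
Proof.
move=> By; have AB := jacobian_wz By; have BA := mulmx1C AB.
exact: conj_mx_sqr AB BA (acs_sqr J (w y)).
Qed.

(** The definition of [J_coord] uses the preferred chart at [w y], which varies with [y]. Near [y0]
    everything is rewritten in the single chart [c], where the smoothness of [w], [J] and [z] gives
    the regularity of the three kinds of factors. *)
Lemma J_coord_tame y0 i j : unit_ball y0 -> tame (fun y => J_coord y i j) y0.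
Proof.
move=> By0; set c := at_ (w y0).
have ac : atlas S c by exact: chart_at_atlas.
have cy0 : chart_dom c (w y0) by exact: chart_at_dom.
have oB := @open_w_dom c; have B0 : (@unit_ball R m `&` w @^-1` chart_dom c) y0 by [].
pose Phi x h := diff_from S c (chart_inv c x)
  (diff_into S (chart_inv c) x h *m J (chart_inv c x)).
(* [acs_smooth] concerns one fixed vector at a time, hence the expansion in the standard basis. *)
have PhiE x h : Phi x h = \sum_l h 0 l *: Phi x (delta_mx 0 l).
  rewrite /Phi (diff_into_coords _ _ _ h) mulmx_suml -diff_from_sum.
  by congr (diff_from _ _ _ _); apply: eq_bigr => l _; rewrite -scalemxAl.
have E : \forall y \near y0,
  \sum_k (\sum_l ('D_(delta_mx 0 i) (c \o w) y) 0 l * (Phi (c (w y)) (delta_mx 0 l)) 0 k)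
    * ('D_(delta_mx 0 k) (z \o chart_inv c) (c (w y))) 0 j = J_coord y i j.
  apply: filterS (open_nbhs_nbhs (conj oB B0)) => y [By cy].
  have [Uy zy] := Bw By.
  have dw := diff_w ac By cy; have dz := diff_z ac cy Uy.
  have -> : J_coord y i j = ((delta_mx 0 i : 'rV[R]_m) *m J_coord y) 0 j by rewrite -rowE [RHS]mxE.
  have qq : chart_inv c (c (w y)) = w y by exact: chart_funK.
  have H h : diff_from S z (w y) (diff_into S w y h *m J (w y)) =
      'd (z \o chart_inv c) (c (w y)) (Phi (c (w y)) ('d (c \o w) y h)).
    rewrite (diff_fromE ac cy dz).2 (diff_intoE ac (wC.1 y By) cy dw).
    by rewrite /Phi /diff_from /diff_into qq.
  rewrite J_coordE // H; move: (delta_mx 0 i) => d.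
  rewrite -(deriveE _ dz) (derive_coords _ dz) summxE; apply: eq_bigr => k _.
  rewrite [RHS]mxE; congr (_ * _); rewrite PhiE summxE; apply: eq_bigr => l _.
  by rewrite [RHS]mxE (deriveE _ dw).
apply: tame_near_eq E _.
have im0 : (c @` (chart_dom c `&` U)) (c (w y0)).
  by exists (w y0) => //; split=> //; have [] := Bw By0.
have oim := @chart_image_open _ _ _ c U Uopen.
have oim' := @chart_im_open _ _ _ c.
have im0' : (c @` chart_dom c) (c (w y0)) by exists (w y0).
have cw : {for y0, continuous (c \o w)}.
  by apply: differentiable_continuous; exact: diff_w.
have Ndw : \forall y \near y0, differentiable (c \o w) y.
  by apply: filterS (open_nbhs_nbhs (conj oB B0)) => y [By cy]; exact: diff_w.
have tw l : tame (fun y => (c \o w) y 0 l) y0.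
  by apply: Ck_tame oB B0 _; exact: (wC.2 c ac 1%N).
apply: tame_sum => k; apply: tame_mul.
  apply: tame_sum => l; apply: tame_mul.
    by apply: Ck_tame oB B0 _; have [_ H] := wC.2 c ac 2%N; exact: H.
  apply: (@tame_comp _ _ _ (fun x => Phi x (delta_mx 0 l) 0 k) (c \o w)) => //.
  by apply: Ck_tame oim' im0' _; exact: (acs_smooth J ac (delta_mx 0 l) 1%N).
apply: (@tame_comp _ _ _ (fun x => 'D_(delta_mx 0 k) (z \o chart_inv c) x 0 j) (c \o w)) => //.
by apply: Ck_tame oim im0 _; have [_ H] := zC 2 ac; exact: H.
Qed.

(** Near [x] the disc [f] is [w] composed with [z \o f], so the Cauchy-Riemann equation passes to
    [z \o f] by the chain rule. *)
Lemma disc_coord (f : 'rV[R]_(1 + 1) -> M) N x : J_disc J N f -> disc x -> U (f x) ->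
  differentiable (z \o f) x /\
  forall h, 'd (z \o f) x (h *m Jst R 1) = 'd (z \o f) x h *m J_coord (z (f x)).
Proof.
move=> [[fc fs] _ fJ] dx Ux.
have [Bz wz] := Uz Ux.
have df c : atlas S c -> chart_dom c (f x) -> differentiable (c \o f) x.
  by move=> ac cx; have [H _] := fs c ac 1%N; apply: H.
have dfe := df _ (chart_at_atlas S (f x)) (chart_at_dom S (f x)).
have dz := diff_z (chart_at_atlas S (f x)) (chart_at_dom S (f x)) Ux.
have [dzf zfE] := diff_chain (fc x dx) dfe dz.
have wc := wC.1 _ Bz.
have Bzx : chart_dom (at_ (f x)) (w (z (f x))) by rewrite wz; exact: chart_at_dom.
have dwe := diff_w (chart_at_atlas S (f x)) Bz Bzx.
have Nf : \forall y \near x, U (f y) := fc x dx _ (open_nbhs_nbhs (conj Uopen Ux)).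
have E : \forall y \near x, (at_ (f x) \o f) y = ((at_ (f x) \o w) \o (z \o f)) y.
  by apply: filterS Nf => y Uy /=; rewrite (Uz Uy).2.
have DI h : diff_into S f x h = diff_into S w (z (f x)) ('d (z \o f) x h).
  rewrite /diff_into wz; exact: diff_near_comp E dzf dwe.
split; first by [].
move=> h; transitivity (diff_from S z (f x) (diff_into S f x h *m J (f x))).
  by rewrite zfE (fJ x h dx).
apply: esym; apply: (etrans (J_coordE _ Bz)); rewrite wz.
exact: (congr1 (fun u => diff_from S z (f x) (u *m J (f x))) (esym (DI h))).
Qed.

End Coordinates.

(** * The Cauchy-Riemann equation differentiated once *)

Section HoloLaplacian.
Variables (R : realType) (C2 : normedModType R).

Lemma derive_comp (V W : normedModType R) (k : C2 -> V) (F : V -> W) x v :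
  differentiable k x -> differentiable F (k x) ->
  'D_v (fun y => F (k y)) x = 'D_('D_v k x) F (k x).
Proof.
move=> dk dF; have dc := @differentiable_comp _ _ _ _ k F x dk dF.
apply: (etrans (deriveE v dc)); rewrite (@diff_comp _ _ _ _ k F) //=.
by apply: esym; apply: (etrans (deriveE _ dF)); rewrite deriveE.
Qed.

Lemma differentiable_sum_mul (I : Type) (r : seq I) (F G : I -> C2 -> R) x :
  (forall i, differentiable (F i) x) -> (forall i, differentiable (G i) x) ->
  differentiable (fun y => \sum_(i <- r) F i y * G i y) x /\
  forall v, 'D_v (fun y => \sum_(i <- r) F i y * G i y) x =
    \sum_(i <- r) (F i x * 'D_v (G i) x + G i x * 'D_v (F i) x).
Proof.
move=> dF dG; elim: r => [|i r [IH1 IH2]].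
  have -> : (fun y => \sum_(i <- [::]) F i y * G i y) = cst (0 : R).
    by apply/funext => y; rewrite big_nil.
  by split=> [|v]; [exact: differentiable_cst | rewrite big_nil derive_cst].
have -> : (fun y => \sum_(j <- i :: r) F j y * G j y) =
    (F i * G i) + (fun y => \sum_(j <- r) F j y * G j y).
  by apply/funext => y; rewrite big_cons.
have d1 := differentiableM (dF i) (dG i).
split=> [|v]; first exact: differentiableD.
have D1 : derivable (F i * G i) x v by exact: diff_derivable.
have D2 : derivable (fun y => \sum_(j <- r) F j y * G j y) x v by exact: diff_derivable.
have D3 : derivable (F i) x v by exact: diff_derivable.
have D4 : derivable (G i) x v by exact: diff_derivable.
by rewrite (deriveD D1 D2) (deriveM D3 D4) big_cons IH2.
Qed.

Lemma vtwice_comp (m n : nat) (phi : 'rV[R]_m -> 'rV[R]_n) (k : C2 -> 'rV[R]_m) x :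
  twice phi (k x) -> twice k x -> vtwice (fun y => phi (k y)) x.
Proof.
move=> tphi tk j.
have ck := differentiable_continuous (twice_diff tk).
have N1 : \forall y \near x, differentiable phi (k y) := ck _ tphi.1.
have N2 := tk.1.
have dpk y : differentiable phi (k y) -> differentiable k y ->
    differentiable (fun y => phi (k y)) y.
  by move=> d1 d2; exact: (@differentiable_comp _ _ _ _ k phi).
split.
  by apply: filterS2 N1 N2 => y d1 d2; apply: differentiable_entry; exact: dpk.
move=> v.
have E : \forall y \near x,
    \sum_i ('D_v k y) 0 i * ('D_(delta_mx 0 i) phi (k y)) 0 j =
    'D_v (fun y => phi (k y) 0 j) y.
  apply: filterS2 N1 N2 => y d1 d2.
  rewrite derive_entry; last exact: dpk.
  rewrite (derive_comp v d2 d1) (derive_coords _ d1) summxE.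
  by apply: eq_bigr => i _; rewrite mxE.
apply: near_eq_differentiable E _.
apply: (differentiable_sum_mul _ _ _).1 => i.
  exact: differentiable_entry (tk.2 v).
apply: (@differentiable_comp _ _ _ _ k (fun u => 'D_(delta_mx 0 i) phi u 0 j)).
  exact: twice_diff tk.
exact: differentiable_entry (tphi.2 _).
Qed.

Variables (e1 e2 : C2) (m : nat) (g : C2 -> 'rV[R]_m) (Jm : 'rV[R]_m -> 'M[R]_m) (x : C2).
Hypotheses (tg : vtwice g x) (dg : differentiable g x)
  (pde : \forall y \near x, forall j,
     'D_e2 (fun y => g y 0 j) y = \sum_i 'D_e1 (fun y => g y 0 i) y * Jm (g y) i j)
  (dJ : forall i j, differentiable (fun u => Jm u i j) (g x))
  (JJ : Jm (g x) *m Jm (g x) = - 1%:M).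

Definition dmx (v : 'rV[R]_m) : 'M[R]_m := \matrix_(i, j) 'D_v (fun u => Jm u i j) (g x).

Lemma vderive_diff v : vderive v g x = 'D_v g x.
Proof. by apply/rowP => i; rewrite mxE derive_entry. Qed.

Lemma vderive_pde : vderive e2 g x = vderive e1 g x *m Jm (g x).
Proof.
apply/rowP => j; rewrite !mxE (nbhs_singleton pde); apply: eq_bigr => i _.
by rewrite mxE.
Qed.

(** With subscripts for partial derivatives, g_y = g_x J(g) is differentiated in both directions. By
    symmetry of the mixed derivatives, g_xx reappears in g_yy multiplied by J^2 = -1 and cancels in
    the sum, which leaves an expression quadratic in the first derivatives. *)
Lemma vlaplacian_pde :
  vlaplacian e1 e2 g x = vderive e1 g x *m dmx (vderive e2 g x)
    + vderive e1 g x *m dmx (vderive e1 g x) *m Jm (g x).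
Proof.
pose D v w : 'rV[R]_m := \row_i 'D_v (fun y => 'D_w (fun y => g y 0 i) y) x.
have Dij v w i : D v w 0 i = 'D_v (fun y => 'D_w (fun y => g y 0 i) y) x by rewrite mxE.
have DE v : D v e2 = vderive e1 g x *m dmx (vderive v g x) + D v e1 *m Jm (g x).
  apply/rowP => j; rewrite !mxE -big_split /=.
  have pj : \forall y \near x, 'D_e2 (fun y => g y 0 j) y =
      \sum_i 'D_e1 (fun y => g y 0 i) y * Jm (g y) i j.
    by apply: filterS pde => y.
  apply: (etrans (near_eq_derive v pj)).
  have dJg i : differentiable (fun y => Jm (g y) i j) x.
    exact: (@differentiable_comp _ _ _ _ g (fun u => Jm u i j) x dg (dJ i j)).
  apply: (etrans ((differentiable_sum_mul _ (fun i => (tg i).2 e1) dJg).2 v)).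
  apply: eq_bigr => i _; rewrite [vderive e1 g x 0 i]mxE [D v e1 0 i]mxE [dmx _ i j]mxE.
  rewrite vderive_diff; congr (_ * _ + _); last by rewrite mulrC.
  exact: (derive_comp v dg (dJ i j)).
have sym : D e2 e1 = D e1 e2.
  apply/rowP => i; rewrite [LHS]mxE [RHS]mxE.
  exact: (derive2_sym e2 e1 (tg i)).
have -> : vlaplacian e1 e2 g x = D e1 e1 + D e2 e2.
  apply/rowP => i; rewrite [LHS]mxE [RHS]mxE.
  exact: (congr2 +%R (esym (Dij e1 e1 i)) (esym (Dij e2 e2 i))).
rewrite DE sym DE mulmxDl -[D e1 e1 *m _ *m _]mulmxA JJ mulmxN mulmx1.
by rewrite addrC addrA subrK.
Qed.

End HoloLaplacian.

Lemma sum_bound (R : realType) (b d y t3 t4 : R) : 0 <= b -> 0 <= d -> y <= b * d ->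
  t3 <= b * y * d -> t4 <= b * (b * d * d) ->
  2 * (t3 + t4) <= (1 + b + 4 * b ^+ 2) * d ^+ 2.
Proof.
move=> b0 d0 hy h3 h4.
have := ler_wpM2r d0 (ler_wpM2l b0 hy).
have := mulr_ge0 b0 (sqr_ge0 d); have := sqr_ge0 d; lra.
Qed.

(** * Estimates uniform over all discs *)

Section UniformEstimates.
Variables (R : realType) (M : topologicalType) (m : nat) (S : manifold R M m).
Variables (J : almost_complex S) (U : set M) (z : M -> 'rV[R]_m) (w : 'rV[R]_m -> M).
Hypotheses (Uopen : open U) (zC : forall k, Ck_on S k U z)
  (wC : smooth_into S (@unit_ball R m) w)
  (Uz : forall x, U x -> unit_ball (z x) /\ w (z x) = x)
  (Bw : forall y, unit_ball y -> U (w y) /\ z (w y) = y).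
Local Notation Jc := (J_coord J z w).
Local Notation e1 := (cplx 1 0 : 'rV[R]_(1 + 1)).
Local Notation e2 := (cplx 0 1 : 'rV[R]_(1 + 1)).

Lemma J_coord_bounds : exists rho K : R, [/\ 0 < rho, 0 <= K &
  forall y, `|y| < rho -> unit_ball y /\ forall i j,
    [/\ differentiable (fun y => Jc y i j) y, `|Jc y i j| <= K &
      forall v, `|'D_v (fun y => Jc y i j) y| <= K * `|v|] ].
Proof.
have T i j := J_coord_tame J Uopen zC wC Bw i j (@unit_ball0 R m).
have [L HL] := choice (fun ij : 'I_m * 'I_m =>
   let: ex_intro2 K a b := T ij.1 ij.2 in ex_intro (fun K : R => 0 <= K /\
     \forall y \near (0 : 'rV[R]_m), [/\ differentiable (fun y => Jc y ij.1 ij.2) y, `|Jc y ij.1 ij.2| <= K &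
      forall v, `|'D_v (fun y => Jc y ij.1 ij.2) y| <= K * `|v|]) K (conj a b)).
have N := filter_forall (nbhs_filter (0 : 'rV[R]_m)) (fun ij => (HL ij).2).
have NB := open_nbhs_nbhs (conj (@open_unit_ball R m) (@unit_ball0 R m)).
have [d d0 H] := near_norm_ball (filterI NB N).
pose K := \sum_ij L ij.
have LK ij : L ij <= K.
  rewrite /K (bigD1 ij) //= lerDl; apply: sumr_ge0 => k _; exact: (HL k).1.
exists d, K; split=> //; first by apply: sumr_ge0 => k _; exact: (HL k).1.
move=> y /H; rewrite addr0 => -[By Hy]; split=> // i j.
have [dy by_ Dy] := Hy (i, j); split=> //; first exact: le_trans by_ (LK _).
by move=> v; apply: le_trans (Dy v) _; rewrite ler_wpM2r.
Qed.

Lemma disc_vtwice f N x : J_disc J N f -> disc x -> U (f x) -> vtwice (z \o f) x.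
Proof.
move=> [[fc fs] _ _] dx Ux; set c := chart_at S (f x).
have ac : atlas S c by exact: chart_at_atlas.
have cx : chart_dom c (f x) by exact: chart_at_dom.
have od : open (@disc R `&` f @^-1` chart_dom c).
  rewrite openE => y [By cy]; rewrite /interior.
  have N1 := open_nbhs_nbhs (conj (@open_unit_ball R _) By).
  have nd : nbhs (f y) (chart_dom c).
    exact: open_nbhs_nbhs (conj (@chart_dom_open _ _ _ c) cy).
  by apply: filterS2 N1 (fc y By _ nd).
have xd : (@disc R `&` f @^-1` chart_dom c) x by [].
have tk : twice (c \o f) x by apply: Ck_twice od xd _; exact: (fs c ac 2%N).
have tz : twice (z \o chart_inv c) (c (f x)).
  have im : (c @` (chart_dom c `&` U)) (c (f x)) by exists (f x).
  by apply: Ck_twice (@chart_image_open _ _ _ c U Uopen) im _; exact: (zC 2 ac).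
have T := vtwice_comp (phi := z \o chart_inv c) (k := c \o f) tz tk.
move=> i; apply: near_eq_twice (T i).
by apply: filterS (near_comp_chart z (fc x dx) cx) => y /= ->.
Qed.

Lemma e1_Jst : e1 *m Jst R 1 = e2.
Proof.
rewrite /cplx /Jst mul_row_block.
congr row_mx; apply/matrixP => i j; rewrite !(mxE, big_ord1) !ord1 /=.
  by rewrite !(mulr0, mul0r, mulr1n, mul0rn, add0r).
by rewrite !(mulr0, mulr1, mulr1n, addr0).
Qed.

Lemma near_disc f N x : J_disc J N f -> disc x -> U (f x) ->
  \forall y \near x, disc y /\ U (f y).
Proof.
move=> [[fc _] _ _] dx Ux.
have N1 := open_nbhs_nbhs (conj (@open_unit_ball R _) dx).
have N2 : \forall y \near x, U (f y) := fc x dx _ (open_nbhs_nbhs (conj Uopen Ux)).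
exact: filterS2 N1 N2.
Qed.

Lemma disc_pde f N x : J_disc J N f -> disc x -> U (f x) ->
  \forall y \near x, forall j,
     'D_e2 (fun y => (z \o f) y 0 j) y =
     \sum_i 'D_e1 (fun y => (z \o f) y 0 i) y * Jc ((z \o f) y) i j.
Proof.
move=> fJ dx Ux; apply: filterS (near_disc fJ dx Ux) => y [dy Uy] j.
have [dg E] := disc_coord Uopen zC wC Uz fJ dy Uy.
have := E e1; rewrite e1_Jst => {}E.
rewrite (derive_entry e2 0 j dg) (deriveE e2 dg) E mxE; apply: eq_bigr => i _.
by rewrite (derive_entry e1 0 i dg) (deriveE e1 dg).
Qed.

Lemma J_coord_lipschitz (rho K : R) : (forall y, `|y| < rho -> forall i j,
    [/\ differentiable (fun y => Jc y i j) y, `|Jc y i j| <= K &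
      forall v, `|'D_v (fun y => Jc y i j) y| <= K * `|v|]) ->
  forall a y i j, `|a| < rho -> `|y| < rho -> `|(Jc y - Jc a) i j| <= K * `|y - a|.
Proof.
move=> H a y i j ar yr.
have cv (s : R) : 0 <= s <= 1 -> `|s *: (y - a) + a| < rho.
  move=> /andP[s0 s1].
  have -> : s *: (y - a) + a = s *: y + (1 - s) *: a.
    by rewrite scalerBr scalerBl scale1r -addrA; congr (_ + _); rewrite addrC.
  apply: le_lt_trans (ler_normD _ _) _; rewrite !normrZ (ger0_norm s0) ger0_norm ?subr_ge0 //.
  have [->|sn] := eqVneq s 0; first by rewrite mul0r add0r subr0 mul1r.
  have sp : 0 < s by rewrite lt0r sn.
  have : s * `|y| < s * rho by rewrite ltr_pM2l.
  have : (1 - s) * `|a| <= (1 - s) * rho by rewrite ler_wpM2l ?subr_ge0 // ltW.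
  move: (`|y|) (`|a|) => u v; lra.
have [s s01 E] := @mean_value_line R _ (fun y => Jc y i j) a (y - a)
  (fun s s01 => let: And3 d _ _ := H _ (cv s s01) i j in d).
rewrite subrK in E.
have -> : (Jc y - Jc a) i j = Jc y i j - Jc a i j by rewrite [LHS]mxE [X in _ + X]mxE.
by rewrite E; have [_ _] := H _ (cv s s01) i j; apply.
Qed.

(** The constants depend on [J] in the coordinates [z] only, not on the disc or on the set
    containing it. The first bound comes from Y - X J(a) = X (J(z f) - J(a)) and the Lipschitz
    bound, the second from [vlaplacian_pde]. *)
Lemma disc_estimates : exists rho Q : R, [/\ 0 < rho, 0 < Q,
  forall y : 'rV[R]_m, `|y| < rho -> unit_ball y,
  forall a v : 'rV[R]_m, `|a| < rho -> herm (Jc a) v v <= Q * dot v v &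
  forall N f x (a : 'rV[R]_m), J_disc J N f -> disc x -> U (f x) -> `|z (f x)| < rho -> `|a| < rho ->
    let X := vderive e1 (z \o f) x in let Y := vderive e2 (z \o f) x in
    let L := vlaplacian e1 e2 (z \o f) x in
    dot (Y - X *m Jc a) (Y - X *m Jc a) <= Q * dot (z (f x) - a) (z (f x) - a) * dot X X /\
    dot L L <= Q * dot X X ^+ 2].
Proof.
have [rho [K [rho0 K0 H]]] := J_coord_bounds.
pose b := m%:R * m%:R * K ^+ 2.
have b0 : 0 <= b by rewrite !mulr_ge0 // exprn_ge0.
have b20 : 0 <= b ^+ 2 by rewrite sqr_ge0.
have JB y (v : 'rV[R]_m) : `|y| < rho -> dot (v *m Jc y) (v *m Jc y) <= b * dot v v.
  by move=> yr; apply: dot_mulmx_le => i j; have [_ /(_ i j)[]] := H y yr.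
(* Here 1 + b serves the invariant norm, b the defect of holomorphy, and 4 b^2 the Laplacian, a sum
   of two terms of squared norm at most b^2 |X|^4 each. *)
exists rho, (1 + b + 4 * b ^+ 2); split=> //.
- by rewrite -addrA ltr_wpDr // addr_ge0 // mulr_ge0.
- by move=> y /H[].
- move=> a v ar; rewrite hermE.
  have := JB a v ar; have := dot_ge0 v; have : 0 <= b ^+ 2 * dot v v by rewrite mulr_ge0 // dot_ge0.
  move: (dot v v) (dot _ _) => d d'; lra.
move=> N f x a fJ dx Ux zr ar X Y L.
have [dg _] := disc_coord Uopen zC wC Uz fJ dx Ux.
have pde := disc_pde fJ dx Ux.
have tg := disc_vtwice fJ dx Ux.
have [Bz _] := Uz Ux.
have dJ i j : differentiable (fun u => Jc u i j) ((z \o f) x).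
  by have [_ /(_ i j)[]] := H _ zr.
have JJ : Jc ((z \o f) x) *m Jc ((z \o f) x) = - 1%:M by exact: J_coord_sqr.
have YX : Y = X *m Jc (z (f x)) by exact: vderive_pde pde.
have LE := vlaplacian_pde tg dg pde dJ JJ.
have dmxB v (u : 'rV[R]_m) : dot (u *m dmx (z \o f) Jc x v) (u *m dmx (z \o f) Jc x v)
    <= b * dot v v * dot u u.
  have := @dot_mulmx_le R m m u (dmx (z \o f) Jc x v) (K * `|v|).
  rewrite exprMn mulrA -/b => HH; apply: le_trans (HH _) _.
    by move=> i j; rewrite mxE; have [_ /(_ i j)[_ _]] := H _ zr; apply.
  by rewrite ler_wpM2r ?dot_ge0 // ler_wpM2l // norm_le_dot.
have dX := dot_ge0 X.
split.
  rewrite YX -mulmxBr.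
  have HH := @dot_mulmx_le R m m X (Jc (z (f x)) - Jc a) (K * `|z (f x) - a|).
  apply: le_trans (HH _) _.
    by move=> i j; apply: (@J_coord_lipschitz rho) => // y yr k l; have [_ /(_ k l)] := H y yr.
  rewrite exprMn mulrA -/b ler_wpM2r //.
  apply: le_trans (ler_wpM2l b0 (norm_le_dot _)) _.
  rewrite ler_wpM2r ?dot_ge0 //; lra.
have hY : dot Y Y <= b * dot X X by rewrite YX JB.
have E : L = X *m dmx (z \o f) Jc x Y + X *m dmx (z \o f) Jc x X *m Jc (z (f x)) by exact: LE.
rewrite E; apply: le_trans (dot_add_le _ _) _.
have h1 := dmxB Y X.
have h2 := le_trans (JB _ (X *m dmx (z \o f) Jc x X) zr) (ler_wpM2l b0 (dmxB X X)).
exact: sum_bound b0 dX hY h1 h2.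
Qed.

End UniformEstimates.

(** * Rescaled discs and sub-mean values *)

Section Reparametrization.
Variables (R : realType) (M : topologicalType) (m : nat) (S : manifold R M m).
Variable J : almost_complex S.
Local Notation C2 := 'rV[R]_(1 + 1).

Lemma diff_affine (V : normedModType R) (a : V) (r : R) (x : V) :
  differentiable (fun x : V => a + r *: x) x /\
  forall h, 'd (fun x : V => a + r *: x) x h = r *: h.
Proof.
have d2 : differentiable ( *:%R r : V -> V) x by exact: ex_diff.
split; first exact: (differentiableD (differentiable_cst a x) d2).
move=> h; rewrite (@diffD _ _ _ (cst a) ( *:%R r)) //=.
by rewrite diff_cst add0r diff_val.
Qed.

Lemma open_disc_dom (f : C2 -> M) (c : chart R M m) : smooth_into S (@disc R) f ->
  open (@disc R `&` f @^-1` chart_dom c).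
Proof.
move=> [fc _]; rewrite openE => y [By cy]; rewrite /interior.
have N1 := open_nbhs_nbhs (conj (@open_unit_ball R _) By).
have nd : nbhs (f y) (chart_dom c).
  exact: open_nbhs_nbhs (conj (@chart_dom_open _ _ _ c) cy).
by apply: filterS2 N1 (fc y By _ nd).
Qed.

Lemma J_disc_affine (N N' : set M) (f : C2 -> M) (a : C2) (r : R) :
  J_disc J N f -> (forall x, disc x -> disc (a + r *: x)) ->
  (forall x, disc x -> N' (f (a + r *: x))) ->
  J_disc J N' (fun x => f (a + r *: x)) /\
  forall x h, disc x ->
    diff_into S (fun x => f (a + r *: x)) x h = r *: diff_into S f (a + r *: x) h.
Proof.
move=> [fs _ fJ] ad aN.
have DI x h : disc x ->
    diff_into S (fun x => f (a + r *: x)) x h = r *: diff_into S f (a + r *: x) h.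
  move=> dx; rewrite /diff_into; set c := chart_at S _.
  have [H _] := fs.2 c (chart_at_atlas S _) 1%N.
  have [da dE] := diff_affine a r x.
  have df : differentiable (c \o f) (a + r *: x).
    by apply: H; split; [exact: ad | exact: chart_at_dom].
  have E : \forall y \near x, (c \o (fun x => f (a + r *: x))) y = ((c \o f) \o (fun x : C2 => a + r *: x)) y.
    by near=> y.
  by apply: (etrans (diff_near_comp h E da df)); rewrite dE; exact: linearZ.
split=> //; split=> //.
- split.
    move=> x dx.
    have c1 := differentiable_continuous (diff_affine a r x).1.
    have c2 := fs.1 _ (ad x dx).
    exact: (@continuous_comp _ _ _ (fun x : C2 => a + r *: x) f x c1 c2).
  move=> c ac k.
  have := Ck_affine 1 r a (@open_disc_dom _ c fs) (fs.2 c ac k).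
  have -> : (fun x : C2 => 1 *: (c \o f) (a + r *: x)) = (c \o (fun x => f (a + r *: x))).
    by apply/funext => x; rewrite scale1r.
  by apply: Ck_subset => x [dx cx]; split => //; exact: ad.
- move=> x h dx; rewrite !DI // fJ; last exact: ad.
  by rewrite scalemxAl.
Unshelve. all: by end_near. Qed.

Lemma enorm_dot k (x : 'rV[R]_k) : enorm x ^+ 2 = dot x x.
Proof. by rewrite sqr_sqrtr; [apply: eq_bigr => i _ | apply: sumr_ge0 => i _; exact: sqr_ge0]. Qed.

Lemma enorm_ge0 k (x : 'rV[R]_k) : 0 <= enorm x.
Proof. exact: sqrtr_ge0. Qed.

Lemma enormZ k (r : R) (x : 'rV[R]_k) : 0 <= r -> enorm (r *: x) = r * enorm x.
Proof.
move=> r0; apply/eqP; rewrite -(@eqrXn2 _ 2) ?mulr_ge0 ?enorm_ge0 //.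
by rewrite exprMn !enorm_dot dotZl dotC dotZl expr2 mulrA.
Qed.

Lemma enorm_le_dot k (x : 'rV[R]_k) (r : R) : 0 <= r -> (enorm x <= r) = (dot x x <= r ^+ 2).
Proof. by move=> r0; rewrite -enorm_dot ler_sqr ?nnegrE ?enorm_ge0. Qed.

Lemma near_enorm (a : C2) (P : set C2) : (\forall y \near a, P y) ->
  exists2 d : R, 0 < d & forall h, enorm h < d -> P (a + h).
Proof.
move=> /near_norm_ball[d d0 H]; exists d => // h hd; rewrite addrC; apply: H.
apply: le_lt_trans hd; rewrite -ler_sqr ?nnegrE ?enorm_ge0 // enorm_dot.
exact: norm_le_dot.
Qed.

(** Plurisubharmonicity on [A] tests only discs contained in [A], whereas [f] may leave [A]. The
    disc is rescaled about [x] so as to stay in [A]; circles about 0 in the rescaled disc are small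
    circles about [x] in the original one. *)
Lemma J_psh_submean (N A : set M) (v : M -> R) (f : C2 -> M) (x : C2) :
  J_disc J N f -> open A -> J_psh J A (fun y => (v y)%:E) -> disc x -> A (f x) ->
  \forall r \near 0^'+, ((v (f x))%:E <= ((2 * pi)^-1)%:E *
    \int[lebesgue_measure]_(t in `[0%R, (2 * pi)%R])
      (v (f (x + r *: (cos t *: cplx 1 0 + sin t *: cplx 0 1))))%:E)%E.
Proof.
move=> fJ oA [_ vA] dx Ax; have [fs _ _] := fJ.
have NA : \forall y \near x, A (f y) := fs.1 x dx _ (open_nbhs_nbhs (conj oA Ax)).
have Nd := open_nbhs_nbhs (conj (@open_unit_ball R _) dx).
have [d d0 H] := near_enorm (filterI Nd NA).
have Hd y : disc y -> disc (x + d *: y) /\ A (f (x + d *: y)).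
  move=> dy; apply: H; rewrite enormZ ?(ltW d0) // -[ltRHS]mulr1 ltr_pM2l //.
have [gJ _] := J_disc_affine fJ (fun y dy => (Hd y dy).1) (fun y dy => (Hd y dy).2).
have [_ sm] := vA _ gJ.
near=> r.
have r0 : 0 < r by near: r; exact: nbhs_right_gt.
have rd : r < d by near: r; exact: nbhs_right_lt.
have := sm 0 (r / d) (divr_gt0 r0 d0).
have sub : [set y : C2 | enorm (y - 0) <= r / d] `<=` @disc R.
  move=> y /=; rewrite subr0 => /le_lt_trans; apply.
  by rewrite ltr_pdivrMr // mul1r.
move=> /(_ sub); rewrite /= scaler0 addr0.
have -> : (\int[lebesgue_measure]_(t in `[0%R, (2 * pi)%R])
   (v (f (x + d *: (0 + (r / d) *: cplx (cos t) (sin t)))))%:E =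
  \int[lebesgue_measure]_(t in `[0%R, (2 * pi)%R])
      (v (f (x + r *: (cos t *: cplx 1 0 + sin t *: cplx 0 1))))%:E)%E.
  apply: eq_integral => t _; rewrite add0r scalerA mulrC divfK ?gt_eqF //.
  by rewrite [cplx (cos t) _]cplxE.
by [].
Unshelve. all: by end_near. Qed.

Lemma Ck_on_continuous (W : normedModType R) (g : M -> W) k (O : set M) x :
  Ck_on S k.+1 O g -> O x -> {for x, continuous g}.
Proof.
move=> gC Ox; have cx := chart_at_dom S x.
have [dg _] := gC _ (chart_at_atlas S x).
have im : (chart_at S x @` (chart_dom (chart_at S x) `&` O)) (chart_at S x x) by exists x.
have c1 : {for x, continuous ((g \o chart_inv (chart_at S x)) \o chart_at S x)}.
  apply: continuous_comp; first exact: chart_fun_cont.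
  exact: differentiable_continuous (dg _ im).
have E : \forall y \near x, ((g \o chart_inv (chart_at S x)) \o chart_at S x) y = g y.
  by apply: filterS (near_chart_invK cx) => y /= ->.
have : ((g \o chart_inv (chart_at S x)) \o chart_at S x) y @[y --> x] --> g x.
  by rewrite -(nbhs_singleton E); exact: c1.
by move=> H; apply: cvg_trans H; apply: near_eq_cvg; apply: filterS E => y ->.
Qed.

Lemma Ck_on_subset_continuous (W : normedModType R) (g : M -> W) k (D : set M) x :
  Ck_on_subset S k.+1 (closure D) g -> open D -> D x -> {for x, continuous g}.
Proof.
move=> gC oD Dx; have [B [h [oO Ox hC gh]]] := gC x (subset_closure Dx).
have c' := Ck_on_continuous hC Ox.
have E : \forall y \near x, h y = g y.
  apply: filterS2 (open_nbhs_nbhs (conj oO Ox)) (open_nbhs_nbhs (conj oD Dx)) => y Oy Dy.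
  by rewrite gh //; exact: subset_closure.
have : h y @[y --> x] --> g x by rewrite -(nbhs_singleton E); exact: c'.
by move=> H; apply: cvg_trans H; apply: near_eq_cvg; apply: filterS E => y ->.
Qed.

End Reparametrization.

(** * The radial weight on the unit disc *)

Section Plane.
Variable R : realType.
Local Notation C2 := 'rV[R]_(1 + 1).
Local Notation e1 := (cplx 1 0 : C2).
Local Notation e2 := (cplx 0 1 : C2).

Lemma dot_cplx (a b a' b' : R) : dot (cplx a b) (cplx a' b') = a * a' + b * b'.
Proof.
rewrite /dot big_split_ord !big_ord1 /cplx !row_mxEl !row_mxEr !mxE.
by rewrite !eqxx !mulr1n.
Qed.

Lemma cplx_split (x : C2) : x = cplx (x 0 (lshift 1 0)) (x 0 (rshift 1 0)).
Proof.
rewrite /cplx -[LHS]hsubmxK; congr row_mx; apply/matrixP => i j;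
  by rewrite !mxE !ord1 eqxx mulr1n.
Qed.

(** The logarithm of |x| is harmonic in the plane off 0, so the whole Laplacian is that of |x|^2. *)
Lemma log_radius_laplacian (x : C2) : x != 0 ->
  twice (fun y : C2 => dot y y - 2^-1 * ln (dot y y)) x /\
  laplacian e1 e2 (fun y : C2 => dot y y - 2^-1 * ln (dot y y)) x = 4.
Proof.
move=> x0.
have n0 : 0 < dot x x.
  by rewrite lt0r dot_ge0 andbT; apply: contra_neq x0; exact: dot_eq0.
have tid : vtwice (@idfun C2) x by move=> i; exact: twice_entry (twice_id x).
have [tn Dn Ln] := twice_dot e1 e2 tid.
have did (y : C2) : differentiable (@idfun C2) y by exact: ex_diff.
have dc i (v : C2) : (fun y : C2 => 'D_v (fun y : C2 => y 0 i) y) = cst (v 0 i).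
  apply/funext => y; rewrite (derive_entry v 0 i (did y)).
  by rewrite (derive_id y v).
have vD v : vderive v (@idfun C2) x = v.
  by apply/rowP => i; rewrite mxE; exact: (congr1 (@^~ x) (dc i v)).
have vL : vlaplacian e1 e2 (@idfun C2) x = 0.
  apply/rowP => i; rewrite mxE [RHS]mxE /laplacian (dc i e1) (dc i e2).
  by rewrite !derive_cst addr0.
rewrite !vD vL in Ln.
pose psi (t : R) := t - 2^-1 * ln t.
pose psi' (t : R) := 1 - 2^-1 * t^-1.
set N := dot x x in n0.
have D1 (t : R) : 0 < t -> is_derive t (1 : R) psi (psi' t).
  move=> t0; have Dl := is_derive1_ln t0.
  by apply: is_derive_eq.
have D1' : \forall t \near N, is_derive (t : R) (1 : R) psi (psi' t).
  by have := lt_nbhsr n0; apply: filterS => t; exact: D1.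
have D2 : is_derive N (1 : R) psi' (2^-1 * N ^- 2).
  have D3 : is_derive N (1 : R) (fun y : R => y^-1) (- N ^- 2 *: 1).
    by apply: is_deriveV; rewrite gt_eqF.
  by apply: is_derive_eq; rewrite /GRing.scale /=; ring.
split; first exact: (twice_comp1 tn D1' D2).
apply: (etrans (laplacian_comp e1 e2 tn D1' D2)).
rewrite (Dn e1) (Dn e2) !vD Ln /psi' -/N.
have d11 : dot e1 e1 = 1 by rewrite dot_cplx; ring.
have d22 : dot e2 e2 = 1 by rewrite dot_cplx; ring.
have -> : dot x 0 = 0 by rewrite /dot big1 // => i _; rewrite mxE mulr0.
have NE : N = dot x e1 ^+ 2 + dot x e2 ^+ 2.
  by rewrite /N [x]cplx_split !dot_cplx; ring.
rewrite d11 d22 !exprMn -mulrDr -NE.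
by field; rewrite gt_eqF.
Qed.

End Plane.

Lemma dot_le_norm (R : realType) m (v : 'rV[R]_m) : dot v v <= m%:R * `|v| ^+ 2.
Proof.
rewrite /dot mulr_natl -[X in _ *+ X](card_ord m) -sumr_const; apply: ler_sum => i _.
rewrite -expr2 -[leLHS]real_normK ?num_real // ler_sqr ?nnegrE //.
exact: coord_le_norm.
Qed.

Lemma closed_norm_le_compact (R : realType) n (A : set 'rV[R]_n) (B : R) :
  closed A -> (forall y, A y -> `|y| <= B) -> compact A.
Proof.
move=> cA AB; apply: bounded_closed_compact cA; exists B; split; first exact: num_real.
by move=> x Bx y /AB /le_trans; apply; exact: ltW.
Qed.

Lemma herm_continuous (R : realType) (m : nat) (T : 'M[R]_m) (a : 'rV[R]_m) :
  continuous (fun y : 'rV[R]_m => herm T (y - a) (y - a)).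
Proof.
move=> y; apply/differentiable_continuous/twice_diff.
have tid : vtwice (@idfun 'rV[R]_m) y by move=> i; exact: twice_entry (twice_id y).
have [tG _ _] := vtwice_affine 0 0 (graph_mx T) a tid.
by have [] := twice_dot 0 0 (tG : vtwice (fun y => (idfun y - a) *m graph_mx T) y).
Qed.

(** * Localization *)

Section PoleSet.
Variables (R : realType) (M : topologicalType) (m : nat) (S : manifold R M m).
Variables (U : set M) (z : M -> 'rV[R]_m) (w : 'rV[R]_m -> M).
Hypotheses (Uopen : open U) (zC : forall k, Ck_on S k U z)
  (wC : smooth_into S (@unit_ball R m) w)
  (Uz : forall x, U x -> unit_ball (z x) /\ w (z x) = x)
  (Bw : forall y, unit_ball y -> U (w y) /\ z (w y) = y).

Lemma image_ball_compact (A : set 'rV[R]_m) (B : R) :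
  closed A -> (forall y, A y -> `|y| <= B) -> A `<=` @unit_ball R m -> compact (w @` A).
Proof.
move=> cA AB Ab; apply: continuous_compact; last exact: closed_norm_le_compact cA AB.
by apply: continuous_in_subspaceT => y; rewrite inE => /Ab; exact: wC.1.
Qed.

Variables (T : 'M[R]_m) (a : 'rV[R]_m) (r0 r1 : R).
Hypotheses (r0_gt0 : 0 < r0) (ar1 : `|a| < r1 / 2) (r01 : r0 <= r1 / 2)
  (r1_ball : forall y : 'rV[R]_m, `|y| < r1 -> unit_ball y).
Local Notation N := (fun y : 'rV[R]_m => herm T (y - a) (y - a)).

(** Defined as an image under [w] because [z] is meaningful on [U] only. Being a continuous image of
    a compact set, it is closed in all of [M]. *)
Definition pole_set : set M := w @` [set y | N y <= r0 ^+ 2].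

(** The quantity t of the overview. The value 1 off [pole_set] gives it a meaning along discs that
    leave [U]. *)
Definition pole_ratio (x : M) : R :=
  if `[< pole_set x >] then N (z x) / r0 ^+ 2 else 1.

Lemma herm_le_norm y : N y <= r0 ^+ 2 -> `|y| < r1.
Proof.
move=> Ny; have : `|y - a| <= r0.
  rewrite -ler_sqr ?nnegrE ?(ltW r0_gt0) //.
  exact: le_trans (norm_le_dot _) (le_trans (dot_le_herm _ _) Ny).
have := ler_normD (y - a) a; rewrite subrK; move: ar1 r01; lra.
Qed.

Lemma pole_setP x : pole_set x <-> U x /\ N (z x) <= r0 ^+ 2.
Proof.
split=> [[y Ny <-]|[Ux Nz]].
  by have [Uw zw] := Bw (r1_ball (herm_le_norm Ny)); rewrite zw.
by exists (z x) => //; have [] := Uz Ux.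
Qed.

Lemma pole_set_closed : closed pole_set.
Proof.
apply: compact_closed; first exact: manifold_hausdorff S.
apply: (@image_ball_compact _ r1).
- have -> : [set y | N y <= r0 ^+ 2] = N @^-1` [set u | u <= r0 ^+ 2] by [].
  apply: preimage_closed; last exact: closed_le.
  by move=> y _; exact: herm_continuous.
- by move=> y /herm_le_norm /ltW.
- by move=> y /herm_le_norm /r1_ball.
Qed.

Lemma pole_ratio_bounds x : 0 <= pole_ratio x <= 1.
Proof.
rewrite /pole_ratio; case: asboolP => [/pole_setP[Ux Nz]|_]; last by rewrite ler01 lexx.
by rewrite divr_ge0 ?dot_ge0 ?exprn_ge0 ?(ltW r0_gt0) //= ler_pdivrMr ?exprn_gt0 // mul1r.
Qed.

Lemma pole_ratioE x : U x -> pole_ratio x = Num.min (N (z x) / r0 ^+ 2) 1.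
Proof.
move=> Ux; rewrite /pole_ratio; case: asboolP => [/pole_setP[_ Nz]|nK].
  by rewrite min_l // ler_pdivrMr ?exprn_gt0 // mul1r.
rewrite min_r // ler_pdivlMr ?exprn_gt0 // mul1r ltW // ltNge.
by apply/negP => Nz; apply: nK; apply/pole_setP.
Qed.

(** Two open sets cover [M]: on [U] the ratio is a minimum of two continuous functions, and on the
    complement of the closed set [pole_set] it is constant. *)
Lemma pole_ratio_continuous x : {for x, continuous pole_ratio}.
Proof.
have [Kx|nK] := pselect (pole_set x).
  have /pole_setP[Ux _] := Kx.
  have E : \forall y \near x, Num.min (N (z y) / r0 ^+ 2) 1 = pole_ratio y.
    by apply: filterS (open_nbhs_nbhs (conj Uopen Ux)) => y Uy; rewrite pole_ratioE.
  have cm : {for x, continuous (fun y => Num.min (N (z y) / r0 ^+ 2) 1)}.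
    apply: (@continuous_min _ _ (fun y => N (z y) / r0 ^+ 2) (fun=> 1)); last exact: cvg_cst.
    apply: continuousM; last exact: cvg_cst.
    apply: (@continuous_comp _ _ _ z N); first exact: z_continuous zC _ Ux.
    exact: herm_continuous.
  have : Num.min (N (z y) / r0 ^+ 2) 1 @[y --> x] --> pole_ratio x.
    by rewrite -(nbhs_singleton E); exact: cm.
  by move=> H; apply: cvg_trans H; apply: near_eq_cvg; apply: filterS E => y ->.
have oK : open (~` pole_set) by rewrite openC; exact: pole_set_closed.
have E : \forall y \near x, 1 = pole_ratio y.
  apply: filterS (open_nbhs_nbhs (conj oK nK)) => y nKy.
  by rewrite /pole_ratio; case: asboolP.
have : (fun=> 1 : R) y @[y --> x] --> pole_ratio x.
  by rewrite -(nbhs_singleton E); exact: cvg_cst.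
by move=> H; apply: cvg_trans H; apply: near_eq_cvg; apply: filterS E => y ->.
Qed.

End PoleSet.

(** * The maximum principle along one disc *)

Section Localization.
Variables (R : realType) (M : topologicalType) (m : nat) (S : manifold R M m).
Variables (J : almost_complex S) (U : set M) (z : M -> 'rV[R]_m) (w : 'rV[R]_m -> M).
Hypotheses (Uopen : open U) (zC : forall k, Ck_on S k U z)
  (wC : smooth_into S (@unit_ball R m) w)
  (Uz : forall x, U x -> unit_ball (z x) /\ w (z x) = x)
  (Bw : forall y, unit_ball y -> U (w y) /\ z (w y) = y).
Local Notation Jc := (J_coord J z w).
Local Notation C2 := 'rV[R]_(1 + 1).
Local Notation e1 := (cplx 1 0 : C2).
Local Notation e2 := (cplx 0 1 : C2).

Variables (rho Q r0 r1 c : R).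
Hypotheses (Q_gt0 : 0 < Q) (c_gt0 : 0 < c)
  (rho_ball : forall y : 'rV[R]_m, `|y| < rho -> unit_ball y)
  (herm_le : forall a v : 'rV[R]_m, `|a| < rho -> herm (Jc a) v v <= Q * dot v v)
  (disc_le : forall N f x (a : 'rV[R]_m), J_disc J N f -> disc x -> U (f x) ->
    `|z (f x)| < rho -> `|a| < rho ->
    let X := vderive e1 (z \o f) x in let Y := vderive e2 (z \o f) x in
    let L := vlaplacian e1 e2 (z \o f) x in
    dot (Y - X *m Jc a) (Y - X *m Jc a) <= Q * dot (z (f x) - a) (z (f x) - a) * dot X X /\
    dot L L <= Q * dot X X ^+ 2).
Hypotheses (r0_gt0 : 0 < r0) (r01 : r0 <= r1 / 2) (r1_rho : r1 <= rho)
  (r1_small : forall y : 'rV[R]_m, `|y| < r1 -> 4 * Q * dot y y <= 1)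
  (r0_small : 20 * Q * r0 <= 1).

Variables (D : set M) (u : M -> R) (L : R).
Hypotheses (Dopen : open D) (u_cont : forall x, D x -> {for x, continuous u})
  (u_lt0 : forall x, D x -> u x < 0)
  (u_psh : J_psh J D (fun x => (u x)%:E))
  (u_ge : forall x, D x -> U x -> - L <= u x)
  (u_spsh : J_psh J (D `&` U) (fun x => (u x - c * enorm (z x) ^+ 2)%:E)).

Variables (f : C2 -> M).
Hypotheses (fJ : J_disc J D f) (Uf0 : U (f 0)) (zf0 : `|z (f 0)| < r1 / 2).
Local Notation a := (z (f 0)).
Local Notation T := (Jc a).
Local Notation t_ := (pole_ratio z w T a r0).
Local Notation K := (pole_set w T a r0).
(** Chosen so that C c is the coefficient 10 Q / r0^2 of the squared norm in [log_pole]: adding C (u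
    - c |z|^2) then trades that term for C u. *)
Let C := 10 * Q / (c * r0 ^+ 2).

Let C_gt0 : 0 < C.
Proof. by rewrite divr_gt0 ?mulr_gt0 ?exprn_gt0. Qed.

Let r1_ball (y : 'rV[R]_m) : `|y| < r1 -> unit_ball y.
Proof. by move=> yr; apply: rho_ball; exact: lt_le_trans r1_rho. Qed.

Let r1_gt0 : 0 < r1.
Proof. by move: r0_gt0 r01; lra. Qed.

Let a_rho : `|a| < rho.
Proof. by apply: lt_le_trans r1_rho; move: zf0 r1_gt0; lra. Qed.

(* The logarithm is [log_pole] with [N = r0 ^+ 2 * t], except that [C * u] replaces
   the multiple of the squared norm; [dot x x] makes the Laplacian positive, and the
   last term divides by [|x|]. *)
Definition energy (x : C2) : R :=
  t_ (f x) * expR (1 - 2 * t_ (f x) + 2 * Num.sqrt (t_ (f x)) + C * u (f x)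
    + (dot x x - 2^-1 * ln (dot x x))).

Let t_bounds x : 0 <= t_ x <= 1.
Proof. exact: (pole_ratio_bounds Uz Bw T r0_gt0 zf0 r01 r1_ball). Qed.

Lemma ln_energy x : 0 < t_ (f x) -> ln (energy x) =
  ln (t_ (f x)) + (1 - 2 * t_ (f x) + 2 * Num.sqrt (t_ (f x)) + C * u (f x)
    + (dot x x - 2^-1 * ln (dot x x))).
Proof. by move=> t0; rewrite lnM ?posrE ?expR_gt0 // expRK. Qed.

Let near_f (A : set M) x : disc x -> open A -> A (f x) -> \forall y \near x, A (f y).
Proof.
by have [fs _ _] := fJ; move=> dx oA Ax; exact: (fs.1 x dx _ (open_nbhs_nbhs (conj oA Ax))).
Qed.

Let f_dom x : disc x -> D (f x).
Proof. by have [_ + _] := fJ; apply. Qed.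

Lemma near_disc0 x : disc x -> x != 0 -> \forall y \near x, [/\ disc y, 0 < dot y y & D (f y)].
Proof.
move=> dx x0.
have Nd : \forall y \near x, disc y := open_nbhs_nbhs (conj (@open_unit_ball R _) dx).
have n0 : 0 < dot x x by rewrite lt0r dot_ge0 andbT; apply: contra_neq x0; exact: dot_eq0.
have Nn : \forall y \near x, 0 < dot y y.
  exact: (@dot_continuous R _ x _ (lt_nbhsr n0)).
near=> y; have dy : disc y by near: y.
by split => //; [near: y | exact: f_dom].
Unshelve. all: by end_near. Qed.

Let cont_uf x : disc x -> {for x, continuous (u \o f)}.
Proof.
move=> dx; have [fs _ _] := fJ.
by apply: continuous_comp; [exact: fs.1 | apply: u_cont; exact: f_dom].
Qed.

Let e_le1 : `|e1| <= 1 /\ `|e2| <= 1.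
Proof.
by split; rewrite (le_trans (norm_cplx_le _ _)) // normr1 normr0 ?addr0 ?add0r.
Qed.

(** Near [x] the ratio is constantly 1, so the logarithm of [energy] is a constant plus C (u \o f)
    plus a function of Laplacian 4. *)
Lemma no_local_max_outside x : disc x -> x != 0 -> ~ K (f x) ->
  ~ (\forall y \near x, energy y <= energy x).
Proof.
move=> dx x0 nK H.
have oK : open (~` K).
  rewrite openC; exact: (@pole_set_closed _ _ _ _ _ wC T _ _ _ r0_gt0 zf0 r01 r1_ball).
have NK := near_f dx oK nK.
have tn y : ~ K (f y) -> t_ (f y) = 1.
  by move=> nKy; rewrite /pole_ratio; case: asboolP.
(* Dividing by [C] leaves [u \o f] with coefficient 1, as [submean_local_max] requires. *)
pose k (y : C2) := C^-1 * (dot y y - 2^-1 * ln (dot y y)).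
have [tl Ll] := log_radius_laplacian x0.
have [tk Lk] := laplacianZ e1 e2 C^-1 tl.
have {}Lk : 0 < laplacian e1 e2 k x by rewrite Lk Ll mulr_gt0 // invr_gt0.
apply: (submean_local_max e_le1.1 e_le1.2 tk Lk (h := u \o f)).
- by apply: filterS (near_disc0 dx x0) => y [dy _ _]; exact: cont_uf.
- exact: (J_psh_submean fJ Dopen u_psh dx (f_dom dx)).
apply: filterS3 H NK (near_disc0 dx x0) => y Ey nKy [dy ny _].
have Ly : ln (energy y) <= ln (energy x).
  by rewrite ler_ln // posrE /energy tn // mul1r expR_gt0.
move: Ly; rewrite !ln_energy ?tn // => Ly.
have CE y' : C * (k y' + (u \o f) y') = C * u (f y') + (dot y' y' - 2^-1 * ln (dot y' y')).
  by rewrite /k mulrDr mulrA mulfV ?gt_eqF // mul1r addrC.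
rewrite -(ler_pM2l C_gt0) (CE y) (CE x); move: Ly.
by rewrite -!addrA !lerD2l.
Qed.

Local Notation N y := (herm T (z (f y) - a) (z (f y) - a)).

(** The multiples of |z|^2 cancel. The constant ln (r0^2) comes from writing N as r0^2 times the
    ratio, and the -1 offsets the 1 in the exponent of [energy]. *)
Lemma log_pole_energy y : 0 < N y ->
  C * (C^-1 * (log_pole (z \o f) T a Q r0 y + (dot y y - 2^-1 * ln (dot y y)))
       + (u (f y) - c * enorm (z (f y)) ^+ 2)) =
  (ln (N y / r0 ^+ 2) + (1 - 2 * (N y / r0 ^+ 2) + 2 * Num.sqrt (N y / r0 ^+ 2)))
  + (C * u (f y) + (dot y y - 2^-1 * ln (dot y y))) + (ln (r0 ^+ 2) - 1).
Proof.
move=> N0; rewrite mulrDr mulVKf ?gt_eqF // enorm_dot /log_pole /=.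
have lnN : ln (N y) = ln (N y / r0 ^+ 2) + ln (r0 ^+ 2).
  by rewrite -lnM ?posrE ?divr_gt0 ?exprn_gt0 // divfK // gt_eqF // exprn_gt0.
have sN : Num.sqrt (N y / r0 ^+ 2) = Num.sqrt (N y) / r0.
  by rewrite sqrtrM ?(ltW N0) // sqrtrV ?exprn_ge0 ?(ltW r0_gt0) // sqrtr_sqr ger0_norm ?(ltW r0_gt0).
have Cc : C * c = 10 * Q / r0 ^+ 2 by rewrite /C; field; rewrite !gt_eqF.
have -> : C * (u (f y) - c * dot (z (f y)) (z (f y))) =
    C * u (f y) - 10 * Q / r0 ^+ 2 * dot (z (f y)) (z (f y)).
  by rewrite mulrBr [C * (c * _)]mulrA Cc.
rewrite lnN sN; move: (ln (N y / _)) (ln (r0 ^+ 2)) (ln (dot y y)) => l1 l2 l3.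
move: (N y) (Num.sqrt _) (dot _ _) (dot y y) (C * u (f y)) => t1 t2 t3 t4 t5.
by ring.
Qed.

(** Past its maximum at 1 the untruncated profile stays below its value there. This is what allows
    the truncation at the edge of [pole_set]. *)
Lemma pole_profile_le (s : R) : 1 <= s ->
  ln s + (1 - 2 * s + 2 * Num.sqrt s) <= 1.
Proof.
move=> s1; have s0 : 0 < s by lra.
have h1 : ln s <= s - 1.
  have := @le_ln1Dx R (s - 1); have -> : 1 + (s - 1) = s by ring.
  by apply; lra.
have h2 : 2 * Num.sqrt s <= s + 1.
  have := sqr_ge0 (Num.sqrt s - 1).
  have := sqr_sqrtr (ltW s0); move: (Num.sqrt s) => q <-; lra.
lra.
Qed.

(** The truncation may destroy smoothness where N = r0^2. Up to an additive constant, the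
    untruncated function built from [log_pole] lies below the logarithm of [energy] near [x] and
    equals it at [x], so it would inherit the local maximum; [submean_local_max] forbids this. *)
Lemma no_local_max_inside x : disc x -> x != 0 -> K (f x) -> 0 < t_ (f x) ->
  ~ (\forall y \near x, energy y <= energy x).
Proof.
move=> dx x0 Kx tx H.
have [Ux Nx] := (pole_setP Uz Bw T r0_gt0 zf0 r01 r1_ball (f x)).1 Kx.
have zr1 := herm_le_norm r0_gt0 zf0 r01 Nx.
have zr := lt_le_trans zr1 r1_rho.
have tE y : U (f y) -> t_ (f y) = Num.min (N y / r0 ^+ 2) 1.
  exact: (pole_ratioE Uz Bw T r0_gt0 zf0 r01 r1_ball).
have r02 : 0 < r0 ^+ 2 by rewrite exprn_gt0.
have N0 : 0 < N x.
  by move: tx; rewrite tE // lt_min => /andP[+ _]; rewrite pmulr_lgt0 ?invr_gt0.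
have [E1 E2] := disc_le fJ dx Ux zr a_rho.
have Bx := Bw (rho_ball a_rho).
have TT : T *m T = - 1%:M by exact: (J_coord_sqr J zC wC Bw (rho_ball a_rho)).
have tg := disc_vtwice Uopen zC fJ dx Ux.
have [tp Lp] := log_pole_laplacian tg TT Q_gt0 r0_gt0 (fun v => herm_le v a_rho)
  E1 E2 (r1_small zr1) (introT andP (conj N0 Nx)) r0_small.
have [tl Ll] := log_radius_laplacian x0.
have [tk Lk] := laplacianZ e1 e2 C^-1 (twiceD tp tl).
have {}Lk : 0 < laplacian e1 e2 (fun y => C^-1 * (log_pole (z \o f) T a Q r0 y + (dot y y - 2^-1 * ln (dot y y)))) x.
  rewrite (etrans Lk (congr1 ( *%R C^-1) (laplacianD e1 e2 tp tl))).
  apply: mulr_gt0; first by rewrite invr_gt0.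
  by apply: ltr_wpDl Lp _; rewrite Ll.
have DUopen : open (D `&` U) by exact: openI.
have NDU := near_f dx DUopen (conj (f_dom dx) Ux).
have [fs _ _] := fJ.
have zf_cont y : disc y -> U (f y) -> {for y, continuous (z \o f)}.
  by move=> dy Uy; apply: continuous_comp; [exact: fs.1 | exact: z_continuous zC _ Uy].
apply: (submean_local_max e_le1.1 e_le1.2 tk Lk (h := fun y => u (f y) - c * enorm (z (f y)) ^+ 2)).
- apply: filterS2 (near_disc0 dx x0) NDU => y [dy _ _] [_ Uy].
  apply: continuousB; first exact: cont_uf.
  apply: (@continuousM _ _ (fun=> c) (fun y => enorm (z (f y)) ^+ 2)).
    exact: cst_continuous.
  have -> : (fun y => enorm (z (f y)) ^+ 2) = (fun v => dot v v) \o (z \o f).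
    by apply/funext => y'; rewrite /= enorm_dot.
  apply: continuous_comp; first exact: zf_cont.
  exact: dot_continuous.
- exact: (J_psh_submean (v := fun y => u y - c * enorm (z y) ^+ 2) fJ DUopen u_spsh dx (conj (f_dom dx) Ux)).
have NN : \forall y \near x, 0 < N y.
  have c1 : {for x, continuous ((fun v => herm T (v - a) (v - a)) \o (z \o f))}.
    by apply: continuous_comp; [exact: zf_cont | exact: herm_continuous].
  exact: (c1 _ (lt_nbhsr N0)).
apply: filterS3 (filterI H NDU) NN (near_disc0 dx x0) => y [Ey [_ Uy]] Ny [dy ny _].
have ty : 0 < t_ (f y) by rewrite tE // lt_min ltr01 andbT divr_gt0.
have Ly : ln (energy y) <= ln (energy x).
  by rewrite ler_ln // posrE mulr_gt0 // expR_gt0.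
rewrite -(ler_pM2l C_gt0) (log_pole_energy Ny) (log_pole_energy N0) lerD2r.
have PP : ln (N y / r0 ^+ 2) + (1 - 2 * (N y / r0 ^+ 2) + 2 * Num.sqrt (N y / r0 ^+ 2)) <=
    ln (t_ (f y)) + (1 - 2 * t_ (f y) + 2 * Num.sqrt (t_ (f y))).
  rewrite tE //; have [//|s1] := leP (N y / r0 ^+ 2) 1.
  rewrite [leRHS](_ : _ = 1); last by rewrite ln1 sqrtr1; ring.
  exact: pole_profile_le (ltW s1).
have tx1 : t_ (f x) = N x / r0 ^+ 2.
  by rewrite tE // min_l // ler_pdivrMr // mul1r.
move: Ly; rewrite (ln_energy ty) (ln_energy tx) tx1 => Ly.
apply: le_trans (lerD PP (lexx _)) _.
by move: Ly; rewrite -!addrA.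
Qed.

Lemma expR_half_ln (s : R) : 0 < s -> expR (2^-1 * ln s) ^+ 2 = s.
Proof.
move=> s0; rewrite expr2 -expRD -mulrDl.
have -> : 2^-1 + 2^-1 = 1 :> R by field.
by rewrite mul1r lnK.
Qed.

(** The bound is attained at sqrt s = 1/2. *)
Lemma profile_exponent_le (s : R) : 0 <= s -> 1 - 2 * s + 2 * Num.sqrt s <= 3 / 2.
Proof.
move=> s0; have := sqr_ge0 (Num.sqrt s - 1 / 2).
have := sqr_sqrtr s0; move: (Num.sqrt s) => q <-; lra.
Qed.

Lemma energy_le_exp x : disc x ->
  energy x <= t_ (f x) * expR (3 / 2 + (dot x x - 2^-1 * ln (dot x x))).
Proof.
move=> dx; have /andP[t0 t1] := t_bounds (f x).
rewrite /energy ler_wpM2l // ler_expR lerD2r.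
have := profile_exponent_le t0.
have : C * u (f x) <= 0 by rewrite mulr_ge0_le0 ?(ltW C_gt0) // ltW // u_lt0 //; exact: f_dom.
move: (1 - _ + _) (C * _) => s1 s2; lra.
Qed.

(** The exponent is at most 3/2 + 1/4 + (ln 4) / 2, and ln 4 <= 3. *)
Lemma energy_boundary x : disc x -> dot x x = 1 / 4 -> energy x <= expR 4.
Proof.
move=> dx n4; apply: le_trans (energy_le_exp dx) _.
have /andP[t0 t1] := t_bounds (f x).
apply: le_trans (ler_wpM2r (expR_ge0 _) t1) _; rewrite mul1r ler_expR n4.
have l4 : ln 4 <= 3 :> R.
  have := @le_ln1Dx R 3; have -> : 1 + 3 = 4 :> R by ring.
  by apply; lra.
have -> : ln (1 / 4) = - ln 4 :> R by rewrite div1r lnV ?posrE.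
by move: l4; move: (ln 4) => l; lra.
Qed.

Let f0E : t_ (f 0) = 0.
Proof.
rewrite (pole_ratioE Uz Bw T r0_gt0 zf0 r01 r1_ball Uf0) subrr.
have -> : herm T 0 0 = 0 by rewrite /herm mul0mx /dot big1 // => i _; rewrite mxE mul0r.
by rewrite mul0r min_l // ler01.
Qed.

Let disc0 : disc (0 : C2).
Proof. exact: unit_ball0. Qed.

(** Differentiability of [z \o f] at 0 bounds the ratio by a multiple of |x|^2, and [energy] divides
    it by |x| only. The multiple, hence [d], depends on the disc, but the bound does not. *)
Lemma energy_near0 : exists2 d : R, 0 < d &
  forall x : C2, 0 < dot x x < d -> energy x <= expR 4.
Proof.
have [dg _] := disc_coord Uopen zC wC Uz fJ disc0 Uf0.
have [k k0 kL] := linear_lipschitz (diff_continuous dg).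
have [d1 d10 H1] := near_norm_ball (differentiable_eps dg ltr01).
have NU := near_f disc0 Uopen Uf0.
have [d2 d20 H2] := near_norm_ball (filterI NU (open_nbhs_nbhs (conj (@open_unit_ball R _) disc0))).
pose B := Q * (m%:R * (k + 1) ^+ 2) / r0 ^+ 2 + 1.
have B0 : 0 < B.
  by rewrite ltr_wpDl // divr_ge0 ?mulr_ge0 ?exprn_ge0 // ?addr_ge0 ?(ltW k0) ?(ltW Q_gt0) ?(ltW r0_gt0).
(* The first two entries keep [x] where the expansion is valid and [f x] is in [U]; [B ^- 2] gives B
   |x| <= 1, and 1 / 2 keeps the exponent 3 / 2 + |x|^2 below 4. *)
pose d := Num.min (Num.min (d1 ^+ 2) (d2 ^+ 2)) (Num.min (1 / 2) (B ^- 2)).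
have dp : 0 < d by rewrite !lt_min !exprn_gt0 // invr_gt0 exprn_gt0 // divr_gt0.
exists d => // x /andP[n0]; rewrite !lt_min => /andP[/andP[nd1 nd2] /andP[n12 nB]].
have xd (e : R) : 0 < e -> dot x x < e ^+ 2 -> `|x| < e.
  move=> e0 ne; rewrite -ltr_sqr ?nnegrE ?(ltW e0) //.
  exact: le_lt_trans (norm_le_dot _) ne.
have /H1 := xd _ d10 nd1; rewrite !addr0 mul1r => Hx.
have /H2 := xd _ d20 nd2; rewrite !addr0 => -[Ux dx].
apply: le_trans (energy_le_exp dx) _.
have gx : `|z (f x) - a| <= (k + 1) * `|x|.
  have := kL x; have := ler_normD ((z \o f) x - (z \o f) 0 - 'd (z \o f) 0 x) ('d (z \o f) 0 x).
  rewrite subrK mulrDl mul1r => h1 h2.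
  by apply: le_trans h1 _; rewrite addrC lerD.
have tx : t_ (f x) <= B * dot x x.
  rewrite (pole_ratioE Uz Bw T r0_gt0 zf0 r01 r1_ball Ux).
  apply: (@le_trans _ _ (N x / r0 ^+ 2)); first by rewrite ge_min lexx.
  apply: le_trans (_ : Q * (m%:R * (k + 1) ^+ 2) / r0 ^+ 2 * dot x x <= _); last first.
    by rewrite ler_wpM2r ?dot_ge0 // lerDl.
  rewrite mulrAC ler_wpM2r ?invr_ge0 ?exprn_ge0 ?(ltW r0_gt0) //.
  apply: le_trans (herm_le _ a_rho) _; rewrite -mulrA ler_wpM2l ?(ltW Q_gt0) //.
  apply: le_trans (dot_le_norm _) _.
  rewrite -mulrA ler_wpM2l //.
  apply: le_trans (_ : ((k + 1) * `|x|) ^+ 2 <= _).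
    by rewrite ler_sqr ?nnegrE ?mulr_ge0 ?addr_ge0 // ltW.
  by rewrite exprMn ler_wpM2l ?exprn_ge0 ?addr_ge0 ?(ltW k0) // norm_le_dot.
apply: le_trans (ler_wpM2r (expR_ge0 _) tx) _.
set q := expR (2^-1 * ln (dot x x)).
have q0 : 0 < q by exact: expR_gt0.
have qq : q ^+ 2 = dot x x by exact: expR_half_ln.
have qB : q <= B^-1.
  by rewrite -ler_sqr ?nnegrE ?invr_ge0 ?(ltW q0) ?(ltW B0) // qq exprVn ltW.
have -> : 3 / 2 + (dot x x - 2^-1 * ln (dot x x)) = (3 / 2 + dot x x) + - (2^-1 * ln (dot x x)) by ring.
rewrite expRD expRN -/q -{1}qq.
have -> : B * q ^+ 2 * (expR (3 / 2 + dot x x) / q) = (B * q) * expR (3 / 2 + dot x x).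
  by field; rewrite gt_eqF.
apply: le_trans (_ : 1 * expR (3 / 2 + dot x x) <= _).
  by rewrite ler_wpM2r ?expR_ge0 // mulrC -ler_pdivlMr // div1r.
by rewrite mul1r ler_expR; move: n12; move: (dot x x) => n; lra.
Qed.

Lemma energy_continuous x : disc x -> x != 0 -> {for x, continuous energy}.
Proof.
move=> dx x0; have [fs _ _] := fJ.
have ct : {for x, continuous (t_ \o f)}.
  apply: continuous_comp; first exact: fs.1.
  exact: (@pole_ratio_continuous _ _ _ _ _ _ _ Uopen zC wC Uz Bw T _ _ _ r0_gt0 zf0 r01 r1_ball).
have n0 : 0 < dot x x by rewrite lt0r dot_ge0 andbT; apply: contra_neq x0; exact: dot_eq0.
have cn := @dot_continuous R _ x.
have cl : {for x, continuous (fun y : C2 => ln (dot y y))}.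
  by apply: (@continuous_comp _ _ _ (fun y : C2 => dot y y) (@ln R)) => //; exact: continuous_ln.
have cs : {for x, continuous (fun y => Num.sqrt ((t_ \o f) y))}.
  by apply: (@continuous_comp _ _ _ (t_ \o f) (@Num.sqrt R)) => //; exact: sqrt_continuous.
have ccst (k : R) : {for x, continuous (fun=> k : R)} by exact: cst_continuous.
have cM (k : R) (g : C2 -> R) : {for x, continuous g} -> {for x, continuous (fun y => k * g y)}.
  by move=> cg; exact: (@continuousM _ _ (fun=> k) g x (ccst k) cg).
pose W (y : C2) := 1 - 2 * t_ (f y) + 2 * Num.sqrt (t_ (f y)) + C * u (f y)
    + (dot y y - 2^-1 * ln (dot y y)).
have cW : {for x, continuous W}.
  have cD (g h : C2 -> R) : {for x, continuous g} -> {for x, continuous h} ->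
      {for x, continuous (fun y => g y + h y)} by exact: continuousD.
  have cB (g h : C2 -> R) : {for x, continuous g} -> {for x, continuous h} ->
      {for x, continuous (fun y => g y - h y)} by exact: continuousB.
  apply: (cD (fun y => 1 - 2 * t_ (f y) + 2 * Num.sqrt (t_ (f y)) + C * u (f y))); last first.
    by apply: (cB (fun y : C2 => dot y y)) => //; exact: cM.
  apply: (cD (fun y => 1 - 2 * t_ (f y) + 2 * Num.sqrt (t_ (f y)))); last first.
    exact: (cM C (u \o f) (cont_uf dx)).
  apply: (cD (fun y => 1 - 2 * t_ (f y))); last exact: cM.
  apply: (cB (fun=> 1)); first exact: ccst.
  exact: (cM 2 (t_ \o f) ct).
apply: (@continuousM _ _ (t_ \o f) (expR \o W)) => //.
by apply: continuous_comp => //; exact: continuous_expR.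
Qed.

(** A maximum point on an annulus lies close to 0, on the outer circle, at a zero of the ratio, or
    is an interior local maximum. The first three cases obey the bound and the last is excluded. *)
Lemma energy_le x : dot x x <= 1 / 4 -> energy x <= expR 4.
Proof.
move=> x14; have [d d0 near0] := energy_near0.
have discP (y : C2) : dot y y <= 1 / 4 -> disc y.
  by move=> y14; apply/unit_ballE; move: y14; lra.
have nz (y : C2) : 0 < dot y y -> y != 0.
  by move=> y0; apply: contraTneq y0 => ->; rewrite /dot big1 ?ltxx // => i _; rewrite mxE mul0r.
have [xd|dx] := ltP (dot x x) d.
  have [/dot_eq0 ->|xn] := eqVneq (dot x x) 0.
    by rewrite /energy f0E mul0r expR_ge0.
  by apply: near0; rewrite xd lt0r xn dot_ge0.
(* The inner radius is taken with d / 2 instead of d so that points with |y|^2 = d are interior to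
   the annulus. *)
pose A := [set y : C2 | d / 2 <= dot y y <= 1 / 4].
have d2 : 0 < d / 2 by rewrite divr_gt0.
have d2d : d / 2 < d by move: d0; lra.
have Ax : A x by rewrite /A /= x14 andbT; apply: le_trans dx; exact: ltW.
have cA : compact A.
  apply: (@closed_norm_le_compact _ _ _ 1) => [|y /andP[_ y14]]; last first.
    rewrite -ler_sqr ?nnegrE // expr1n; apply: le_trans (norm_le_dot _) _.
    by move: y14; lra.
  have -> : A = (fun y : C2 => dot y y) @^-1` [set` `[d / 2, 1 / 4]].
    by apply/seteqP; split=> y /=; rewrite in_itv.
  apply: preimage_closed; last exact: itv_closed.
  by move=> y _; exact: dot_continuous.
have cE : {within A, continuous energy}.
  apply: continuous_in_subspaceT => y; rewrite inE => /andP[y1 y2].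
  by apply: energy_continuous; [exact: discP | apply: nz; exact: lt_le_trans y1].
have [y0 y0A y0max] := EVT_max_rV (ex_intro A x Ax) cA cE.
have {}y0max y : A y -> energy y <= energy y0 by move=> Ay; apply: y0max; rewrite inE.
apply: le_trans (y0max _ Ax) _.
move: y0A; rewrite inE => /andP[y01 y02].
have n0 := lt_le_trans d2 y01.
have dy := discP _ y02.
have [yd|ydn] := ltP (dot y0 y0) d; first by apply: near0; rewrite n0 yd.
have [/(energy_boundary dy) //|yn4] := eqVneq (dot y0 y0) (1 / 4).
have yl4 : dot y0 y0 < 1 / 4 by rewrite lt_neqAle yn4.
have Nmax : \forall y \near y0, energy y <= energy y0.
  have c1 : \forall y \near y0, d / 2 < dot y y :=
    @dot_continuous R _ y0 _ (lt_nbhsr (lt_le_trans d2d ydn)).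
  have c2 : \forall y \near y0, dot y y < 1 / 4 := @dot_continuous R _ y0 _ (lt_nbhsl yl4).
  by apply: filterS2 c1 c2 => y y1 y2; apply: y0max; rewrite /A /= !ltW.
have /andP[t0 _] := t_bounds (f y0).
have [t00|tn0] := eqVneq (t_ (f y0)) 0; first by rewrite /energy t00 mul0r expR_ge0.
have tp : 0 < t_ (f y0) by rewrite lt0r tn0.
have [Ky|nKy] := pselect (K (f y0)).
  by case: (no_local_max_inside dy (nz _ n0) Ky tp Nmax).
by case: (no_local_max_outside dy (nz _ n0) nKy Nmax).
Qed.

Hypothesis L_ge0 : 0 <= L.

(** Solves exp (4 + C L) delta = 1/2. It does not depend on the disc and becomes the factor [s] of
    the theorem. *)
Let delta : R := expR (- (4 + C * L)) / 2.

Let delta_bounds : 0 < delta <= 1 / 2.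
Proof.
rewrite divr_gt0 ?expR_gt0 //= ler_pM2r ?invr_gt0 // -expR0 ler_expR.
by rewrite oppr_le0 addr_ge0 // mulr_ge0 // ltW.
Qed.

Let disc_delta (x : C2) : enorm x <= delta -> disc x.
Proof.
by move=> /le_lt_trans; apply; case/andP: delta_bounds => _ h; move: h; lra.
Qed.

(** Since u >= -L on [U] and 1 - 2 t + 2 sqrt t >= 0 for t in [0, 1], the bound on [energy] becomes
    t <= exp (4 + C L) |x|. *)
Lemma pole_ratio_le_half x : enorm x <= delta -> K (f x) -> t_ (f x) <= 1 / 2.
Proof.
move=> xd Kx; have /andP[d0 d12] := delta_bounds.
have [->|x0] := eqVneq x 0; first by rewrite f0E divr_ge0.
have dx := disc_delta xd.
have n0 : 0 < dot x x by rewrite lt0r dot_ge0 andbT; apply: contra_neq x0; exact: dot_eq0.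
have nd : dot x x <= delta ^+ 2 by rewrite -enorm_le_dot // ltW.
have n14 : dot x x <= 1 / 4.
  apply: le_trans nd _; have -> : 1 / 4 = (1 / 2) ^+ 2 :> R by field.
  by rewrite ler_sqr ?nnegrE ?(ltW d0).
have /andP[t0 t1] := t_bounds (f x).
have [Ux _] := (pole_setP Uz Bw T r0_gt0 zf0 r01 r1_ball (f x)).1 Kx.
have ux := u_ge (f_dom dx) Ux.
set q := expR (2^-1 * ln (dot x x)).
have q0 : 0 < q by exact: expR_gt0.
have qd : q <= delta.
  by rewrite -ler_sqr ?nnegrE ?(ltW q0) ?(ltW d0) // expR_half_ln.
have st : 0 <= 1 - 2 * t_ (f x) + 2 * Num.sqrt (t_ (f x)).
  have s0 := sqrtr_ge0 (t_ (f x)); have s2 := sqr_sqrtr t0.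
  have s1 : Num.sqrt (t_ (f x)) <= 1 by rewrite -sqrtr1 ler_sqrt.
  move: s0 s2 s1 t1; move: (t_ (f x)) (Num.sqrt _) => t s s0 <- s1 _.
  have : 0 <= s * (1 - s) by rewrite mulr_ge0 // subr_ge0.
  lra.
have Cu : - (C * L) <= C * u (f x) by rewrite -mulrN ler_pM2l.
have E1 : t_ (f x) * expR (- (C * L) - 2^-1 * ln (dot x x)) <= expR 4.
  apply: le_trans (energy_le n14); rewrite /energy ler_wpM2l // ler_expR.
  move: st Cu n0; move: (dot x x) (ln _) (C * u _) (C * L) (1 - _ + _) => s1 s2 s3 s4 s5; lra.
have E2 : t_ (f x) <= expR (4 + C * L) * q.
  have := ler_wpM2r (expR_ge0 (C * L + 2^-1 * ln (dot x x))) E1.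
  rewrite -mulrA -expRD.
  have -> : - (C * L) - 2^-1 * ln (dot x x) + (C * L + 2^-1 * ln (dot x x)) = 0 by ring.
  by rewrite expR0 mulr1 /q (expRD (C * L)) (expRD 4 (C * L)) -mulrA.
apply: le_trans E2 _; apply: le_trans (ler_wpM2l (expR_ge0 _) qd) _.
by rewrite /delta mulrA -expRD subrr expR0.
Qed.

(** Along the segment from 0 to [x] the ratio is continuous and starts at 0. It is at most 1/2 where
    [f] is in the pole set and 1 elsewhere, so it omits 3/4 and cannot reach 1. *)
Lemma disc_in_pole_set x : enorm x <= delta -> K (f x).
Proof.
move=> xd; have [//|nK] := pselect (K (f x)).
have tn y : ~ K (f y) -> t_ (f y) = 1.
  by move=> nKy; rewrite /pole_ratio; case: asboolP.
have /andP[d0 d12] := delta_bounds; have [fs _ _] := fJ.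
have sx (s : R) : 0 <= s <= 1 -> enorm (s *: x) <= delta.
  move=> /andP[s0 s1]; rewrite enormZ //; apply: le_trans xd.
  by rewrite ler_piMl // enorm_ge0.
pose g (s : R) := t_ (f (s *: x)).
have cg : {within `[0, 1], continuous g}.
  apply: continuous_in_subspaceT => s; rewrite inE /= in_itv => s01.
  have c1 : {for s, continuous (fun s : R => s *: x)}.
    by apply: continuousZr_tmp.
  have c2 : {for s, continuous (f \o (fun s : R => s *: x))}.
    by apply: continuous_comp; [exact: c1 | apply: fs.1; apply: disc_delta; exact: sx].
  apply: (@continuous_comp _ _ _ (f \o (fun s : R => s *: x)) t_); first exact: c2.
  exact: (@pole_ratio_continuous _ _ _ _ _ _ _ Uopen zC wC Uz Bw T _ _ _ r0_gt0 zf0 r01 r1_ball).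
have g0 : g 0 = 0 by rewrite /g scale0r f0E.
have g1 : g 1 = 1 by rewrite /g scale1r tn.
have g01 : Num.min (g 0) (g 1) <= 3 / 4 <= Num.max (g 0) (g 1).
  by rewrite g0 g1 min_l // max_r //; apply/andP; split; lra.
have [s] := IVT ler01 cg g01; rewrite in_itv => s01 gs.
have [Ks|nKs] := pselect (K (f (s *: x))).
  have := pole_ratio_le_half (sx s s01) Ks; rewrite -/(g s) gs; lra.
have := tn _ nKs; rewrite -/(g s) gs; lra.
Qed.

Lemma shrunk_disc : exists g, [/\ J_disc J (D `&` U) g, g 0 = f 0 &
  diff_into S g 0 e1 = delta *: diff_into S f 0 e1].
Proof.
have /andP[d0 d12] := delta_bounds.
have sd (x : C2) : disc x -> enorm (0 + delta *: x) <= delta.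
  move=> dx; rewrite add0r enormZ ?(ltW d0) // ler_piMr ?(ltW d0) //.
  exact: (ltW dx).
have [gJ gd] : J_disc J (D `&` U) (fun x => f (0 + delta *: x)) /\ forall x h, disc x ->
    diff_into S (fun x => f (0 + delta *: x)) x h = delta *: diff_into S f (0 + delta *: x) h.
  apply: (J_disc_affine fJ) => x dx; first exact/disc_delta/sd.
  split; first exact/f_dom/disc_delta/sd.
  by have [] := (pole_setP Uz Bw T r0_gt0 zf0 r01 r1_ball _).1 (disc_in_pole_set (sd x dx)).
have E0 : 0 + delta *: (0 : C2) = 0 by rewrite scaler0 addr0.
exists (fun x => f (0 + delta *: x)); split=> //; first by rewrite E0.
apply: (etrans (gd 0 e1 disc0)).
exact: (congr1 (fun x => delta *: diff_into S f x e1) E0).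
Qed.

End Localization.

(** * The neighbourhood [V] and the conclusion *)

Section CoordinateBall.
Variables (R : realType) (M : topologicalType) (m : nat) (S : manifold R M m).
Variables (U : set M) (z : M -> 'rV[R]_m) (w : 'rV[R]_m -> M).
Hypotheses (Uopen : open U) (zC : forall k, Ck_on S k U z)
  (wC : smooth_into S (@unit_ball R m) w)
  (Uz : forall x, U x -> unit_ball (z x) /\ w (z x) = x)
  (Bw : forall y, unit_ball y -> U (w y) /\ z (w y) = y).

Lemma coordinate_ball_open (r : R) : open (U `&` [set x | `|z x| < r]).
Proof.
rewrite openE => x [Ux zx]; apply: filterI (open_nbhs_nbhs (conj Uopen Ux)) _.
have cn : {for x, continuous ((fun y : 'rV[R]_m => `|y|) \o z)}.
  by apply: continuous_comp; [exact: z_continuous zC _ Ux | exact: norm_continuous].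
exact: (cn _ (lt_nbhsl zx)).
Qed.

(** The image under [w] of the closed ball is compact, hence closed in the Hausdorff space [M], so
    it contains the closure taken in [M]. *)
Lemma coordinate_ball_closure (r : R) :
  (forall y : 'rV[R]_m, `|y| <= r -> unit_ball y) ->
  compact (closure (U `&` [set x | `|z x| < r])) /\
  closure (U `&` [set x | `|z x| < r]) `<=` U.
Proof.
move=> rB; pose A := [set y : 'rV[R]_m | `|y| <= r].
have cA : closed A.
  have -> : A = (fun y : 'rV[R]_m => `|y|) @^-1` [set t | t <= r] by [].
  by apply: preimage_closed; [move=> y _; exact: norm_continuous | exact: closed_le].
have kA : compact (w @` A) by exact: (@image_ball_compact _ _ _ S w wC A r cA (fun y Ay => Ay) rB).
have VA : closure (U `&` [set x | `|z x| < r]) `<=` w @` A.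
  rewrite [X in _ `<=` X](closure_id _).1; last exact: compact_closed (manifold_hausdorff S) kA.
  apply: closureS => x [Ux zx]; exists (z x); last by have [] := Uz Ux.
  exact: ltW.
split; first by apply: subclosed_compact kA VA; exact: closed_closure.
by move=> x /VA [y Ay <-]; have [] := Bw (rB y Ay).
Qed.

End CoordinateBall.

(** A disc in [N] that is admissible for the constant a provides one in [N'] admissible for a / s,
    because its derivative at 0 is multiplied by [s]. *)
Lemma kobayashi_le_of_discs (R : realType) (M : topologicalType) (m : nat)
    (S : manifold R M m) (J : almost_complex S) (N N' : set M) (q : M) (v : 'rV[R]_m) (s : R) :
  0 < s ->
  (forall f, J_disc J N f -> f 0 = q -> exists g, [/\ J_disc J N' g, g 0 = q &
    diff_into S g 0 (cplx 1 0) = s *: diff_into S f 0 (cplx 1 0)]) ->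
  (s%:E * kobayashi J N' q v <= kobayashi J N q v)%E.
Proof.
move=> s0 H; apply: le_ereal_inf_tmp => _ [a [a0 [f [fJ f0 fv]]] <-].
have [g [gJ g0 gv]] := H f fJ f0.
rewrite -[leLHS]/(s%:E * kobayashi J N' q v)%E -lee_pdivlMl //.
apply: ereal_inf_lbound; exists (s^-1 * a) => //; split.
  by rewrite mulr_gt0 ?invr_gt0.
exists g; split=> //; apply: (etrans gv); apply: (etrans (congr1 ( *:%R s) fv)).
by rewrite scalerA invfM invrK.
Qed.

Lemma localization_radii (R : realType) (m : nat) (rho Q : R) : 0 < rho -> 0 < Q ->
  exists r0 r1 : R, [/\ 0 < r0, r0 <= r1 / 2, r1 <= rho, 20 * Q * r0 <= 1 &
    forall y : 'rV[R]_m, `|y| < r1 -> 4 * Q * dot y y <= 1].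
Proof.
move=> rho0 Q0; pose k : R := 1 + 4 * Q * (m%:R + 1).
have m0 : 0 <= m%:R :> R by [].
have k1 : 1 <= k by rewrite lerDl !mulr_ge0 ?addr_ge0 // ltW.
have k0 : 0 < k := lt_le_trans ltr01 k1.
pose r1 := Num.min rho k^-1.
have r10 : 0 < r1 by rewrite lt_min rho0 invr_gt0.
have Q20 : 0 < 20 * Q by rewrite mulr_gt0.
exists (Num.min (r1 / 2) (20 * Q)^-1), r1; split.
- by rewrite lt_min divr_gt0 //= invr_gt0.
- by rewrite ge_min lexx.
- by rewrite ge_min lexx.
- by rewrite mulrC -ler_pdivlMr // div1r ge_min lexx orbT.
move=> y; rewrite lt_min => /andP[_ yk].
have yk' : k * `|y| <= 1 by rewrite mulrC -ler_pdivlMr // div1r ltW.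
have y1 : `|y| <= 1 by apply: le_trans yk'; rewrite ler_peMl.
have y2 : `|y| ^+ 2 <= `|y| by rewrite expr2 ler_piMl.
apply: le_trans (ler_wpM2l _ (dot_le_norm y)) _; first by rewrite mulr_ge0 // ltW.
apply: le_trans (ler_wpM2l _ (ler_wpM2l m0 y2)) _; first by rewrite mulr_ge0 // ltW.
apply: le_trans yk'; rewrite mulrA ler_wpM2r // /k mulrDr mulr1.
by move: Q0; move: (4 * Q * _) => t; lra.
Qed.

Theorem proposition3 (R : realType) (n : nat) (M : topologicalType)
    (S : manifold R M (n + n)) (J : almost_complex S)
    (p : M) (U : set M) (z : M -> 'rV[R]_(n + n))
    (Uopen : open U) (Up : U p) (zadapted : adapted J p U z)
    (c L : R) (c_gt0 : 0 < c) (L_gt0 : 0 < L) :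
  exists (s : R) (V : set M),
    [/\ 0 < s, open V /\ V p, compact (closure V) /\ closure V `<=` U &
      forall (D : set M) (u : M -> R),
        domain D -> closure D p ->
        Ck_on_subset S 2 (closure D) u ->
        (forall x, D x -> u x < 0) ->
        J_psh J D (fun x => (u x)%:E) ->
        (forall x, D x -> U x -> - L <= u x < 0) ->
        J_psh J (D `&` U) (fun x => (u x - c * enorm (z x) ^+ 2)%:E) ->
        forall (q : M) (v : 'rV[R]_(n + n)), D q -> V q ->
          (s%:E * kobayashi J (D `&` U) q v <= kobayashi J D q v)%E].
Proof.
have [zp0 [w [zC wC Uz Bw _]] _] := zadapted.
have [rho [Q [rho0 Q0 rho_ball herm_le disc_le]]] := disc_estimates J Uopen zC wC Uz Bw.
have [r0 [r1 [r00 r01 r1_rho r0_small r1_small]]] := localization_radii (n + n) rho0 Q0.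
have r1_gt0 : 0 < r1 by move: r00 r01; lra.
have r12 : r1 / 2 < r1 by rewrite ltr_pdivrMr // mulr2n mulrDr mulr1 ltrDl.
(* The factor is [delta], in which only c, L and the constants Q, r0 attached to the coordinates
   occur. [V] uses half of r1 so that, as r0 <= r1 / 2, the pole set of each of its points stays in
   the ball of radius r1. *)
exists (expR (- (4 + 10 * Q / (c * r0 ^+ 2) * L)) / 2), (U `&` [set x | `|z x| < r1 / 2]); split.
- by rewrite divr_gt0 ?expR_gt0.
- split; first exact: coordinate_ball_open Uopen zC _.
  by split=> //=; rewrite zp0 normr0 divr_gt0.
- apply: (coordinate_ball_closure wC Uz Bw) => y yr.
  by apply: rho_ball; apply: lt_le_trans r1_rho; exact: le_lt_trans r12.
move=> D u [oD _ _] _ uC u0 uP uL uS q v Dq [Uq zq].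
apply: kobayashi_le_of_discs => [|f fJ f0]; first by rewrite divr_gt0 ?expR_gt0.
have uc x : D x -> {for x, continuous u} by exact: Ck_on_subset_continuous uC oD.
have ug x : D x -> U x -> - L <= u x by move=> Dx Ux; case/andP: (uL x Dx Ux).
rewrite -f0 in Uq zq.
have [g [gJ g0 gv]] := shrunk_disc Uopen zC wC Uz Bw Q0 c_gt0 rho_ball herm_le
  disc_le r00 r01 r1_rho r1_small r0_small oD uc u0 uP ug uS fJ Uq zq (ltW L_gt0).
by exists g; rewrite -f0.
Qed.
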